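(* Let $N\ge 1$, $p>1$, and let $\Omega\subset\mathbb{R}^N$ be a bounded smooth domain. Let $w_1\in\mathcal{A}_p$ and $w_2\in\mathcal{A}_s$ with $p_s>N$ be such that $w_2(x)\le w_1(x)$ for a.e. $x\in\Omega$. Let $f_1,f_2\in L^1(\Omega)$ satisfy $0\le f_1(x)<f_2(x)$ for a.e. $x\in\Omega$. Assume that $u\in W^{1,p}(\Omega,w_1)$ is a weak solution of $$-\operatorname{div}(w_1|\nabla u|^{p-2}\nabla u)=f_1(x)|u|^{p-2}u\ \text{ in }\Omega,\qquad u\ge 0,\ u\not\equiv 0\ \text{ in }\Omega,\qquad u=0\ \text{ on }\partial\Omega.$$ Then any non-trivial weak solution $v\in W^{1,p}(\Omega,w_2)$ of $$-\operatorname{div}(w_2|\nabla v|^{p-2}\nabla v)=f_2(x)|v|^{p-2}v\ \text{ in }\Omega,\qquad v=0\ \text{ on }\partial\Omega$$ must change sign in $\Omega$.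
   Context: A weight on $\Omega$ is a measurable real-valued function that is positive a.e. The class $\mathcal{A}_p$ consists of the weights $a$ on $\Omega$ with $a\in L^1_{loc}(\Omega)$ and $a^{-1/(p-1)}\in L^1_{loc}(\Omega)$. The class $\mathcal{A}_s$ consists of those $a\in\mathcal{A}_p$ for which $a^{-s}\in L^1(\Omega)$ for some $s\ge\frac{1}{p-1}$; for such $s$ put $p_s=\frac{ps}{s+1}$. ''$w_2\in\mathcal{A}_s$ with $p_s>N$'' means that such an $s$ exists for $w_2$ with $p_s>N$. For $w\in\mathcal{A}_p$, $W^{1,p}(\Omega,w)$ is the space of real-valued functions $u$ on $\Omega$ with $\|u\|_{1,p,w}=\left(\int_\Omega|u|^p\,dx+\int_\Omega w|\nabla u|^p\,dx\right)^{1/p}<\infty$ ($\nabla u$ the weak gradient), and $W_0^{1,p}(\Omega,w)$ is the closure of $C_c^\infty(\Omega)$ in this norm. For $i=1,2$, a weak solution $z$ of $-\operatorname{div}(w_i|\nabla z|^{p-2}\nabla z)=f_i(x)|z|^{p-2}z$ in $\Omega$, $z=0$ on $\partial\Omega$, is a function $z\in W_0^{1,p}(\Omega,w_i)$ with $\int_\Omega w_i|\nabla z|^{p-2}\nabla z\cdot\nabla\varphi\,dx=\int_\Omega f_i|z|^{p-2}z\,\varphi\,dx$ for all $\varphi\in W_0^{1,p}(\Omega,w_i)$. To change sign means that neither $v\ge 0$ a.e. in $\Omega$ nor $v\le 0$ a.e. in $\Omega$. *)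

(* Defs.v *)
From HB Require Import structures.
From mathcomp Require Import all_boot all_order all_algebra.
From mathcomp Require Import all_classical all_reals all_analysis.

Set Implicit Arguments.
Unset Strict Implicit.
Unset Printing Implicit Defensive.
Import Order.TTheory GRing.Theory Num.Theory.
Import numFieldNormedType.Exports.
Local Open Scope classical_set_scope.
Local Open Scope ring_scope.

(* Throughout, R^N is 'rV[R]_N with N = n.+1 >= 1.  Its library norm is the
   sup norm: it is used only for topological notions (open, compact, bounded,
   continuous).  Gradients are measured with the Euclidean norm [enorm]. *)

Section lebesgue_outer_measure.
Context (R : realType) (n : nat).
Local Notation E := 'rV[R]_n.+1.

Definition box (ab : E * E) : set E :=
  [set x | forall i, ab.1 0 i < x 0 i <= ab.2 0 i].

(* Some factor is 0 when [box ab] is empty. *)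
Definition box_vol (ab : E * E) : R :=
  \prod_i Num.max 0 (ab.2 0 i - ab.1 0 i).

Definition box_cover (A : set E) : set (nat -> E * E) :=
  [set F | A `<=` \bigcup_k box (F k)].

Local Open Scope ereal_scope.

Definition leb_outer (A : set E) : \bar R :=
  ereal_inf [set \sum_(k <oo) (box_vol (F k))%:E | F in box_cover A].

Let vol_ge0 ab : 0 <= (box_vol ab)%:E.
Proof.
by rewrite lee_fin prodr_ge0// => i _; rewrite le_max lexx.
Qed.

Let leb_outer_ge0 A : 0 <= leb_outer A.
Proof. by apply: le_ereal_inf_tmp => _ [F _ <-]; exact: nneseries_ge0. Qed.

Let leb_outer0 : leb_outer set0 = 0.
Proof.
apply/eqP; rewrite eq_le leb_outer_ge0 andbT.
apply: ereal_inf_lbound; exists (fun=> (0%R, 0%R)) => //.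
apply: eseries0 => k _ _; congr EFin; rewrite /box_vol (bigD1 ord0)//=.
by rewrite subrr maxxx mul0r.
Qed.

Let le_leb_outer : {homo leb_outer : A B / A `<=` B >-> A <= B}.
Proof.
move=> A B AB; apply/ereal_inf_le_tmp => _ [F BF <-]; exists F => //.
exact: subset_trans AB BF.
Qed.

Let leb_outer_sigma_subadditive : sigma_subadditive leb_outer.
Proof.
move=> A; have [[i ioo]|] := pselect (exists i, leb_outer (A i) = +oo).
  by rewrite (eseries_pinfty _ _ ioo) ?leey// => k _; rewrite -ltNye
    (lt_le_trans _ (leb_outer_ge0 _)).
rewrite -forallNE => Aoo.
suff add2e (e : {posnum R}) :
    leb_outer (\bigcup_n A n) <= \sum_(i <oo) leb_outer (A i) + e%:num%:E.
  by apply/lee_addgt0Pr => _/posnumP[].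
rewrite (le_trans _ (epsilon_trick _ _ _))//.
pose P k (F : nat -> E * E) := box_cover (A k) F /\
  \sum_(j <oo) (box_vol (F j))%:E
    <= leb_outer (A k) + (e%:num / (2 ^ k.+1)%:R)%:E.
have [G PG] : {G : nat -> nat -> E * E & forall k, P k (G k)}.
  apply: (@choice _ _ P) => k; rewrite /P.
  have en1 : (0 < e%:num / (2 ^ k.+1)%:R)%R by [].
  have fA : leb_outer (A k) \is a fin_num.
    by rewrite ge0_fin_numE// ltey; apply/eqP; exact: Aoo.
  have [x [F AF <-] xS] := lb_ereal_inf_adherent en1 fA.
  by exists F; split => //; exact: ltW.
pose v (ij : nat * nat) := (box_vol (G ij.1 ij.2))%:E.
apply: (@le_trans _ _ (\esum_(ij in setT) v ij)).
  apply: ereal_inf_lbound => /=.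
  have /card_esym/ppcard_eqP[f] := card_nat2.
  exists (fun k => G (f k).1 (f k).2).
    move=> t [i _ /(PG i).1[j _ Gt]]; exists (f^-1%FUN (i, j)) => //=.
    by rewrite invK ?inE.
  rewrite -(esum_pred_image v _ xpredT) ?[fun=> _]set_true//; last first.
    by move=> ? _; exact: vol_ge0.
  by rewrite image_eq.
rewrite (_ : esum _ _ = \sum_(i <oo) \sum_(j <oo) v (i, j)); last first.
  pose J : nat -> set (nat * nat) := fun i => [set (i, j) | j in setT].
  rewrite (_ : setT = \bigcup_k J k); last first.
    by rewrite predeqE => -[a b]; split => // _; exists a => //; exists b.
  rewrite esum_bigcupT /=; last 2 first.
    - apply/trivIsetP => i j _ _ ij.
      rewrite predeqE => -[k m] /=; split => //= -[] [_] _ [<-{k} _].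
      by move=> [m' _] [] /esym/eqP; rewrite (negbTE ij).
    - by move=> ?; exact: vol_ge0.
  rewrite -(image_id [set: nat]) -fun_true esum_pred_image//; last first.
    by move=> k _; apply: esum_ge0 => *; exact: vol_ge0.
  apply: eq_eseriesr => /= j _.
  rewrite -(esum_pred_image v (pair j) predT)//=; last 2 first.
    by move=> ? _; exact: vol_ge0.
    by move=> ? ? _ _; exact: (@can_inj _ _ _ snd).
  by congr esum; rewrite predeqE => -[a b]; split; move=> [i _ <-]; exists i.
apply: lee_nneseries => [i _ _|i _]; last exact: (PG i).2.
by apply: nneseries_ge0 => *; exact: vol_ge0.
Qed.

HB.instance Definition _ := isOuterMeasure.Build R E leb_outer
  leb_outer0 leb_outer_ge0 le_leb_outer leb_outer_sigma_subadditive.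

End lebesgue_outer_measure.

(* N-dimensional Lebesgue measure, on the sigma-algebra of all Lebesgue
   measurable sets (in the sense of Caratheodory; it is complete) *)
Definition leb (R : realType) (n : nat) :
    set (caratheodory_type (@leb_outer R n)) -> \bar R := @leb_outer R n.

HB.instance Definition _ (R : realType) (n : nat) :=
  isMeasure.Build _ _ _ (@leb R n)
    (@caratheodory_measure0 _ _ (@leb_outer R n))
    (@caratheodory_measure_ge0 _ _ (@leb_outer R n))
    (@caratheodory_measure_sigma_additive _ _ (@leb_outer R n)).

Section smooth_functions.
Context (R : realType) (n : nat).
Local Notation E := 'rV[R]_n.+1.
Implicit Types (U K Omega : set E) (f phi u : E -> R).

Definition partial (i : 'I_n.+1) f : E -> R :=
  fun x => 'D_(delta_mx 0 i) (f : E -> R^o) x.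

Definition grad f : E -> E := fun x => \row_i partial i f x.

(* f is of class C^k on the open set U *)
Fixpoint class_C (k : nat) U f : Prop :=
  (forall x, U x -> {for x, continuous f}) /\
  if k is k'.+1 then
    forall i, (forall x, U x -> derivable (f : E -> R^o) x (delta_mx 0 i)) /\
      class_C k' U (partial i f)
  else True.

Definition smooth_on U f := forall k, class_C k U f.

(* C_c^oo(Omega), each function being extended by zero outside Omega *)
Definition test_function Omega phi :=
  [/\ smooth_on setT phi,
      compact (closure [set x | phi x != 0]) &
      closure [set x | phi x != 0] `<=` Omega].

(* Near each of its boundary points, Omega is a sublevel set of a C^oo
   function with nonvanishing gradient. *)
Definition smooth_boundary Omega :=
  forall x0, (closure Omega `\` interior Omega) x0 ->
    exists (U : set E) (rho : E -> R),
      [/\ open U, U x0, smooth_on U rho, grad rho x0 != 0 &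
          Omega `&` U = [set x | U x /\ rho x < 0]].

Definition bounded_smooth_domain Omega :=
  [/\ open Omega, Omega !=set0, connected Omega, bounded_set Omega &
      smooth_boundary Omega].

End smooth_functions.

Section weighted_sobolev.
Context (R : realType) (n : nat).
Local Notation E := 'rV[R]_n.+1.
Local Notation X := (caratheodory_type (@leb_outer R n)).
Local Notation mu := (@leb R n).

Definition dot (x y : E) : R := \sum_i x 0 i * y 0 i.

Definition enorm (x : E) : R := Num.sqrt (dot x x).

Variable Omega : set E.

Definition ae_in (P : E -> Prop) := {ae mu, forall x : X, Omega x -> P x}.

Definition L1 (f : E -> R) := mu.-integrable (Omega : set X) (EFin \o f).

Definition L1loc (f : E -> R) :=
  measurable_fun (Omega : set X) (f : X -> R) /\
  forall K : set E, compact K -> K `<=` Omega ->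
    mu.-integrable (K : set X) (EFin \o f).

Definition weight (a : E -> R) :=
  measurable_fun (Omega : set X) (a : X -> R) /\ ae_in (fun x => 0 < a x).

Variable p : R.

Definition class_A (a : E -> R) :=
  [/\ weight a, L1loc a & L1loc (fun x => a x `^ (- (p - 1)^-1))].

(* the exponents s witnessing that a, in class_A, belongs to the class A_s *)
Definition As_exponent (a : E -> R) (s : R) :=
  (p - 1)^-1 <= s /\ L1 (fun x => a x `^ (- s)).

Definition class_As (a : E -> R) :=
  class_A a /\ exists s, As_exponent a s.

(* p_s *)
Definition p_sub (s : R) : R := p * s / (s + 1).

Definition weak_gradient (u : E -> R) (g : E -> E) :=
  [/\ L1loc u, forall i, L1loc (fun x => g x 0 i) &
      forall phi, test_function Omega phi -> forall i,
        (\int[mu]_(x in (Omega : set X)) (u x * partial i phi x)%:E =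
         - \int[mu]_(x in (Omega : set X)) (g x 0 i * phi x)%:E)%E].

Variable w : E -> R.

(* ||u||_{1,p,w}, where g is the weak gradient of u *)
Definition sobolev_norm (u : E -> R) (g : E -> E) : \bar R :=
  ((\int[mu]_(x in (Omega : set X)) (`|u x| `^ p)%:E +
    \int[mu]_(x in (Omega : set X)) (w x * enorm (g x) `^ p)%:E) `^ p^-1)%E.

(* Weak gradients are only defined up to null sets, so the spaces are presented
   by the relation "u belongs to the space and g is its weak gradient". *)
Definition W1p (u : E -> R) (g : E -> E) :=
  weak_gradient u g /\ (sobolev_norm u g < +oo)%E.

Definition W1p0 (u : E -> R) (g : E -> E) :=
  W1p u g /\
  forall e : R, 0 < e -> exists2 phi, test_function Omega phi &
    (sobolev_norm (u \- phi)%R (g \- grad phi)%R < e%:E)%E.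

(* At points where g x = 0 (resp. u x = 0), the factor `^ (p - 2) is
   multiplied by 0, so that |0|^(p-2) 0 = 0 also for p < 2. *)
Definition weak_solution (f u : E -> R) :=
  exists2 g, W1p0 u g &
    forall phi h, W1p0 phi h ->
      (\int[mu]_(x in (Omega : set X))
         (w x * (enorm (g x) `^ (p - 2) * dot (g x) (h x)))%:E =
       \int[mu]_(x in (Omega : set X))
         (f x * (`|u x| `^ (p - 2) * u x) * phi x)%:E)%E.

Definition changes_sign (v : E -> R) :=
  ~ ae_in (fun x => 0 <= v x) /\ ~ ae_in (fun x => v x <= 0).

End weighted_sobolev.

(* Main.v *)
Require Import Defs.
From mathcomp Require Import all_boot all_order all_algebra.
From mathcomp Require Import all_classical all_reals all_analysis.
From mathcomp Require Import measurable_realfun ring lra.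

Set Implicit Arguments.
Unset Strict Implicit.
Unset Printing Implicit Defensive.
Import Order.TTheory GRing.Theory Num.Theory.
Import numFieldNormedType.Exports.
Local Open Scope classical_set_scope.
Local Open Scope ring_scope.

(** Suppose that v does not change sign; replacing v by - v, let v >= 0. The
    proof compares u with v through Picone's inequality
      |grad v|^(p-2) grad v . grad (|phi|^p / v^(p-1)) <= |grad phi|^p,
    which, once the equation of v has been tested with |phi|^p / v^(p-1), says
    that the integral of f2 |phi|^p is at most that of w2 |grad phi|^p. If v is
    positive almost everywhere, this may be used for phi = u, and with
    w2 <= w1 and the equation of u it gives
      int f2 |u|^p <= int w2 |grad u|^p <= int w1 |grad u|^p = int f1 |u|^p,
    which is absurd because f1 < f2 and u is not zero
    ([no_positive_solution]).

    Two points need work. The first is that |phi|^p / v^(p-1) need not be an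
    admissible test function. Here phi is a test function, |phi|^p is replaced
    by the smooth function [smooth_pow] of phi, and v by [profile] (m v) / m,
    which is bounded below by 1 / m and tends to v as m grows. Membership of
    the resulting function in W_0^(1,p)(Omega, w2) follows from a chain rule
    ([W1p0_chain]), proved by composing the test functions that approximate v.
    The outcome is [weighted_picone]. A parameter lam in Young's inequality
    allows for keeping a part of the energy of log v on the left-hand side.

    The second is that v is positive almost everywhere ([solution_positive]).
    The bound on the energy of log v shows that the indicator function of the
    set {v != 0} has weak gradient 0 ([nonzero_set_derivative]): it is
    approximated by functions of v whose gradients are at most 2 s |grad log v|
    with s as small as desired. A set with this property meets any two
    translates of a small box in the same measure ([measure_box_translate]),
    so its measure in boxes is proportional to the volume, and covering by
    boxes shows that it is null or full in each small box ([box_dichotomy]).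
    As Omega is connected and v is not zero, {v != 0} has full measure.

    Domination of the approximating sequences rests on the inequality
    y <= w y^p + w^(-1/(p-1)) ([young_weight]) and on the local integrability
    of w^(-1/(p-1)). *)

(** * Lebesgue measure on R^N *)

Section lebesgue_measure.
Context (R : realType) (n : nat).
Local Notation E := 'rV[R]_n.+1.
Local Notation X := (caratheodory_type (@leb_outer R n)).
Local Notation mu := (@leb R n).

Lemma leb_outer_cover_le (A : set E) F : box_cover A F ->
  (leb_outer A <= \sum_(k <oo) (box_vol (F k))%:E)%E.
Proof. by move=> AF; apply: ereal_inf_lbound; exists F. Qed.

Lemma leb_box_le (ab : E * E) : (mu (box ab) <= (box_vol ab)%:E)%E.
Proof.
apply: ereal_inf_lbound.
exists (fun k => if k == 0%N then ab else (0, 0)).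
  by move=> x abx; exists 0%N.
rewrite (nneseriesD1 (n := 0%N))//=; last first.
  by move=> k _; rewrite lee_fin prodr_ge0// => i _; rewrite le_max lexx.
rewrite eseries0 ?adde0// => k _ /= /negbTE ->.
by rewrite /box_vol (bigD1 ord0)//= subrr maxxx mul0r.
Qed.

(** A hyperplane cuts each box of a covering into two boxes whose volumes add
    up, so half-spaces satisfy the Caratheodory condition. *)
Lemma measurable_coord_le (i : 'I_n.+1) (c : R) :
  measurable [set x : X | (x : E) 0 i <= c].
Proof.
apply: le_caratheodory_measurable => S; apply: le_ereal_inf_tmp => _ [F SF <-].
pose lo (ab : E * E) : E * E :=
  (ab.1, \row_j if j == i then Num.min (ab.2 0 j) c else ab.2 0 j).
pose hi (ab : E * E) : E * E :=
  (\row_j if j == i then Num.max (ab.1 0 j) c else ab.1 0 j, ab.2).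
have vol_ge0 ab : (0 <= (@box_vol R n ab)%:E)%E.
  by rewrite lee_fin prodr_ge0// => j _; rewrite le_max lexx.
have volD ab : ((box_vol ab)%:E = (box_vol (lo ab))%:E + (box_vol (hi ab))%:E)%E.
  rewrite -EFinD; congr EFin; rewrite /box_vol !(bigD1 (P := xpredT) i)//= !mxE eqxx.
  rewrite [X in _ = _ * X + _](eq_bigr (fun j => Num.max 0 (ab.2 0 j - ab.1 0 j))); last first.
    by move=> j /negbTE ji; rewrite mxE ji.
  rewrite [X in _ = _ + _ * X](eq_bigr (fun j => Num.max 0 (ab.2 0 j - ab.1 0 j))); last first.
    by move=> j /negbTE ji; rewrite mxE ji.
  rewrite -mulrDl; congr (_ * _).
  move: (ab.1 0 i) (ab.2 0 i) => a b.
  rewrite !maxEle !minEle.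
  by repeat case: ifPn; lra.
rewrite (eq_eseriesr (fun k _ => volD (F k))) nneseriesD//.
apply: leeD.
- apply: (@leb_outer_cover_le _ (lo \o F)). move=> x [/SF[k _ Fkx] xc].
  exists k => //= j; rewrite !mxE; case: eqP => [->|_]; last exact: Fkx.
  by have /andP[-> ?] := Fkx i; rewrite le_min/=; apply/andP.
- apply: (@leb_outer_cover_le _ (hi \o F)) => x [/SF[k _ Fkx] /negP].
  rewrite -ltNge => cx.
  exists k => //= j; rewrite !mxE; case: eqP => [->|_]; last exact: Fkx.
  by have /andP[? ->] := Fkx i; rewrite gt_max andbT; apply/andP.
Qed.

Lemma measurable_box (ab : E * E) : measurable (box ab : set X).
Proof.
have -> : box ab = \bigcap_(i in [set: 'I_n.+1])
    ([set x : E | x 0 i <= ab.2 0 i] `&` ~` [set x : E | x 0 i <= ab.1 0 i]).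
  apply/seteqP; split => x /= abx i; have := abx i.
    by move=> /andP[ax ?] _; split=> //=; apply/negP; rewrite -ltNge.
  by move=> /(_ I)[/= -> /negP]; rewrite -ltNge => ->.
apply: fin_bigcap_measurable => // i _; apply: measurableI.
  exact: measurable_coord_le.
exact/measurableC/measurable_coord_le.
Qed.

(** These countably many boxes are a base of neighbourhoods, up to their
    boundaries. *)
Definition rational_box (k : nat) : E * E :=
  if (unpickle k : option ('rV[rat]_n.+1 * 'rV[rat]_n.+1)) is Some ab
  then (map_mx ratr ab.1, map_mx ratr ab.2) else (0, 0).

Lemma open_rational_box (U : set E) (x : E) : open U -> U x ->
  exists2 k, box (rational_box k) x & box (rational_box k) `<=` U.
Proof.
move=> oU Ux; have /nbhs_ballP[e /= e0 eU] := open_nbhs_nbhs (conj oU Ux).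
have /choice[a aP] : forall i : 'I_n.+1, exists q : rat, x 0 i - e < ratr q < x 0 i.
  move=> i; have [|q /=] := @rat_in_itvoo R (x 0 i - e) (x 0 i); first by rewrite ltrBlDr ltrDl.
  by rewrite in_itv /=; exists q.
have /choice[b bP] : forall i : 'I_n.+1, exists q : rat, x 0 i < ratr q < x 0 i + e.
  move=> i; have [|q /=] := @rat_in_itvoo R (x 0 i) (x 0 i + e); first by rewrite ltrDl.
  by rewrite in_itv /=; exists q.
exists (pickle (\row_i a i, \row_i b i)); rewrite /rational_box pickleK.
  move=> i /=; rewrite !mxE; have /andP[_ ->] := aP i.
  by have /andP[/ltW] := bP i.
move=> y aby; apply: eU; split => // i j; rewrite ord1 /=.
have := aby j; rewrite !mxE => /andP[ay yb].
have /andP[xa _] := aP j; have /andP[_ bx] := bP j.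
rewrite /ball/= ltr_distlC; apply/andP; split; first exact: lt_trans ay.
exact: le_lt_trans bx.
Qed.

Lemma measurable_open (U : set E) : open U -> measurable (U : set X).
Proof.
move=> oU.
have -> : U = \bigcup_(k in [set k | box (rational_box k) `<=` U]) box (rational_box k).
  apply/seteqP; split => [x Ux|x [k /= kU]]; last exact: kU.
  by have [k kx kU] := open_rational_box oU Ux; exists k.
by apply: bigcup_measurable => k _; exact: measurable_box.
Qed.

Lemma measurable_closed (K : set E) : closed K -> measurable (K : set X).
Proof. by move=> cK; rewrite -(setCK K); apply/measurableC/measurable_open/closed_openC. Qed.

Lemma measurable_fun_continuous (f : E -> R) : continuous f ->
  measurable_fun [set: X] (f : X -> R).
Proof.
move=> cf; apply: (measurability _ (RGenOpens.measurableE R)).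
move=> _ [_ [a [b ->] <-]]; rewrite setTI; apply: measurable_open.
by move/continuousP: cf; apply; exact: interval_open.
Qed.

Definition shift_by (y : E) : E -> E := fun x => x + y.

Let leb_shift_le (y : E) (A : set E) :
  (leb_outer (shift_by y @^-1` A) <= leb_outer A)%E.
Proof.
apply: le_ereal_inf_tmp => _ [F AF <-].
pose G k : E * E := ((F k).1 - y, (F k).2 - y).
have -> : (\sum_(k <oo) (box_vol (F k))%:E = \sum_(k <oo) (box_vol (G k))%:E)%E.
  apply: eq_eseriesr => k _; congr EFin; apply: eq_bigr => i _.
  by rewrite /= !mxE; congr (Num.max _ _); lra.
apply: leb_outer_cover_le => x /= /AF[k _ Fk]; exists k => // i.
by have := Fk i; rewrite !mxE ltrBlDr lerBrDr.
Qed.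

Lemma leb_shift (y : E) (A : set E) : leb_outer (shift_by y @^-1` A) = leb_outer A.
Proof.
apply/eqP; rewrite eq_le leb_shift_le/=.
have := leb_shift_le (- y) (shift_by y @^-1` A).
congr (_ <= _)%E; congr leb_outer.
by apply/seteqP; split => x /=; rewrite /shift_by /= subrK.
Qed.

Lemma measurable_shift (y : E) : measurable_fun [set: X] (shift_by y : X -> X).
Proof.
move=> _ A mA; rewrite setTI.
change (caratheodory_measurable (@leb_outer R n) (shift_by y @^-1` A)) => S.
have e : S = shift_by y @^-1` (shift_by (- y) @^-1` S).
  by apply/seteqP; split => x /=; rewrite /shift_by /= addrK.
rewrite e preimage_setC -!preimage_setI.
by rewrite (leb_shift y) (leb_shift y) (leb_shift y); exact: mA.
Qed.

(** Translating a covering by boxes does not change its total volume. *)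
Lemma integral_shift (y : E) (f : E -> R) :
  mu.-integrable [set: X] (EFin \o f) ->
  mu.-integrable [set: X] (EFin \o (f \o shift_by y)) /\
  (\int[mu]_x (f (x + y))%:E = \int[mu]_x (f x)%:E)%E.
Proof.
move=> intf.
have mf := measurable_int _ intf.
have ms := measurable_shift y.
have H : mu.-integrable [set: X] (EFin \o (f \o shift_by y)).
  apply/integrableP; split.
    have /measurable_EFinP mf' := mf; apply/measurable_EFinP.
    exact: (measurableT_comp mf' ms).
  have /integrableP[_] := intf; apply: le_lt_trans.
  rewrite (_ : (\int[mu]_x `|(EFin \o f) x| = \int[pushforward mu (shift_by y : X -> X)]_x `|(EFin \o f) x|)%E).
    by rewrite ge0_integral_pushforward//; exact/measurableT_comp.
  by apply/esym/eq_measure_integral => A mA _; exact: leb_shift.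
split => //.
have := integral_pushforward (mu := mu) ms mf H measurableT.
rewrite preimage_setT => <-.
by apply: eq_measure_integral => A mA _; exact: leb_shift.
Qed.

Lemma mx_norm_coord (x : E) i : `|x 0 i| <= `|x|.
Proof.
by rewrite [leRHS]/Num.norm/= mx_normrE; apply: (@le_bigmax _ _ _ 0 (fun ij : 'I_1 * 'I_n.+1 => `|x ij.1 ij.2|) (0, i)).
Qed.

Lemma bounded_sub_box (A : set E) : bounded_set A ->
  exists2 M, 0 < M & A `<=` box (const_mx (- M), const_mx M).
Proof.
move=> /pinfty_ex_gt0[M M0 AM]; exists (M + 1); first by rewrite addr_gt0.
move=> x /AM/= xM i; rewrite !mxE /=; have := le_trans (mx_norm_coord x i) xM.
by rewrite ler_norml; lra.
Qed.

Lemma bounded_leb_lty (A : set E) : bounded_set A -> (mu A < +oo)%E.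
Proof.
move=> /bounded_sub_box[M _ AM].
apply: (@le_lt_trans _ _ (mu (box (const_mx (- M), const_mx M)))).
  exact: (@le_outer_measure _ _ (@leb_outer R n)).
by rewrite (le_lt_trans (leb_box_le _))// ltry.
Qed.

(** The whole space is a countable union of translates of one box. *)
Lemma leb_null_box (a b : E) : (forall i, a 0 i < b 0 i) ->
  mu (box (a, b)) = 0%E -> forall A : set E, leb_outer A = 0%E.
Proof.
move=> ab box0 A.
pose z_ (k : nat) : E :=
  if (unpickle k : option 'rV[int]_n.+1) is Some z
  then \row_i ((z 0 i)%:~R * (b 0 i - a 0 i)) else 0.
have sub : A `<=` \bigcup_k (shift_by (z_ k) @^-1` box (a, b)).
  move=> x _.
  (* the integer translate that moves x 0 i into the half-open side of the box *)
  exists (pickle (\row_i (1 - Num.ceil ((x 0 i - a 0 i) / (b 0 i - a 0 i))))) => // i.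
  rewrite /z_ pickleK /shift_by !mxE /=.
  set q := (x 0 i - a 0 i) / _; have d0 : 0 < b 0 i - a 0 i by rewrite subr_gt0.
  have xE : x 0 i = a 0 i + q * (b 0 i - a 0 i) by rewrite divfK ?gt_eqF// subrKC.
  rewrite xE rmorphB/=; have := ceil_itv q; rewrite intrD; case/andP.
  move: (b 0 i) (a 0 i) d0 ((Num.ceil q)%:~R : R) => B A0 d0 c.
  by rewrite intrN => h1 h2; apply/andP; split; nra.
apply/eqP; rewrite eq_le outer_measure_ge0 andbT.
apply: le_trans (le_outer_measure (@leb_outer R n) _ _ sub) _.
apply: le_trans (outer_measure_sigma_subadditive (@leb_outer R n) _) _.
by rewrite eseries0// => k _ _; exact: (etrans (leb_shift _ _) box0).
Qed.

End lebesgue_measure.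

(** * Calculus of smooth functions *)

Section smooth_calculus.
Context (R : realType) (n : nat).
Local Notation E := 'rV[R]_n.+1.
Implicit Types (f g phi xi : E -> R) (x v : E) (H : R -> R).

(** A directional derivative is an ordinary derivative along a line; this is
    how one-variable rules are transported to R^N. *)
Lemma is_derive_line f x v (t df : R) :
  is_derive (x + t *: v) v (f : E -> R^o) df <->
  is_derive t 1 (fun s : R => f (x + s *: v) : R^o) df.
Proof.
have e : (fun h : R => h^-1 *: ((f \o shift (x + t *: v)) (h *: v) - f (x + t *: v)) : R^o) =
    (fun h : R => h^-1 *: (((fun s : R => f (x + s *: v) : R^o) \o shift t) (h *: 1) - f (x + t *: v))).
  apply/funext => h /=; congr (_ *: (f _ - _)).
  by rewrite [h *: 1]mulr1 scalerDl addrCA.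
by split => -[d1 d2]; split; move: d1 d2; rewrite /derivable /derive e.
Qed.

Lemma is_derive_comp f H x v (df dH : R) :
  is_derive x v (f : E -> R^o) df -> is_derive (f x) 1 H dH ->
  is_derive x v (H \o f : E -> R^o) (dH * df).
Proof.
move=> Df DH; have e : x = x + 0 *: v by rewrite scale0r addr0.
rewrite {1}e; apply/is_derive_line.
rewrite e in Df; move/is_derive_line in Df.
by apply: is_derive1_comp; rewrite -e.
Qed.

Lemma class_CW k f : class_C k.+1 setT f -> class_C k setT f.
Proof.
elim: k f => [|k IH] f; first by case=> ? _; split.
by move=> [cf Df]; split => // i; split; [exact: (Df i).1|apply: IH; exact: (Df i).2].
Qed.

Lemma class_C_step k f (df : 'I_n.+1 -> E -> R) : continuous f ->
  (forall i x, is_derive x (delta_mx 0 i) (f : E -> R^o) (df i x)) ->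
  (forall i, class_C k setT (df i)) -> class_C k.+1 setT f.
Proof.
move=> cf Df Cdf; split => [x _|i]; first exact: cf.
split=> [x _|]; first by have [] := Df i x.
by rewrite (_ : partial i f = df i)//; apply/funext => x; have [] := Df i x.
Qed.

Lemma class_C_continuous k f : class_C k setT f -> continuous f.
Proof. by case: k => [|k] [cf _] x; exact: cf. Qed.

Lemma class_C_is_derive k f i x : class_C k.+1 setT f ->
  is_derive x (delta_mx 0 i) (f : E -> R^o) (partial i f x).
Proof. by move=> [_ Df]; apply: derivableP; exact: (Df i).1. Qed.

Lemma class_C_partial k f i : class_C k.+1 setT f -> class_C k setT (partial i f).
Proof. by move=> [_ Df]; exact: (Df i).2. Qed.

Lemma class_C_cst k (c : R) : class_C k setT (fun _ : E => c).
Proof.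
elim: k c => [|k IH] c; first by split=> // x _; exact: cst_continuous.
apply: (@class_C_step _ _ (fun _ _ => 0)) => //; first exact: cst_continuous.
Qed.

Lemma class_C_coord k i : class_C k setT (fun x : E => x 0 i).
Proof.
case: k => [|k]; first by split=> // x _; exact: coord_continuous.
apply: (@class_C_step _ _ (fun j _ => (i == j)%:R)) => //.
- by move=> x; exact: coord_continuous.
- move=> j x; have e : x = x + 0 *: delta_mx 0 j by rewrite scale0r addr0.
  rewrite e; apply/is_derive_line.
  rewrite (_ : (fun s : R => _) = cst (x 0 i) + (i == j)%:R \*: id); last first.
    by apply/funext => s /=; rewrite !mxE/= mulrC eq_sym.
  by apply: is_derive_eq; rewrite add0r [_ *: _]mulr1.
by move=> j; exact: class_C_cst.
Qed.

Lemma class_CD k f g : class_C k setT f -> class_C k setT g ->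
  class_C k setT (fun x => f x + g x).
Proof.
elim: k f g => [|k IH] f g Cf Cg.
  by split=> // x _; apply: continuousD; [exact: (class_C_continuous Cf)|exact: (class_C_continuous Cg)].
apply: (@class_C_step _ _ (fun i x => partial i f x + partial i g x)).
- by move=> x; apply: continuousD; [exact: (class_C_continuous Cf)|exact: (class_C_continuous Cg)].
- by move=> i x; apply: is_deriveD; [exact: (class_C_is_derive _ _ Cf)|exact: (class_C_is_derive _ _ Cg)].
- by move=> i; apply: IH; exact: class_C_partial.
Qed.

Lemma class_CM k f g : class_C k setT f -> class_C k setT g ->
  class_C k setT (fun x => f x * g x).
Proof.
elim: k f g => [|k IH] f g Cf Cg.
  by split=> // x _; apply: continuousM; [exact: (class_C_continuous Cf)|exact: (class_C_continuous Cg)].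
apply: (@class_C_step _ _ (fun i x => f x * partial i g x + g x * partial i f x)).
- by move=> x; apply: continuousM; [exact: (class_C_continuous Cf)|exact: (class_C_continuous Cg)].
- by move=> i x; apply: is_deriveM; [exact: (class_C_is_derive _ _ Cf)|exact: (class_C_is_derive _ _ Cg)].
- by move=> i; apply: class_CD; apply: IH; (exact: class_CW || exact: class_C_partial).
Qed.

(** [H j] stands for the j-th derivative of a one-variable function, on a set
    [D] that contains the values of [f]: each step of the induction replaces
    [H j] by [H j.+1]. *)
Lemma class_C_comp (D : set R) (H : nat -> R -> R) :
  (forall j y, D y -> is_derive y 1 (H j) (H j.+1 y)) ->
  forall k j f, (forall x, D (f x)) -> class_C k setT f ->
  class_C k setT (H j \o f).
Proof.
move=> DH.
have cH j f : (forall x, D (f x)) -> continuous f -> continuous (H j \o f).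
  move=> Df cf x; apply: continuous_comp; first exact: cf.
  by apply/differentiable_continuous/derivable1_diffP; have [] := DH j _ (Df x).
elim=> [|k IH] j f Df Cf.
  by split=> // x _; apply: cH => //; exact: class_C_continuous Cf.
apply: (@class_C_step _ _ (fun i x => (H j.+1 \o f) x * partial i f x)).
- by apply: cH => //; exact: class_C_continuous Cf.
- move=> i x; apply: is_derive_comp; [exact: (class_C_is_derive _ _ Cf)|exact: DH].
- by move=> i; apply: class_CM; [apply: IH => //; exact: class_CW|exact: class_C_partial].
Qed.

Lemma smooth_is_derive f i x : smooth_on setT f ->
  is_derive x (delta_mx 0 i) (f : E -> R^o) (partial i f x).
Proof. by move=> /(_ 1%N); exact: class_C_is_derive. Qed.

Lemma smooth_continuous f : smooth_on setT f -> continuous f.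
Proof. by move=> /(_ 0%N); exact: class_C_continuous. Qed.

Lemma smooth_partial f i : smooth_on setT f -> smooth_on setT (partial i f).
Proof. by move=> Sf k; apply: class_C_partial; exact: Sf. Qed.

Lemma smooth_powR f (a : R) : (forall x, 0 < f x) -> smooth_on setT f ->
  smooth_on setT (fun x => f x `^ a).
Proof.
move=> f0 Sf k.
(* the j-th derivative of y ^ a is a (a - 1) ... (a - j + 1) y ^ (a - j) *)
pose c (j : nat) := \prod_(l < j) (a - l%:R).
pose H (j : nat) (y : R) := c j * y `^ (a - j%:R).
rewrite (_ : (fun x => _) = H 0%N \o f); last first.
  by apply/funext => x; rewrite /H /c /= big_ord0 mul1r subr0.
apply: (@class_C_comp [set y | 0 < y]) => // j y /= y0.
have yI : y \in `]0, +oo[ by rewrite in_itv/= y0.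
have d : is_derive y 1 (@powR R ^~ (a - j%:R)) ((a - j%:R) * y `^ (a - j%:R - 1)).
  split; first exact: derivable_powR.
  by rewrite -derive1E powR_derive1.
rewrite (_ : H j = c j \*: (@powR R ^~ (a - j%:R)))//.
apply: is_derive_eq.
by rewrite /H /c big_ord_recr/= -[_ *: _]/(_ * _) mulrA -natr1 opprD addrA.
Qed.

End smooth_calculus.

(** * Smooth bumps on boxes *)

Section bump.
Context (R : realType) (n : nat).
Local Notation E := 'rV[R]_n.+1.
Implicit Types (f g phi xi : E -> R) (Omega : set E).

Lemma exprn_le_expR k (u : R) : 0 <= u -> u ^+ k.+1 <= k.+1%:R ^+ k.+1 * expR u.
Proof.
move=> u0; have k0 : 0 < k.+1%:R :> R by rewrite ltr0n.
have -> : expR u = expR (u / k.+1%:R) ^+ k.+1.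
  by rewrite -expRM_natl mulrC divfK// gt_eqF.
rewrite -exprMn lerXn2r ?nnegrE ?mulr_ge0 ?expR_ge0// -ler_pdivrMl// mulrC.
by apply: le_trans (expR_ge1Dx _); rewrite ler_wpDl.
Qed.

(** With [u = 1 / y], this says that P(1 / y) exp(- 1 / y) is O(y ^ 2) as y
    decreases to 0, for every polynomial P. *)
Lemma poly_le_expR (P : {poly R}) : exists2 C, 0 <= C &
  forall u, 0 <= u -> `|P.[u]| * u ^+ 2 <= C * expR u.
Proof.
exists (\sum_(i < size P) `|P`_i| * (i.+2%:R ^+ i.+2)).
  by apply: sumr_ge0 => i _; rewrite mulr_ge0// exprn_ge0.
move=> u u0; rewrite horner_coef mulr_suml.
apply: le_trans (ler_wpM2r (exprn_ge0 2 u0) (ler_norm_sum _ _ _)) _.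
rewrite mulr_suml; apply: ler_sum => i _.
rewrite normrM normrX (ger0_norm u0) -mulrA -exprD addn2 -mulrA ler_wpM2l//.
exact: exprn_le_expR.
Qed.

(** Gives all derivatives of exp(- 1 / y) at the point where the two branches
    meet. *)
Lemma is_derive_sqr_bound (f : R -> R) C (c : R) :
  (forall x, `|f x - f c| <= C * (x - c) ^+ 2) -> is_derive c 1 f 0.
Proof.
move=> fC; apply/is_derive1_caratheodory.
exists (fun z => (f z - f c) / (z - c)); split => [z||].
- have [->|zc] := eqVneq z c; first by rewrite !subrr !mul0r.
  by rewrite divfK// subr_eq0.
- have C0 : 0 <= C.
    by have := le_trans (normr_ge0 _) (fC (c + 1)); rewrite [c + 1]addrC addrK expr1n mulr1.
  apply/cvgrPdist_le => e e0 /=; rewrite !subrr mul0r.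
  have Ce0 : 0 < e / (C + 1) by rewrite divr_gt0// ltr_wpDl.
  near=> z; rewrite sub0r normrN normrM normfV.
  have [->|zc] := eqVneq z c; first by rewrite !subrr normr0 mul0r ltW.
  have zc0 : 0 < `|z - c| by rewrite normr_gt0 subr_eq0.
  rewrite ler_pdivrMr//; apply: le_trans (fC z) _.
  rewrite -(real_normK (num_real (z - c))) expr2 mulrA ler_wpM2r//.
  have : `|z - c| <= e / (C + 1).
    by rewrite distrC; near: z; apply: cvgr_dist_le => //; exact: cvg_id.
  rewrite ler_pdivlMr; last by rewrite ltr_wpDl.
  by move: zc0; move: `|z - c| => d; nra.
- by rewrite subrr mul0r.
Unshelve. all: by end_near. Qed.

(** The j-th derivative of exp(- 1 / y) is P_j(1 / y) exp(- 1 / y) for y > 0;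
    since (1 / y)' = - (1 / y) ^ 2, the polynomials satisfy
    P_(j+1) = X ^ 2 (P_j - P_j'). *)
Fixpoint flat_poly (j : nat) : {poly R} :=
  if j is j'.+1 then 'X^2 * (flat_poly j' - (flat_poly j')^`()) else 1.

Definition flat_deriv (j : nat) (y : R) : R :=
  if 0 < y then (flat_poly j).[y^-1] * expR (- y^-1) else 0.

Definition flat (y : R) : R := if 0 < y then expR (- y^-1) else 0.

Lemma flat_derivE : flat = flat_deriv 0.
Proof.
by apply/funext => y; rewrite /flat /flat_deriv /=; case: ifP; rewrite // hornerE mul1r.
Qed.

Lemma flat_deriv_bound j : exists C, forall y, `|flat_deriv j y| <= C * y ^+ 2.
Proof.
have [C C0 PC] := poly_le_expR (flat_poly j); exists C => y.
rewrite /flat_deriv; case: ifPn => [y0|_]; last by rewrite normr0 mulr_ge0// sqr_ge0.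
have yV : 0 < y^-1 by rewrite invr_gt0.
have := PC _ (ltW yV); rewrite -ler_pdivlMr ?exprn_gt0// exprVn invrK => h.
rewrite normrM (ger0_norm (expR_ge0 _)) expRN ler_pdivrMr ?expR_gt0//.
by apply: le_trans h _; rewrite mulrAC.
Qed.

Lemma flat_deriv_is_derive (j : nat) (y : R) : is_derive y (1 : R) (flat_deriv j) (flat_deriv j.+1 y).
Proof.
have [y0|y0|<-] := ltgtP 0 y.
- pose F := fun z : R => (flat_poly j).[z^-1] * expR (- z^-1).
  have nF : \forall z \near y, F z = flat_deriv j z.
    by near=> z; rewrite /flat_deriv ifT//; near: z; exact: lt_nbhsr.
  have y1 : y != 0 by rewrite gt_eqF.
  have D : is_derive y 1 F (flat_deriv j.+1 y).
    have dV : is_derive y 1 (fun z : R => z^-1) (- y ^- 2).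
      by apply: is_derive_eq (is_deriveV (f := id) y1 (is_derive_id _ _)) _; rewrite [_ *: _]mulr1.
    have d1 := is_derive1_comp (is_derive_poly (flat_poly j) y^-1) dV.
    have d2 := @is_derive1_comp _ expR (fun z : R => - z^-1) _ _ _ (is_derive_expR (- y^-1)) (is_deriveN dV).
    apply: is_derive_eq (is_deriveM d1 d2) _.
    rewrite /flat_deriv y0 /= !hornerE/= -![_ *: _]/(_ * _) /=.
    by rewrite -exprVn; ring.
  have [d1 d2] := D; split; first exact: near_eq_derivable nF d1.
  by rewrite -d2; apply/esym/near_eq_derive.
- have nF : \forall z \near y, cst 0 z = flat_deriv j z.
    near=> z; rewrite /flat_deriv ifF//; apply/negbTE; rewrite -leNgt ltW//.
    by near: z; exact: lt_nbhsl.
  have [d1 d2] := is_derive_cst (0 : R) y (1 : R).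
  split; first exact: near_eq_derivable nF d1.
  rewrite /flat_deriv ifF; last by apply/negbTE; rewrite -leNgt ltW.
  by rewrite -[RHS]d2; apply/esym/near_eq_derive.
- rewrite [flat_deriv j.+1 0]/flat_deriv ltxx.
  have [C bC] := flat_deriv_bound j.
  apply: (@is_derive_sqr_bound _ C) => x.
  by rewrite [flat_deriv j 0]/flat_deriv ltxx !subr0.
Unshelve. all: by end_near. Qed.

Lemma smooth_flat f : smooth_on setT f -> smooth_on setT (flat \o f).
Proof.
move=> Sf k; rewrite flat_derivE.
by apply: (@class_C_comp _ _ setT) => // j y _; exact: flat_deriv_is_derive.
Qed.

Lemma flat_ge0 y : 0 <= flat y.
Proof. by rewrite /flat; case: ifP => // _; exact: expR_ge0. Qed.

Lemma flat_le1 y : flat y <= 1.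
Proof.
rewrite /flat; case: ifPn => // y0.
by rewrite expR_le1 oppr_le0 invr_ge0 ltW.
Qed.

Lemma flat_gt0 y : (0 < flat y) = (0 < y).
Proof. by rewrite /flat; case: ifPn; rewrite ?expR_gt0// ltxx. Qed.

Lemma smooth_cst (c : R) : smooth_on setT (fun _ : E => c).
Proof. by move=> k; exact: class_C_cst. Qed.

Lemma smoothD f g : smooth_on setT f -> smooth_on setT g ->
  smooth_on setT (fun x => f x + g x).
Proof. by move=> Sf Sg k; apply: class_CD. Qed.

Lemma smoothM f g : smooth_on setT f -> smooth_on setT g ->
  smooth_on setT (fun x => f x * g x).
Proof. by move=> Sf Sg k; apply: class_CM. Qed.

Lemma smooth_prod (I : Type) (s : seq I) (F : I -> E -> R) :
  (forall i, smooth_on setT (F i)) -> smooth_on setT (fun x => \prod_(i <- s) F i x).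
Proof.
move=> SF; elim: s => [|i s IH].
  by under eq_fun do rewrite big_nil; exact: smooth_cst.
by under eq_fun do rewrite big_cons; exact: smoothM.
Qed.

Implicit Types (s t : R) (x a b : E).

(** The slopes [s] and [t] steepen the lower and upper faces of the box
    independently, as is needed to approximate a half-open box. *)
Definition bump_fun (s t : R) (a b : E) : E -> R := fun x =>
  \prod_i (flat (s * (x 0 i - a 0 i)) * flat (t * (b 0 i - x 0 i))).

Lemma smooth_bump s t a b : smooth_on setT (bump_fun s t a b).
Proof.
apply: smooth_prod => i; apply: smoothM.
- apply: (@smooth_flat (fun x => s * (x 0 i - a 0 i))).
  apply: smoothM; first exact: smooth_cst.
  by apply: smoothD; [move=> k; exact: class_C_coord|exact: smooth_cst].
- apply: (@smooth_flat (fun x => t * (b 0 i - x 0 i))).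
  apply: smoothM; first exact: smooth_cst.
  apply: smoothD; first exact: smooth_cst.
  under eq_fun do rewrite -mulN1r.
  by apply: smoothM; [exact: smooth_cst|move=> k; exact: class_C_coord].
Qed.

Lemma bump_ge0 s t a b x : 0 <= bump_fun s t a b x.
Proof. by apply: prodr_ge0 => i _; rewrite mulr_ge0// flat_ge0. Qed.

Lemma bump_le1 s t a b x : bump_fun s t a b x <= 1.
Proof.
apply: prodr_ile1 => i _; rewrite mulr_ge0 ?flat_ge0//=.
by rewrite mulr_ile1 ?flat_ge0 ?flat_le1.
Qed.

Lemma bump_neq0 s t a b x : 0 < s -> 0 < t ->
  bump_fun s t a b x != 0 -> forall i, a 0 i < x 0 i < b 0 i.
Proof.
move=> s0 t0 bx i; apply: contraTT bx => abx; rewrite negbK.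
rewrite /bump_fun (bigD1 i)//= mulf_eq0; apply/orP; left.
rewrite mulf_eq0; have fl y : (flat y == 0) = (y <= 0).
  by rewrite leNgt -flat_gt0 lt_neqAle flat_ge0 andbT eq_sym negbK.
rewrite !fl !pmulr_rle0// !subr_le0.
by move: abx; rewrite negb_and -!leNgt.
Qed.

Lemma bump_gt0 s t a b x : 0 < s -> 0 < t ->
  (forall i, a 0 i < x 0 i < b 0 i) -> 0 < bump_fun s t a b x.
Proof.
move=> s0 t0 abx; apply: prodr_gt0 => i _; have /andP[ax xb] := abx i.
by rewrite mulr_gt0// flat_gt0 mulr_gt0// subr_gt0.
Qed.

Definition closed_box (a b : E) : set E := [set x | forall i, a 0 i <= x 0 i <= b 0 i].

Lemma closed_box_compact a b : compact (closed_box a b).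
Proof.
rewrite (_ : closed_box a b = [set v : E | forall i, `[a 0 i, b 0 i]%classic (v ord0 i)]).
  by apply: (@rV_compact _ _ (fun i => `[a 0 i, b 0 i]%classic)) => i; exact: segment_compact.
by apply/seteqP; split => x /= xab i; have := xab i; rewrite /= in_itv.
Qed.

Lemma closed_boxP a b : closed (closed_box a b).
Proof. by apply: compact_closed; [exact: norm_hausdorff|exact: closed_box_compact]. Qed.

Lemma test_bump Omega s t a b : 0 < s -> 0 < t -> closed_box a b `<=` Omega ->
  test_function Omega (bump_fun s t a b).
Proof.
move=> s0 t0 abO.
have sub : closure [set x | bump_fun s t a b x != 0] `<=` closed_box a b.
  rewrite [X in _ `<=` X]((closure_id _).1 (@closed_boxP a b)).
  apply: closure_subset => x /= /(bump_neq0 s0 t0) abx i.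
  by have /andP[/ltW -> /ltW] := abx i.
split; first exact: smooth_bump.
- exact: (subclosed_compact (@closed_closure _ _) (@closed_box_compact a b) sub).
- exact: subset_trans abO.
Qed.

End bump.

(** * Integrals of real-valued functions *)

Section real_integration.
Context d (T : measurableType d) (R : realType).
Variables (mu : {measure set T -> \bar R}) (D : set T).
Hypothesis mD : measurable D.
Implicit Types f g : T -> R.
Local Notation integrable f := (mu.-integrable D (EFin \o f)).

Lemma measurable_comp_continuous (H : R -> R) f : continuous H ->
  measurable_fun D f -> measurable_fun D (fun x => H (f x)).
Proof. by move=> cH mf; exact: (measurableT_comp (continuous_measurable_fun cH) mf). Qed.

Lemma measurable_norm f : measurable_fun D f -> measurable_fun D (fun x => `|f x|).
Proof. by move=> mf; exact: (measurableT_comp (@normr_measurable R setT) mf). Qed.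

Lemma measurable_powR_comp f (q : R) : measurable_fun D f ->
  measurable_fun D (fun x => f x `^ q).
Proof. by move=> mf; exact: (measurableT_comp (@measurable_powR R q) mf). Qed.

Lemma measurable_EFin_comp f : measurable_fun D f -> measurable_fun D (fun x => (f x)%:E).
Proof. by move=> /measurable_EFinP. Qed.

Lemma integrable_measurable f : integrable f -> measurable_fun D f.
Proof. by move=> /measurable_int/measurable_EFinP. Qed.

Lemma ae_le_integrable f g : measurable_fun D f -> integrable g ->
  {ae mu, forall x, D x -> `|f x| <= g x} -> integrable f.
Proof.
move=> mf ig fg; apply/integrableP; split; first exact/measurable_EFinP.
have /integrableP[mg] := ig; apply: le_lt_trans.
apply: ae_ge0_le_integral => //.
- by apply: measurableT_comp => //; exact/measurable_EFinP.
- exact: measurableT_comp.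
- apply: filterS fg => x + Dx => /(_ Dx) fgx.
  by rewrite /= lee_fin (le_trans fgx)// ler_norm.
Qed.

Lemma integrableRD f g : integrable f -> integrable g -> integrable (fun x => f x + g x).
Proof. by move=> fi gi; exact: (integrableD mD fi gi). Qed.

Lemma integrableRB f g : integrable f -> integrable g -> integrable (fun x => f x - g x).
Proof. by move=> fi gi; exact: (integrableB mD fi gi). Qed.

Lemma integrableRZ (k : R) f : integrable f -> integrable (fun x => k * f x).
Proof. by move=> fi; exact: (integrableZl mD k fi). Qed.

Lemma integrableR_norm f : integrable f -> integrable (fun x => `|f x|).
Proof. by move=> fi; exact: (integrable_norm fi). Qed.

Lemma ae_eq_Rintegral f g : measurable_fun D f -> measurable_fun D g ->
  {ae mu, forall x, D x -> f x = g x} ->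
  \int[mu]_(x in D) f x = \int[mu]_(x in D) g x.
Proof.
move=> mf mg fg; congr fine; apply: ae_eq_integral => //.
- exact/measurable_EFinP.
- exact/measurable_EFinP.
- by apply: filterS fg => x + Dx => /(_ Dx) ->.
Qed.

Lemma ae_le_Rintegral f g : integrable f -> integrable g ->
  {ae mu, forall x, D x -> f x <= g x} ->
  \int[mu]_(x in D) f x <= \int[mu]_(x in D) g x.
Proof.
move=> fi gi fg; rewrite -subr_ge0 -RintegralB//.
have [mf mg] := (integrable_measurable fi, integrable_measurable gi).
have mB : measurable_fun D (fun x => g x - f x) by exact: measurable_funB.
rewrite (@ae_eq_Rintegral _ (fun x => `|g x - f x|))//.
- by apply: Rintegral_ge0 => x _; exact: normr_ge0.
- exact: measurableT_comp.
- by apply: filterS fg => x + Dx => /(_ Dx) fgx; rewrite ger0_norm// subr_ge0.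
Qed.

Lemma ae_Rintegral_ge0 f : integrable f -> {ae mu, forall x, D x -> 0 <= f x} ->
  0 <= \int[mu]_(x in D) f x.
Proof.
move=> fi f0; have mf := integrable_measurable fi.
rewrite (@ae_eq_Rintegral _ (fun x => `|f x|))//.
- by apply: Rintegral_ge0 => x _; exact: normr_ge0.
- exact: measurable_norm.
- by apply: filterS f0 => x + Dx => /(_ Dx) ?; rewrite ger0_norm.
Qed.

Lemma Rintegral_gt0_ae f : integrable f -> {ae mu, forall x, D x -> 0 <= f x} ->
  \int[mu]_(x in D) f x <= 0 -> {ae mu, forall x, D x -> f x = 0}.
Proof.
move=> fi f0 If; have mf := integrable_measurable fi.
have mEf : measurable_fun D (EFin \o f) by exact/measurable_EFinP.
have mn : measurable_fun D (fun x => `|f x|) by exact: measurableT_comp.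
have nf : \int[mu]_(x in D) `|f x| = \int[mu]_(x in D) f x.
  apply: ae_eq_Rintegral => //.
  by apply: filterS f0 => x + Dx => /(_ Dx) ?; rewrite ger0_norm.
have : (\int[mu]_(x in D) `|(EFin \o f) x| = 0)%E.
  apply/eqP; rewrite eq_le integral_ge0// andbT.
  have ? : (\int[mu]_(x in D) `|(EFin \o f) x|)%E \is a fin_num.
    have /integrableP[_] := fi; rewrite ge0_fin_numE//.
    exact: integral_ge0.
  rewrite -[leLHS]fineK// lee_fin.
  by rewrite /Rintegral in nf If *; rewrite [X in X <= _]nf.
move=> /(ae_eq_integral_abs mu mD mEf).
by apply: filterS => x + Dx => /(_ Dx) [].
Qed.

Lemma dominated_Rintegral (f_ : nat -> T -> R) f g :
  (forall n, measurable_fun D (f_ n)) -> measurable_fun D f -> integrable g ->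
  {ae mu, forall x, D x -> f_ ^~ x @ \oo --> f x} ->
  {ae mu, forall x n, D x -> `|f_ n x| <= g x} ->
  integrable f /\ \int[mu]_(x in D) f_ n x @[n --> \oo] --> \int[mu]_(x in D) f x.
Proof.
move=> mf_ mf gi ff fg.
have [||||fi _ cv] := @dominated_convergence _ _ _ mu D mD (fun n x => (f_ n x)%:E)
  (EFin \o f) (EFin \o g) _ _ _ gi.
- by move=> n; exact/measurable_EFinP.
- exact/measurable_EFinP.
- by apply: filterS ff => x + Dx => /(_ Dx) h; apply: cvg_EFin => //; exact: nearW.
- by apply: filterS fg => x + n Dx => /(_ n Dx) h; rewrite /= lee_fin.
split => //; apply: fine_cvg; rewrite fineK//.
exact: integrable_fin_num.
Qed.

(** Unlike dominated convergence, this also yields the integrability of the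
    limit, from a bound on the integrals alone. *)
Lemma fatou_Rintegral (f_ : nat -> T -> R) f (c_ : nat -> R) c :
  (forall n, integrable (f_ n)) -> measurable_fun D f ->
  {ae mu, forall x, D x -> f_ ^~ x @ \oo --> f x} ->
  {ae mu, forall x n, D x -> 0 <= f_ n x} ->
  (forall n, \int[mu]_(x in D) f_ n x <= c_ n) -> c_ @ \oo --> c ->
  integrable f /\ \int[mu]_(x in D) f x <= c.
Proof.
move=> if_ mf ff f0 Ic cc.
have mf_ n := integrable_measurable (if_ n).
have mF n : measurable_fun D (fun x => `|f_ n x|%:E).
  exact/measurable_EFinP/measurableT_comp.
have F0 n x : D x -> (0 <= `|f_ n x|%:E)%E by rewrite lee_fin.
have := fatou mu mD mF F0.
have mabs : measurable_fun D (fun x => `|f x|%:E).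
  exact/measurable_EFinP/measurableT_comp.
have <- : (\int[mu]_(x in D) `|f x|%:E =
  \int[mu]_(x in D) limn_einf (fun n => `|f_ n x|%:E))%E.
  apply: ge0_ae_eq_integral => //.
  - rewrite (_ : (fun x => _) = (fun x => - limn_esup (fun n => - `|f_ n x|%:E))%E).
      apply: measurableT_comp => //; apply: measurable_fun_limn_esup => n.
      by apply: measurableT_comp => //; exact: mF.
    by apply/funext => x; rewrite -[LHS]oppeK -limn_esupN.
  - move=> x Dx; rewrite limn_einf_lim; apply: lime_ge; first exact: is_cvg_einfs.
    by apply: nearW => n; apply: le_ereal_inf_tmp => _ [k _ <-]; rewrite lee_fin.
  - apply: filterS ff => x + Dx => /(_ Dx) h.
    have /cvg_limn_einf_sup[-> //] : (fun n => `|f_ n x|%:E) @ \oo --> `|f x|%:E.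
    by apply: cvg_EFin; [exact: nearW|exact: cvg_norm].
set L := limn_einf _ => fatou.
have Lc : (L <= c%:E)%E.
  have cE : (EFin \o c_) @ \oo --> c%:E by apply: cvg_EFin => //; exact: nearW.
  rewrite /L limn_einf_lim -(cvg_lim _ cE)//; apply: lee_lim.
  - exact: is_cvg_einfs.
  - by apply/cvg_ex; exists c%:E.
  apply: nearW => n; apply: (@le_trans _ _ (\int[mu]_(x in D) `|f_ n x|%:E)%E).
    by apply: ereal_inf_lbound; exists n => //=.
  have e : (\int[mu]_(x in D) `|f_ n x|%:E = \int[mu]_(x in D) (f_ n x)%:E)%E.
    apply: ae_eq_integral => //; first exact: (measurable_int mu (if_ n)).
    by apply: filterS f0 => x f0x Dx; congr EFin; exact: (ger0_norm (f0x n Dx)).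
  rewrite e -[leLHS]fineK; last by apply: integrable_fin_num => //; exact: if_.
  by rewrite lee_fin; exact: Ic.
have fi : integrable f.
  apply/integrableP; split; first exact/measurable_EFinP.
  by apply: le_lt_trans (ltry c); exact: le_trans Lc.
split => //.
have fn : {ae mu, forall x, D x -> f x = `|f x|}.
  apply: filterS2 ff f0 => x h f0x Dx; rewrite ger0_norm//.
  rewrite -(cvg_lim _ (h Dx))//; apply: limr_ge; last by apply: nearW => n; exact: f0x.
  by move: (h Dx) => ?; apply/cvg_ex; exists (f x).
rewrite (ae_eq_Rintegral _ _ fn)//; last exact: measurableT_comp.
rewrite -lee_fin /Rintegral fineK; first exact: le_trans Lc.
by apply: integrable_fin_num => //; exact: (integrable_norm fi).
Qed.

Lemma ge0_integrableP f : measurable_fun D f -> {ae mu, forall x, D x -> 0 <= f x} ->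
  integrable f <-> (\int[mu]_(x in D) (f x)%:E < +oo)%E.
Proof.
move=> mf f0; have mEf := measurable_EFin_comp mf.
have <- : (\int[mu]_(x in D) `|(f x)%:E| = \int[mu]_(x in D) (f x)%:E)%E.
  apply: ae_eq_integral => //; first exact: measurableT_comp.
  by apply: filterS f0 => x + Dx => /(_ Dx) ?; rewrite gee0_abs.
by split=> [/integrableP[]//|?]; apply/integrableP.
Qed.

(** The sum of the sequence is finite almost everywhere and dominates every
    term. Approximating fast enough thus gives a dominated, almost everywhere
    convergent sequence without extracting subsequences. *)
Lemma summable_dominated (F : nat -> T -> R) :
  (forall k, integrable (F k)) -> {ae mu, forall x, D x -> forall k, 0 <= F k x} ->
  (forall k, \int[mu]_(x in D) F k x <= 1 / (2 ^ k.+1)%:R) ->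
  exists2 G, integrable G & {ae mu, forall x, D x -> forall k, F k x <= G x}.
Proof.
move=> Fi F0 IF.
pose N k x := `|F k x|%:E; pose H x := (\sum_(k <oo) N k x)%E.
have N0 k x : (0 <= N k x)%E by rewrite lee_fin.
have mN k : measurable_fun D (N k).
  exact/measurable_EFin_comp/measurable_norm/integrable_measurable.
have H0 x : (0 <= H x)%E by exact: nneseries_ge0.
have mH : measurable_fun D H.
  by apply: (@ge0_emeasurable_sum _ _ _ _ N xpredT) => // k x _ _.
have INle k : (\int[mu]_(x in D) N k x <= (1 / (2 ^ k.+1)%:R)%:E)%E.
  have -> : (\int[mu]_(x in D) N k x = \int[mu]_(x in D) (F k x)%:E)%E.
    apply: ae_eq_integral => //.
      exact/measurable_EFin_comp/integrable_measurable.
    by apply: filterS F0 => x + Dx => /(_ Dx k) ?; rewrite /N ger0_norm.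
  rewrite -[leLHS]fineK ?lee_fin ?IF//.
  by apply: integrable_fin_num => //; exact: Fi.
have Hi : mu.-integrable D H.
  apply/integrableP; split => //; under eq_integral do rewrite gee0_abs//.
  rewrite /H integral_nneseries//.
  apply: le_lt_trans (ltry 1); apply: le_trans (@epsilon_trick0 R 1 xpredT ler01).
  apply: lee_nneseries => [k _ _|k _]; last exact: INle.
  exact: integral_ge0.
have Hfin := integrable_ae mD Hi.
exists (fine \o H).
  apply/integrableP; split.
    exact/measurable_EFin_comp/(measurableT_comp (fine_measurable measurableT) mH).
  have /integrableP[_] := Hi; apply: le_lt_trans.
  rewrite le_eqVlt; apply/orP; left; apply/eqP; apply: ae_eq_integral => //.
  - apply: measurableT_comp => //.
    exact/measurable_EFin_comp/(measurableT_comp (fine_measurable measurableT) mH).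
  - exact: measurableT_comp.
  - by apply: filterS Hfin => x + Dx => /(_ Dx) Hx; congr abse; exact: fineK.
apply: filterS Hfin => x + Dx => /(_ Dx) Hx k.
rewrite -lee_fin fineK//; apply: (@le_trans _ _ (N k x)).
  by rewrite lee_fin ler_norm.
rewrite /H (nneseriesD1 (n := k))//.
by rewrite leeDl// nneseries_ge0.
Qed.

End real_integration.

(** * Test functions *)

Section test_functions.
Context (R : realType) (n : nat).
Local Notation E := 'rV[R]_n.+1.
Local Notation X := (caratheodory_type (@leb_outer R n)).
Local Notation mu := (@leb R n).
Implicit Types (f g phi xi : E -> R) (Omega : set E) (i : 'I_n.+1).

Lemma test_function_supp Omega phi f : test_function Omega phi ->
  smooth_on setT f -> (forall x, f x != 0 -> closure [set y | phi y != 0] x) ->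
  test_function Omega f.
Proof.
move=> [_ cphi sphi] Sf sub.
have {}sub : closure [set x | f x != 0] `<=` closure [set x | phi x != 0].
  rewrite [X in _ `<=` X]((closure_id _).1 (@closed_closure _ _)).
  exact: closure_subset.
split => //; last exact: subset_trans sphi.
by apply: subclosed_compact cphi sub; exact: closed_closure.
Qed.

Lemma test_function_sub Omega Omega' phi : Omega `<=` Omega' ->
  test_function Omega phi -> test_function Omega' phi.
Proof. by move=> sub [? ? s]; split => //; exact: subset_trans sub. Qed.

Lemma test_function_mul Omega phi g : test_function Omega phi ->
  smooth_on setT g -> test_function Omega (fun x => phi x * g x).
Proof.
move=> Tphi Sg; apply: (test_function_supp Tphi).
  by have [Sphi _ _] := Tphi; exact: smoothM.
by move=> x; rewrite mulf_eq0 negb_or => /andP[? _]; exact: subset_closure.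
Qed.

Lemma test_function_partial Omega phi i : test_function Omega phi ->
  test_function Omega (partial i phi).
Proof.
move=> Tphi; have [Sphi _ _] := Tphi.
apply: (test_function_supp Tphi); first exact: smooth_partial.
move=> x; apply: contraNP => ncl.
have near0 : \forall y \near x, cst 0 y = phi y.
  have oC : open (~` closure [set y | phi y != 0]) by exact/closed_openC/closed_closure.
  have := open_nbhs_nbhs (conj oC ncl); apply: filterS => y /= ncly.
  by apply/esym/eqP; apply: contra_notT ncly => ?; exact: subset_closure.
apply/eqP; rewrite /partial -(@near_eq_derive _ _ R^o (cst 0) phi x (delta_mx 0 i))//.
exact: derive_cst.
Qed.

Lemma test_function_bounded Omega phi : test_function Omega phi ->
  exists2 C, 0 < C & forall x, `|phi x| <= C.
Proof.
move=> [Sphi cphi _].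
have : compact (phi @` closure [set x | phi x != 0]).
  apply: continuous_compact => //.
  exact/continuous_subspaceT/smooth_continuous.
move=> /compact_bounded/pinfty_ex_gt0[C C0 phiC]; exists C => // x.
have [->|x0] := eqVneq (phi x) 0; first by rewrite normr0 ltW.
by apply: phiC; exists x => //; exact: subset_closure.
Qed.

Lemma test_function_in Omega phi x : test_function Omega phi ->
  phi x != 0 -> Omega x.
Proof. by move=> [_ _ s] x0; apply: s; exact: subset_closure. Qed.

Lemma test_function_measurable Omega phi (D : set X) : test_function Omega phi ->
  measurable_fun D (phi : X -> R).
Proof.
move=> [Sphi _ _]; apply: measurable_funTS.
exact/measurable_fun_continuous/smooth_continuous.
Qed.

Lemma integrable_bounded_supp (D B : set E) (f : E -> R) C :
  measurable (D : set X) -> measurable (B : set X) -> (mu B < +oo)%E ->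
  measurable_fun (D : set X) (f : X -> R) ->
  (forall x, `|f x| <= C) -> (forall x, f x != 0 -> B x) ->
  mu.-integrable (D : set X) (EFin \o f).
Proof.
move=> mD mB B_fin mf fC fB.
have mDB : measurable (D `&` B : set X) by exact: measurableI.
have : mu.-integrable (D `&` B : set X) (EFin \o f).
  apply: measurable_bounded_integrable => //.
  - apply: le_lt_trans B_fin; apply: le_measure; rewrite ?inE//.
  - by apply: measurable_funS mf.
  - exists C; split; first exact: num_real.
    by move=> y Cy x _ /=; exact: le_trans (ltW Cy).
move=> /(integrable_restrict mu mB mD).
apply: eq_integrable => // x _; rewrite patchE /=; case: ifPn => // /negP.
by rewrite inE => nB; congr EFin; apply/esym/eqP; apply: contra_notT nB; exact: fB.
Qed.

Lemma test_function_integrable Omega phi (D : set X) : test_function Omega phi ->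
  measurable D -> mu.-integrable D (EFin \o phi).
Proof.
move=> Tphi mD; have [C _ phiC] := test_function_bounded Tphi.
have [_ cphi _] := Tphi.
apply: (@integrable_bounded_supp D (closure [set x | phi x != 0]) phi C) => //.
- exact/measurable_closed/closed_closure.
- exact/bounded_leb_lty/compact_bounded.
- exact: test_function_measurable Tphi.
- by move=> x x0; exact: (@subset_closure _ [set y | phi y != 0]) x0.
Qed.

Lemma lipschitz_bound (f df : R -> R) (t C : R) : 0 <= t ->
  (forall s : R, is_derive s (1 : R) f (df s)) -> (forall s, 0 <= s <= t -> `|df s| <= C) ->
  `|f t - f 0| <= C * t.
Proof.
move=> t0 Df dfC.
have [|c c0t ->] := @MVT_segment _ f df 0 t t0 (fun s _ => Df s).
  apply: continuous_subspaceT => s.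
  by apply/differentiable_continuous/derivable1_diffP; have [] := Df s.
by rewrite subr0 normrM [`|t|]ger0_norm// ler_wpM2r// dfC// -in_itv.
Qed.

(** The second derivative along the line is bounded because it is continuous
    with compact support; the mean value theorem is applied twice. *)
Lemma taylor_bound Omega xi i : test_function Omega xi ->
  exists2 C, 0 < C & forall x (t : R), 0 <= t ->
    `|xi (x + t *: delta_mx 0 i) - xi x - t * partial i xi x| <= C * t ^+ 2.
Proof.
move=> Txi; have [C C0 d2C] :=
  test_function_bounded (test_function_partial i (test_function_partial i Txi)).
have [Sxi _ _] := Txi.
exists C => // x t t0; set e := delta_mx 0 i.
have Dg (s : R) : is_derive s (1 : R) (fun s : R => xi (x + s *: e)) (partial i xi (x + s *: e)).
  by apply/is_derive_line; exact: smooth_is_derive.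
have Dg' (s : R) : is_derive s (1 : R) (fun s : R => partial i xi (x + s *: e))
    (partial i (partial i xi) (x + s *: e)).
  by apply/is_derive_line; apply: smooth_is_derive; exact: smooth_partial.
pose k (s : R) := xi (x + s *: e) - s * partial i xi x.
have Dk (s : R) : is_derive s (1 : R) k (partial i xi (x + s *: e) - partial i xi x).
  have d : is_derive s (1 : R) (fun s : R => s * partial i xi x) (partial i xi x).
    apply: is_derive_eq (is_deriveM (is_derive_id s (1 : R)) (is_derive_cst (partial i xi x) s (1 : R))) _.
    by rewrite scaler0 add0r [_ *: _]mulr1.
  exact: (is_deriveB (Dg s) d).
have := @lipschitz_bound k _ t (C * t) t0 Dk.
rewrite /k scale0r addr0 mul0r subr0 addrAC -mulrA -expr2; apply => s /andP[s0 st].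
have := @lipschitz_bound _ _ s C s0 Dg'.
rewrite scale0r addr0 => h; apply: le_trans (h _) _; first by move=> *; exact: d2C.
by rewrite ler_wpM2l// ltW.
Qed.

(** Instead of Fubini's theorem: the integral of xi (x + t e_i) - xi x vanishes
    by translation invariance, and by [taylor_bound] this difference is
    t (partial i xi x) up to an error C t ^ 2 on a bounded set. Dividing by t
    bounds the integral of the derivative by a multiple of t. *)
Lemma Rintegral_partial Omega xi i : test_function Omega xi ->
  \int[mu]_x partial i xi x = 0.
Proof.
move=> Txi; have Tdxi := test_function_partial i Txi.
have [C C0 xiC] := taylor_bound i Txi.
have Ixi := test_function_integrable Txi (@measurableT _ X).
have Idxi := test_function_integrable Tdxi (@measurableT _ X).
have [_ /compact_bounded/bounded_sub_box[M M0 xiM] _] := Txi.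
have suppM x : ~ box (const_mx (- M) : E, const_mx M : E) x -> xi x = 0 /\ partial i xi x = 0.
  move=> xM; split; apply/eqP; apply: contra_notT xM => x0; apply: xiM.
    exact: subset_closure.
  have : test_function (closure [set y | xi y != 0]) xi by case: Txi => *; split.
  by move=> /(test_function_partial i)/test_function_in; apply.
(* the support of xi is pushed backwards by t <= 1, hence the extra 1 below *)
pose B : set E := box (const_mx (- M - 1) : E, const_mx M : E).
have B_fin : (mu B < +oo)%E by rewrite (le_lt_trans (leb_box_le _))// ltry.
have mB : measurable (B : set X) by exact: measurable_box.
have B0 x t : 0 <= t <= 1 -> ~ B x -> xi (x + t *: delta_mx 0 i) = 0 /\ xi x = 0 /\ partial i xi x = 0.
  move=> t01 Bx; split; [|by apply: suppM; apply: contra_not Bx => + j => /(_ j); rewrite !mxE/=; lra].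
  have [|-> //] := suppM (x + t *: delta_mx 0 i).
  apply: contra_not Bx => + j => /(_ j); rewrite !mxE /= => /andP[h1 h2].
  by move: h1 h2; case: (j == i); rewrite ?mulr1n ?mulr0n ?mulr0 ?mulr1; move=> h1 h2; lra.
apply/eqP; rewrite -normr_le0; apply/ler_addgt0Pr => e e0; rewrite add0r.
have key t : 0 < t <= 1 -> `|\int[mu]_x partial i xi x| <= C * t * fine (mu B).
  move=> /andP[t0 t1].
  have [Ish Esh] := integral_shift (t *: delta_mx 0 i) Ixi.
  pose r x := xi (x + t *: delta_mx 0 i) - xi x - t * partial i xi x.
  have Itd : mu.-integrable setT (EFin \o (fun x : X => t * partial i xi x)).
    exact: (@integrableZl _ _ _ mu setT (@measurableT _ X) t _ Idxi).
  have Idiff := @integrableB _ _ _ mu setT (@measurableT _ X) _ _ Ish Ixi.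
  have Ir : \int[mu]_x r x = - t * \int[mu]_x partial i xi x.
    rewrite /r RintegralB// RintegralB// RintegralZl//.
    by rewrite /Rintegral /= Esh subrr sub0r mulNr.
  have mr : measurable_fun setT (r : X -> R).
    apply: integrable_measurable.
    exact: (@integrableB _ _ _ mu setT (@measurableT _ X) _ _ Idiff Itd).
  have rB x : `|r x| <= (C * t ^+ 2) * \1_B x.
    have [xB|nB] := pselect (B x).
      by rewrite indicE mem_set// mulr1; exact: xiC (ltW t0).
    have [|r1 [r2 r3]] := B0 x t _ nB; first by rewrite (ltW t0).
    by rewrite indicE memNset// mulr0 /r r1 r2 r3 mulr0 !subrr normr0.
  have IB : mu.-integrable setT (EFin \o (fun x : X => C * t ^+ 2 * \1_B x)).
    apply: (@integrableZl _ _ _ mu setT (@measurableT _ X) (C * t ^+ 2) (EFin \o \1_B)).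
    apply/integrableP; split; first exact/measurable_EFinP.
    under eq_integral do rewrite gee0_abs ?lee_fin//.
    by rewrite integral_indic// setIT.
  have Irr : mu.-integrable setT (EFin \o (r : X -> R)).
    by apply: (@ae_le_integrable _ _ _ mu setT measurableT _ _ mr IB); apply: aeW => x _; exact: rB.
  rewrite -(ler_pM2l t0) -[X in X * `|_|](gtr0_norm t0) -normrM -normrN -mulNr -Ir.
  apply: le_trans (le_normr_Rintegral measurableT Irr) _.
  apply: le_trans (le_Rintegral measurableT (integrable_norm Irr) IB _) _.
    by move=> x _; exact: rB.
  rewrite RintegralZl//; last first.
    apply/integrableP; split; first exact/measurable_EFinP.
    under eq_integral do rewrite gee0_abs ?lee_fin//.
    by rewrite integral_indic// setIT.
  rewrite /Rintegral integral_indic// setIT.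
  by rewrite expr2 mulrA !mulrA [t * C]mulrC.
pose t := Num.min 1 (e / (C * fine (mu B) + 1)).
have B1 : 0 <= C * fine (mu B) by rewrite mulr_ge0 ?fine_ge0// ltW.
have t0 : 0 < t by rewrite lt_min ltr01/= divr_gt0// ltr_wpDl.
apply: le_trans (key t _) _; first by rewrite t0 ge_min lexx.
rewrite mulrAC -[leRHS](@divfK _ (C * fine (mu B) + 1)); last by rewrite gt_eqF// ltr_wpDl.
rewrite [leRHS]mulrC; apply: ler_pM => //; first exact: ltW.
- by rewrite lerDl.
- by rewrite /t ge_min lexx orbT.
Qed.

Lemma Rintegral_partial_in Omega xi i : measurable (Omega : set X) ->
  test_function Omega xi -> \int[mu]_(x in (Omega : set X)) partial i xi x = 0.
Proof.
move=> mO Txi; rewrite -[RHS](Rintegral_partial i Txi) Rintegral_mkcond.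
apply: eq_Rintegral => x _; rewrite patchE; case: ifPn => // /negP; rewrite inE => xO.
apply/esym/eqP; apply: contra_notT xO.
exact: test_function_in (test_function_partial i Txi).
Qed.

End test_functions.

(** * The Euclidean norm and real powers *)

Section euclidean_norm.
Context (R : realType) (n : nat).
Local Notation E := 'rV[R]_n.+1.
Implicit Types (x y : E).

Lemma dotC x y : dot x y = dot y x.
Proof. by apply: eq_bigr => i _; rewrite mulrC. Qed.

Lemma dotDr x y z : dot x (y + z) = dot x y + dot x z :> R.
Proof. by rewrite -big_split; apply: eq_bigr => i _; rewrite !mxE mulrDr. Qed.

Lemma dotZr (a : R) x y : dot x (a *: y) = a * dot x y.
Proof. by rewrite mulr_sumr; apply: eq_bigr => i _; rewrite mxE mulrCA. Qed.

Lemma dotxx_ge0 x : 0 <= dot x x.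
Proof. by apply: sumr_ge0 => i _; rewrite -expr2 sqr_ge0. Qed.

Lemma enorm_ge0 x : 0 <= enorm x.
Proof. exact: sqrtr_ge0. Qed.

Lemma enorm_sqr x : enorm x ^+ 2 = dot x x.
Proof. by rewrite sqr_sqrtr// dotxx_ge0. Qed.

Lemma coord_le_enorm x i : `|x 0 i| <= enorm x.
Proof.
rewrite -(@ler_pXn2r _ 2)// ?nnegrE ?enorm_ge0// enorm_sqr real_normK ?num_real//.
rewrite /dot (bigD1 i)//= expr2 lerDl.
by apply: sumr_ge0 => j _; rewrite -expr2 sqr_ge0.
Qed.

(** The Cauchy-Schwarz inequality, by expanding dot z z >= 0 for
    z = (y.y) x - (x.y) y. *)
Lemma dot_le_enorm x y : `|dot x y| <= enorm x * enorm y.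
Proof.
rewrite -(@ler_pXn2r _ 2)// ?nnegrE ?mulr_ge0 ?enorm_ge0// exprMn !enorm_sqr.
rewrite real_normK ?num_real//.
have [y0|y0] := eqVneq (dot y y) 0.
  suff -> : dot x y = 0 by rewrite expr0n/= y0 mulr0.
  have : enorm y ^+ 2 = 0 by rewrite enorm_sqr.
  move=> /eqP; rewrite sqrf_eq0 => /eqP ny.
  apply: big1 => i _; have := coord_le_enorm y i; rewrite ny normr_le0 => /eqP ->.
  by rewrite mulr0.
have {}y0 : 0 < dot y y by rewrite lt_neqAle eq_sym y0 dotxx_ge0.
have : 0 <= dot (dot y y *: x + - dot x y *: y) (dot y y *: x + - dot x y *: y).
  exact: dotxx_ge0.
rewrite dotDr !dotZr ![dot (_ + _) _]dotC !dotDr !dotZr (dotC y x).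
have -> : dot y y * (dot y y * dot x x + - dot x y * dot x y) +
   - dot x y * (dot y y * dot x y + - dot x y * dot y y) =
   dot y y * (dot x x * dot y y - dot x y ^+ 2) by ring.
by rewrite pmulr_rge0// subr_ge0.
Qed.

Lemma enormD x y : enorm (x + y) <= enorm x + enorm y.
Proof.
rewrite -(@ler_pXn2r _ 2)// ?nnegrE ?addr_ge0 ?enorm_ge0//.
rewrite enorm_sqr dotDr ![dot (_ + _) _]dotC !dotDr sqrrD !enorm_sqr (dotC y x).
by have := le_trans (ler_norm _) (dot_le_enorm x y); lra.
Qed.

Lemma enormZ (a : R) x : enorm (a *: x) = `|a| * enorm x.
Proof. by rewrite /enorm dotZr dotC dotZr mulrA -expr2 sqrtrM ?sqr_ge0// sqrtr_sqr. Qed.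

Lemma enormN x : enorm (- x) = enorm x.
Proof. by rewrite -scaleN1r enormZ normrN1 mul1r. Qed.

Lemma enorm0 : enorm (0 : E) = 0.
Proof. by rewrite -(scale0r 0) enormZ normr0 mul0r. Qed.

End euclidean_norm.

Section powers.
Context (R : realType).
Implicit Types (a b c p w : R).

Lemma ler_powRl p a b : 0 <= p -> 0 <= a -> a <= b -> a `^ p <= b `^ p.
Proof.
move=> p0 a0 ab; apply: ge0_ler_powR; rewrite // nnegrE//.
exact: le_trans ab.
Qed.

Lemma ltr_powRl p a b : 0 < p -> 0 <= a -> a < b -> a `^ p < b `^ p.
Proof.
move=> p0 a0 ab; apply: gt0_ltr_powR; rewrite // nnegrE//.
exact: le_trans (ltW ab).
Qed.

Lemma powRD_le p a b : 0 <= p -> 0 <= a -> 0 <= b ->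
  (a + b) `^ p <= 2 `^ p * (a `^ p + b `^ p).
Proof.
move=> p0 a0 b0; wlog ab : a b a0 b0 / b <= a.
  have [ab|/ltW ba] := leP b a; first exact.
  by move=> /(_ b a b0 a0 ba); rewrite addrC [b `^ _ + _]addrC.
apply: (@le_trans _ _ ((2 * a) `^ p)); first by apply: ler_powRl => //; lra.
by rewrite powRM// ler_wpM2l ?powR_ge0// lerDl powR_ge0.
Qed.

Lemma powRD3_le p a b c : 0 <= p -> 0 <= a -> 0 <= b -> 0 <= c ->
  (a + b + c) `^ p <= 2 `^ p * 2 `^ p * (a `^ p + b `^ p + c `^ p).
Proof.
move=> p0 a0 b0 c0.
apply: le_trans (powRD_le p0 (addr_ge0 a0 b0) c0) _.
rewrite -mulrA ler_wpM2l ?powR_ge0//.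
rewrite mulrDr lerD ?powRD_le// ler_peMl ?powR_ge0//.
by rewrite -[leLHS](powRr0 2) ler_powR// ler1n.
Qed.

Lemma powR_cvg0_inv p (y : nat -> R) : 0 < p -> (forall k, 0 <= y k) ->
  (fun k => y k `^ p) @ \oo --> 0 -> y @ \oo --> 0.
Proof.
move=> p0 y0 /cvgrPdist_lt yp; apply/cvgrPdist_lt => e e0.
have := yp _ (powR_gt0 p e0); apply: filterS => k.
rewrite !sub0r !normrN !ger0_norm ?powR_ge0//; apply: contraTT.
by rewrite -!leNgt => ey; apply: ler_powRl => //; exact: ltW.
Qed.

Lemma cvg0_powR p (y : nat -> R) : 0 < p -> (forall k, 0 <= y k) ->
  y @ \oo --> 0 -> (fun k => y k `^ p) @ \oo --> 0.
Proof.
move=> p0 y0 /cvgrPdist_le yp; apply/cvgrPdist_le => e e0.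
have := yp _ (powR_gt0 p^-1 e0); apply: filterS => k.
rewrite !sub0r !normrN !ger0_norm ?powR_ge0// => /(ler_powRl (ltW p0) (y0 k)).
by rewrite -powRrM mulVf ?gt_eqF// powRr1// ltW.
Qed.

(** Controls a gradient by its weighted energy and a locally integrable
    function of the weight, so that energy bounds yield local L^1 bounds.
    Either the left-hand side is at most the last term, or [w * y ^ (p - 1)]
    is at least 1. *)
Lemma young_weight p w y : 1 < p -> 0 < w -> 0 <= y ->
  y <= w * y `^ p + w `^ (- (p - 1)^-1).
Proof.
move=> p1 w0 y0; have p10 : 0 < p - 1 by rewrite subr_gt0.
have [yw|/ltW yw] := leP y (w `^ (- (p - 1)^-1)).
  by apply: le_trans yw _; rewrite lerDr mulr_ge0 ?powR_ge0 ?ltW.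
rewrite -[leLHS]addr0 lerD ?powR_ge0//.
rewrite -mulr_powRB1 ?(lt_trans ltr01)// mulrCA ler_peMr//.
have := ler_powRl (ltW p10) (powR_ge0 _ _) yw.
rewrite -powRrM mulNr mulVf ?gt_eqF// powR_inv1; last exact: ltW.
by rewrite -ler_pdivrMl// mulr1.
Qed.

End powers.

(** * Weighted Sobolev spaces *)

Section sobolev.
Context (R : realType) (n : nat).
Local Notation E := 'rV[R]_n.+1.
Local Notation X := (caratheodory_type (@leb_outer R n)).
Local Notation mu := (@leb R n).
Variables (Omega : set E) (p : R) (w : E -> R).
Hypotheses (oO : open Omega) (p1 : 1 < p).
Hypothesis Aw : class_A Omega p w.
Implicit Types (u v f phi psi xi zeta : E -> R) (g h : E -> E).
Local Notation O := (Omega : set X).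
Local Notation integrable f := (mu.-integrable O (EFin \o (f : X -> R))).
Local Notation mfun f := (measurable_fun O (f : X -> R)).

Let p0 : 0 < p. Proof. exact: lt_trans p1. Qed.
Let mO : measurable O. Proof. exact: measurable_open. Qed.
Let mw : mfun w. Proof. by have [[]] := Aw. Qed.
Let w_gt0 : {ae mu, forall x : X, Omega x -> 0 < w x}. Proof. by have [[]] := Aw. Qed.

Lemma measurable_enorm g : (forall i, mfun (fun x => g x 0 i)) ->
  mfun (fun x => enorm (g x)).
Proof.
move=> mg; apply: (measurable_comp_continuous (@sqrt_continuous R)).
by apply: measurable_sum => i; exact: measurable_funM.
Qed.

Lemma weak_gradient_measurable u g : weak_gradient Omega u g ->
  mfun u /\ forall i, mfun (fun x => g x 0 i).
Proof. by move=> [[mu_ _] mg _]; exact: (conj mu_ (fun i => (mg i).1)). Qed.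

Lemma sobolev_norm_ltP u g (e : R) : 0 < e -> mfun u ->
  (forall i, mfun (fun x => g x 0 i)) ->
  (sobolev_norm Omega p w u g < e%:E)%E <->
  [/\ integrable (fun x => `|u x| `^ p), integrable (fun x => w x * enorm (g x) `^ p) &
   \int[mu]_(x in O) (`|u x| `^ p) + \int[mu]_(x in O) (w x * enorm (g x) `^ p) < e `^ p].
Proof.
move=> e0 mfu mg.
have mA : mfun (fun x => `|u x| `^ p) by exact/measurable_powR_comp/measurable_norm.
have mB : mfun (fun x => w x * enorm (g x) `^ p).
  by apply: (measurable_funM mw); exact/measurable_powR_comp/measurable_enorm.
have A0 : {ae mu, forall x : X, Omega x -> 0 <= `|u x| `^ p}.
  by apply: aeW => x _; exact: powR_ge0.
have B0 : {ae mu, forall x : X, Omega x -> 0 <= w x * enorm (g x) `^ p}.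
  by apply: filterS w_gt0 => x wx Ox; rewrite mulr_ge0 ?powR_ge0// ltW// wx.
have EA := ge0_integrableP mO mA A0.
have EB := ge0_integrableP mO mB B0.
have IA0 : (0 <= \int[mu]_(x in O) (`|u x| `^ p)%:E)%E by exact: integral_ge0.
have IB0 : (0 <= \int[mu]_(x in O) (w x * enorm (g x) `^ p)%:E)%E.
  have -> : (\int[mu]_(x in O) (w x * enorm (g x) `^ p)%:E =
      \int[mu]_(x in O) `|(w x * enorm (g x) `^ p)%:E|)%E.
    apply: ae_eq_integral => //.
    - exact: (measurable_EFin_comp mB).
    - by apply: (measurable_EFin_comp (f := fun x => `|_|)); exact: measurable_norm.
    - by apply: filterS B0 => x + Ox => /(_ Ox) ?; rewrite gee0_abs.
  exact: integral_ge0.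
have pV : p^-1 != 0 by rewrite invr_eq0 gt_eqF.
have powK (x : R) : 0 <= x -> (x `^ p^-1) `^ p = x.
  by move=> x0; rewrite -powRrM mulVf ?gt_eqF// powRr1.
rewrite /sobolev_norm; split => [sn|[iA iB AB]].
- have /(lty_poweRy pV) ABoo := lt_trans sn (ltry e).
  have Aoo : (\int[mu]_(x in O) (`|u x| `^ p)%:E < +oo)%E.
    by apply: le_lt_trans ABoo; rewrite leeDl.
  have Boo : (\int[mu]_(x in O) (w x * enorm (g x) `^ p)%:E < +oo)%E.
    by apply: le_lt_trans ABoo; rewrite leeDr.
  split.
  + exact/EA.
  + exact/EB.
  have Af : (\int[mu]_(x in O) (`|u x| `^ p)%:E)%E \is a fin_num by rewrite ge0_fin_numE.
  have Bf : (\int[mu]_(x in O) (w x * enorm (g x) `^ p)%:E)%E \is a fin_num.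
    by rewrite ge0_fin_numE.
  move: sn; rewrite -(fineK Af) -(fineK Bf) -EFinD poweR_EFin lte_fin => sn.
  rewrite -[ltLHS]powK; first by apply: ltr_powRl => //; exact: powR_ge0.
  by apply: addr_ge0; apply: fine_ge0.
- have Af := integrable_fin_num mO iA.
  have Bf := integrable_fin_num mO iB.
  rewrite -[X in (X + _)%E](fineK Af) -[X in (_ + X)%E](fineK Bf) -EFinD poweR_EFin lte_fin.
  rewrite -[ltRHS](@powRr1 _ e) ?ltW// -(mulfV (lt0r_neq0 p0)) powRrM.
  apply: ltr_powRl => //; first by rewrite invr_gt0.
  by apply: addr_ge0; apply: fine_ge0.
Qed.

Lemma W1pP u g : W1p Omega p w u g <->
  [/\ weak_gradient Omega u g, integrable (fun x => `|u x| `^ p) &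
      integrable (fun x => w x * enorm (g x) `^ p)].
Proof.
split=> [[wg sn]|[wg iA iB]].
- have [mfu mg] := weak_gradient_measurable wg.
  have sn0 : (0 <= sobolev_norm Omega p w u g)%E by exact: poweR_ge0.
  have snf : sobolev_norm Omega p w u g \is a fin_num by rewrite ge0_fin_numE.
  have e0 : 0 < fine (sobolev_norm Omega p w u g) + 1 by rewrite ltr_wpDl// fine_ge0.
  have [+ _] := sobolev_norm_ltP e0 mfu mg.
  by case=> //; rewrite -[X in (X < _)%E]fineK// lte_fin ltrDl.
- have [mfu mg] := weak_gradient_measurable wg; split=> //.
  set c := \int[mu]_(x in O) (`|u x| `^ p) + \int[mu]_(x in O) (w x * enorm (g x) `^ p).
  have e0 : 0 < (`|c| + 1) `^ p^-1 by rewrite powR_gt0// ltr_wpDl.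
  have [_] := sobolev_norm_ltP e0 mfu mg.
  have -> : ((`|c| + 1) `^ p^-1) `^ p = `|c| + 1.
    by rewrite -powRrM mulVf ?gt_eqF// powRr1// addr_ge0.
  move=> /(_ _)/lt_trans; apply; last exact: ltry.
  by split => //; rewrite (le_lt_trans (ler_norm c))// ltrDl.
Qed.

Lemma test_weight_integrable phi f : test_function Omega phi -> L1loc Omega f ->
  integrable (fun x => phi x * f x).
Proof.
move=> Tphi [mf If]; have [C C0 phiC] := test_function_bounded Tphi.
have [_ cphi sphi] := Tphi; set K := closure _ in cphi sphi.
have mK : measurable (K : set X) by exact/measurable_closed/closed_closure.
have mphi := test_function_measurable (D := O) Tphi.
have IK : integrable (fun x => (f \_ K) x).
  rewrite (_ : EFin \o _ = (EFin \o f) \_ K); last by rewrite restrict_EFin.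
  by apply/(integrable_restrict mu mK mO); rewrite setIidr//; exact: If.
have ICK : integrable (fun x => C * `|(f \_ K) x|).
  by apply: (@integrableZl _ _ _ mu O mO C (EFin \o (fun x => `|(f \_ K) x|))); exact: integrable_norm.
apply: (ae_le_integrable mO _ ICK); first exact: measurable_funM.
apply: aeW => x _; rewrite normrM.
have [->|x0] := eqVneq (phi x) 0.
  by rewrite normr0 mul0r mulr_ge0// ltW.
rewrite patchE mem_set; first by rewrite ler_wpM2r.
exact: (@subset_closure _ [set y | phi y != 0]).
Qed.

Lemma grad_test_mfun phi i : test_function Omega phi -> mfun (fun x => grad phi x 0 i).
Proof.
move=> Tphi; under eq_fun do rewrite mxE.
exact: test_function_measurable (test_function_partial i Tphi).
Qed.

(** The k-th approximation is so good that (k + 1) times its error has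
    integral at most 2 ^ (- k - 1). The sum [D] of all these errors is
    integrable, and the factor k + 1 forces pointwise convergence. *)
Lemma approx_dominated v g : W1p0 Omega p w v g ->
  exists (psi : nat -> E -> R) (D : E -> R),
  [/\ forall k, test_function Omega (psi k), integrable D &
   ae_in Omega (fun x => forall k,
     k.+1%:R * (`|v x - psi k x| `^ p + w x * enorm (g x - grad (psi k) x) `^ p) <= D x)].
Proof.
move=> [[wg _] app]; have [mv mg] := weak_gradient_measurable wg.
pose e_ (k : nat) : R := (1 / (2 ^ k.+1)%:R / k.+1%:R) `^ p^-1.
have e0 k : 0 < e_ k by rewrite powR_gt0// divr_gt0// divr_gt0// ltr0n expn_gt0.
have eE k : e_ k `^ p = 1 / (2 ^ k.+1)%:R / k.+1%:R.
  by rewrite -powRrM mulVf ?gt_eqF// powRr1// divr_ge0// divr_ge0.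
have /choice[psi psiP] : forall k, exists phi, test_function Omega phi /\
    (sobolev_norm Omega p w (v \- phi)%R (g \- grad phi)%R < (e_ k)%:E)%E.
  by move=> k; have [phi ? ?] := app _ (e0 k); exists phi.
pose A k x := `|v x - psi k x| `^ p; pose B k x := w x * enorm (g x - grad (psi k) x) `^ p.
have mpsi k : mfun (fun x => (v \- psi k) x).
  exact: (measurable_funB mv (test_function_measurable (D := O) (psiP k).1)).
have mgpsi k i : mfun (fun x => (g \- grad (psi k)) x 0 i).
  rewrite (_ : (fun x => _) = (fun x => g x 0 i - grad (psi k) x 0 i)); last first.
    by apply/funext => x; rewrite !mxE.
  exact: (measurable_funB (mg i) (grad_test_mfun i (psiP k).1)).
have IAB k : [/\ integrable (A k), integrable (B k) &
    \int[mu]_(x in O) A k x + \int[mu]_(x in O) B k x < 1 / (2 ^ k.+1)%:R / k.+1%:R].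
  rewrite -eE; have [/(_ (psiP k).2)[h1 h2 h3] _] := sobolev_norm_ltP (e0 k) (mpsi k) (mgpsi k).
  by split.
pose F k x := k.+1%:R * (A k x + B k x).
have IF k : integrable (F k).
  by have [iA iB _] := IAB k; exact: (integrableRZ mO _ (integrableRD mO iA iB)).
have F0 : {ae mu, forall x : X, Omega x -> forall k, 0 <= F k x}.
  apply: filterS w_gt0 => x wx Ox k.
  by rewrite mulr_ge0// addr_ge0 ?powR_ge0// mulr_ge0 ?powR_ge0// ltW// wx.
have IFle k : \int[mu]_(x in O) F k x <= 1 / (2 ^ k.+1)%:R.
  have [iA iB AB] := IAB k.
  rewrite (RintegralZl _ mO (integrableRD mO iA iB)) (RintegralD mO iA iB).
  move: AB; move: (Rintegral mu O (A k)) (Rintegral mu O (B k)) => a b ab.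
  by rewrite -ler_pdivlMl// mulrC ltW.
have [G iG FG] := summable_dominated mO IF F0 IFle.
exists psi, G; split => // k; exact: (psiP k).1.
Qed.

End sobolev.

(** * The chain rule for weak gradients *)

Section composition.
Context (R : realType) (n : nat).
Local Notation E := 'rV[R]_n.+1.
Local Notation X := (caratheodory_type (@leb_outer R n)).
Local Notation mu := (@leb R n).

(** [G] is a bounded function of class C^oo with bounded derivative [G']. Its
    smoothness is expressed through compositions with smooth functions on R^N,
    because only these are used. *)
Definition smooth_bounded (G G' : R -> R) : Prop :=
  [/\ forall f : E -> R, smooth_on setT f -> smooth_on setT (G \o f),
      forall t : R, is_derive t (1 : R) G (G' t), continuous G' &
      exists2 M, 0 < M & forall t, `|G t| <= M /\ `|G' t| <= M].

Lemma smooth_bounded_continuous G G' : smooth_bounded G G' -> continuous G.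
Proof.
move=> [_ DG _ _] t.
by apply/differentiable_continuous/derivable1_diffP; have [] := DG t.
Qed.

Lemma partial_mul_comp G G' (zeta psi : E -> R) i x : smooth_bounded G G' ->
  smooth_on setT zeta -> smooth_on setT psi ->
  partial i (fun y => zeta y * G (psi y)) x =
  G (psi x) * partial i zeta x + zeta x * G' (psi x) * partial i psi x.
Proof.
move=> [_ DG _ _] Sz Sp.
have d1 := smooth_is_derive i x Sz.
have d2 := is_derive_comp (smooth_is_derive i x Sp) (DG (psi x)).
have [_ e] := is_deriveM d1 d2; apply: etrans e _.
by rewrite -![_ *: _]/(_ * _) /= addrC mulrA.
Qed.

Lemma grad_mul_comp G G' (zeta psi : E -> R) x : smooth_bounded G G' ->
  smooth_on setT zeta -> smooth_on setT psi ->
  grad (fun y => zeta y * G (psi y)) x =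
  G (psi x) *: grad zeta x + (zeta x * G' (psi x)) *: grad psi x.
Proof.
by move=> GG Sz Sp; apply/rowP => i; rewrite !mxE (partial_mul_comp i x GG Sz Sp).
Qed.

Lemma harmonic_cvg0 (a : nat -> R) (D : R) : (forall k, 0 <= a k) ->
  (forall k, k.+1%:R * a k <= D) -> a @ \oo --> 0.
Proof.
move=> a0 aD; apply: (@squeeze_cvgr _ _ _ _ (fun=> 0) (fun k => D * harmonic k)).
- by apply: nearW => k; rewrite a0/= /harmonic/= ler_pdivlMr// mulrC.
- exact: cvg_cst.
- by rewrite -[X in _ --> X](mulr0 D); apply: cvgM; [exact: cvg_cst|exact: cvg_harmonic].
Qed.

Variables (Omega : set E) (p : R) (w : E -> R).
Hypotheses (oO : open Omega) (p1 : 1 < p).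
Hypothesis Aw : class_A Omega p w.
Implicit Types (u v f phi psi xi zeta : E -> R) (g h : E -> E).
Local Notation O := (Omega : set X).
Local Notation integrable f := (mu.-integrable O (EFin \o (f : X -> R))).
Local Notation mfun f := (measurable_fun O (f : X -> R)).

Let p0 : 0 < p. Proof. exact: lt_trans p1. Qed.
Let mO : measurable O. Proof. exact: measurable_open. Qed.
Let w_gt0 : {ae mu, forall x : X, Omega x -> 0 < w x}. Proof. by have [[]] := Aw. Qed.

(** The last bound dominates the gradients of the approximations on compact
    sets, by [young_weight]: this is where the local integrability of
    w ^ (- 1 / (p - 1)) enters. *)
Lemma approx_ae v g : W1p0 Omega p w v g ->
  exists (psi : nat -> E -> R) (D : E -> R),
  [/\ forall k, test_function Omega (psi k), integrable D &
   {ae mu, forall x : X, Omega x ->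
     [/\ psi ^~ x @ \oo --> v x,
         (fun k => enorm (g x - grad (psi k) x)) @ \oo --> 0,
         forall k, w x * enorm (g x - grad (psi k) x) `^ p <= D x &
         forall k, enorm (g x - grad (psi k) x) <= D x + w x `^ (- (p - 1)^-1)]}].
Proof.
move=> /(approx_dominated oO p1 Aw)[psi [D [Tpsi iD psiD]]].
exists psi, D; split => //; apply: filterS2 w_gt0 psiD => x + + Ox.
move=> /(_ Ox) wx /(_ Ox) Dx.
have a0 k : 0 <= `|v x - psi k x| `^ p by exact: powR_ge0.
have b0 k : 0 <= w x * enorm (g x - grad (psi k) x) `^ p.
  by rewrite mulr_ge0 ?powR_ge0// ltW.
have bD k : w x * enorm (g x - grad (psi k) x) `^ p <= D x.
  apply: le_trans (Dx k); rewrite mulrDr.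
  apply: (@le_trans _ _ (k.+1%:R * (w x * enorm (g x - grad (psi k) x) `^ p))).
    by rewrite ler_peMl// ler1n.
  by rewrite lerDr mulr_ge0.
split=> //.
- have h : (fun k => `|v x - psi k x|) @ \oo --> 0.
    apply: (powR_cvg0_inv p0) => //; apply: (@harmonic_cvg0 _ (D x)) => // k.
    by apply: le_trans (Dx k); rewrite ler_wpM2l// lerDl.
  by apply/cvgrPdist_le => e e0; move/cvgrPdist_le: h => /(_ _ e0); apply: filterS => k;
    rewrite sub0r normrN normr_id.
- apply: (powR_cvg0_inv p0) => [k|]; first exact: enorm_ge0.
  apply: (@harmonic_cvg0 _ (D x / w x)) => [k|k]; first exact: powR_ge0.
  rewrite ler_pdivlMr// -mulrA [_ * w x]mulrC.
  by apply: le_trans (Dx k); rewrite ler_wpM2l// lerDr.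
- move=> k; apply: le_trans (young_weight p1 wx (enorm_ge0 _)) _.
  by rewrite lerD2r.
Qed.

(** G(psi) xi is a test function when psi is one, so the integral of each of
    its derivatives is 0. Dominated convergence carries this identity from
    the approximations of [v] to [v]. *)
Lemma chain_rule_weak v g G G' xi i : W1p0 Omega p w v g ->
  smooth_bounded G G' -> test_function Omega xi ->
  integrable (fun x => G (v x) * partial i xi x) /\
  integrable (fun x => G' (v x) * g x 0 i * xi x) /\
  \int[mu]_(x in O) (G (v x) * partial i xi x) =
  - \int[mu]_(x in O) (G' (v x) * g x 0 i * xi x).
Proof.
move=> W0 GG Txi; have [[wg _] _] := W0.
have [mv mg] := weak_gradient_measurable wg.
have [SG DG cG' [M M0 GM]] := GG.
have [psi [D [Tpsi iD psiP]]] := approx_ae W0.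
have [C C0 xiC] := test_function_bounded Txi.
have Tdxi := test_function_partial i Txi.
have [Sxi _ _] := Txi.
have mGv := measurable_comp_continuous (smooth_bounded_continuous GG) mv.
have mG'v := measurable_comp_continuous cG' mv.
have mxi := test_function_measurable (D := O) Txi.
have mdxi := test_function_measurable (D := O) Tdxi.
have idxi := test_function_integrable Tdxi mO.
have ixig : integrable (fun x => xi x * g x 0 i).
  by apply: (test_weight_integrable oO Txi); have [_ mgi _] := wg.
have ixiw : integrable (fun x => xi x * w x `^ (- (p - 1)^-1)).
  by apply: (test_weight_integrable oO Txi); have [] := Aw.
have iG : integrable (fun x => G (v x) * partial i xi x).
  apply: (ae_le_integrable mO (measurable_funM mGv mdxi) (integrableRZ mO M (integrableR_norm idxi))).
  by apply: aeW => x _; rewrite normrM ler_wpM2r//; have [] := GM (v x).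
have iG' : integrable (fun x => G' (v x) * g x 0 i * xi x).
  apply: (ae_le_integrable mO (measurable_funM (measurable_funM mG'v (mg i)) mxi)
    (integrableRZ mO M (integrableR_norm ixig))).
  apply: aeW => x _ /=; rewrite -mulrA normrM [g x 0 i * _]mulrC ler_wpM2r//.
  by have [] := GM (v x).
split => //; split => //.
apply/eqP; rewrite -addr_eq0 -(RintegralD mO iG iG').
have idom := integrableRD mO (integrableRZ mO M (integrableR_norm idxi))
  (integrableRZ mO M (integrableRD mO (integrableR_norm ixig)
    (integrableRD mO (integrableRZ mO C (integrableR_norm iD)) (integrableR_norm ixiw)))).
pose F k x := G (psi k x) * partial i xi x + G' (psi k x) * grad (psi k) x 0 i * xi x.
have FE k : F k = partial i (fun y => xi y * G (psi k y)).
  apply/funext => x; have [Sp _ _] := Tpsi k.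
  rewrite (partial_mul_comp i x GG Sxi Sp) /F mxE; congr (_ + _).
  by rewrite mulrC mulrA.
have TF k : test_function Omega (fun y => xi y * G (psi k y)).
  by apply: (test_function_mul Txi); apply: SG; have [] := Tpsi k.
have mF k : mfun (F k).
  by rewrite FE; exact: test_function_measurable (test_function_partial i (TF k)).
have cF : {ae mu, forall x : X, Omega x ->
    F ^~ x @ \oo --> G (v x) * partial i xi x + G' (v x) * g x 0 i * xi x}.
  apply: filterS psiP => x + Ox => /(_ Ox)[cpsi cgrad _ _].
  have cG : G (psi k x) @[k --> \oo] --> G (v x).
    by apply: continuous_cvg cpsi; exact: (smooth_bounded_continuous GG).
  have cGp : G' (psi k x) @[k --> \oo] --> G' (v x).
    by apply: continuous_cvg cpsi; exact: cG'.
  have cg : grad (psi k) x 0 i @[k --> \oo] --> g x 0 i.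
    apply/cvgrPdist_le => e e0; move/cvgrPdist_le: cgrad => /(_ _ e0).
    apply: filterS => k; rewrite sub0r normrN ger0_norm ?enorm_ge0//; apply: le_trans.
    by have := coord_le_enorm (g x - grad (psi k) x) i; rewrite !mxE.
  by apply: cvgD; [apply: cvgM => //; exact: cvg_cst|
    apply: cvgM; [apply: cvgM|exact: cvg_cst]].
have dF : {ae mu, forall (x : X) k, Omega x -> `|F k x| <=
    M * `|partial i xi x| + M * (`|xi x * g x 0 i| +
     (C * `|D x| + `|xi x * w x `^ (- (p - 1)^-1)|))}.
  apply: filterS psiP => x psix k Ox; have [_ _ _ /(_ k) bk] := psix Ox.
  have [G1 G2] := GM (psi k x).
  apply: le_trans (ler_normD _ _) _; rewrite !normrM; apply: lerD.
    by rewrite ler_wpM2r.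
  rewrite -mulrA; apply: ler_pM => //.
  set W := w x `^ _ in bk *.
  have Wge0 : 0 <= W by exact: powR_ge0.
  have gk : `|grad (psi k) x 0 i| <= `|g x 0 i| + (`|D x| + W).
    have := le_trans (coord_le_enorm (g x - grad (psi k) x) i) bk.
    rewrite !mxE distrC => h; rewrite -(subrK (g x 0 i) (partial i (psi k) x)).
    apply: le_trans (ler_normD _ _) _; rewrite addrC lerD2l; apply: le_trans h _.
    by rewrite lerD2r ler_norm.
  rewrite mulrC; apply: le_trans (ler_wpM2l (normr_ge0 _) gk) _.
  rewrite !mulrDr lerD2l (ger0_norm Wge0) lerD2r ler_wpM2r//.
have [_ cv] := dominated_Rintegral mO mF (integrable_measurable (integrableRD mO iG iG')) idom cF dF.
have F0 k : \int[mu]_(x in O) F k x = 0.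
  by rewrite FE; exact: (Rintegral_partial_in i mO (TF k)).
rewrite (_ : (fun k => _) = (fun=> 0)) in cv; last by apply/funext => k; exact: F0.
by apply/eqP; exact: (cvg_unique _ cv (cvg_cst 0)).
Qed.

End composition.

(** * Admissible test functions built from a solution *)

Section test_pair.
Context (R : realType) (n : nat).
Local Notation E := 'rV[R]_n.+1.
Local Notation X := (caratheodory_type (@leb_outer R n)).
Local Notation mu := (@leb R n).
Variables (Omega : set E) (p : R) (w : E -> R).
Hypotheses (oO : open Omega) (bO : bounded_set Omega) (p1 : 1 < p).
Hypothesis Aw : class_A Omega p w.
Implicit Types (u v f phi psi xi zeta : E -> R) (g h : E -> E).
Local Notation O := (Omega : set X).
Local Notation integrable f := (mu.-integrable O (EFin \o (f : X -> R))).
Local Notation mfun f := (measurable_fun O (f : X -> R)).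

Let p0 : 0 < p. Proof. exact: lt_trans p1. Qed.
Let mO : measurable O. Proof. exact: measurable_open. Qed.
Let mw : mfun w. Proof. by have [[]] := Aw. Qed.
Let w_gt0 : {ae mu, forall x : X, Omega x -> 0 < w x}. Proof. by have [[]] := Aw. Qed.

(** The weak gradient of zeta G(v) when [g] is that of [v]. *)
Definition chain_grad (G G' : R -> R) zeta v g : E -> E :=
  fun x => G (v x) *: grad zeta x + (zeta x * G' (v x)) *: g x.

Lemma grad_test_bounded zeta : test_function Omega zeta ->
  exists2 C, 0 < C & forall x, enorm (grad zeta x) <= C.
Proof.
move=> Tz.
have /choice[c cP] : forall i : 'I_n.+1, exists c, 0 < c /\ forall x, `|partial i zeta x| <= c.
  by move=> i; have [c c0 cz] := test_function_bounded (test_function_partial i Tz); exists c.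
have s0 : 0 <= \sum_i c i ^+ 2 by apply: sumr_ge0 => i _; exact: sqr_ge0.
exists (Num.sqrt (\sum_i c i ^+ 2) + 1) => [|x]; first by rewrite ltr_wpDl// sqrtr_ge0.
apply: (@le_trans _ _ (Num.sqrt (\sum_i c i ^+ 2))); last by rewrite lerDl.
rewrite /enorm ler_sqrt// /dot; apply: ler_sum => i _.
have [c0 cz] := cP i; rewrite !mxE -expr2 -(real_normK (num_real (partial i zeta x))).
by rewrite ler_sqr ?nnegrE// ltW.
Qed.

Lemma weight_grad_integrable zeta : test_function Omega zeta ->
  integrable (fun x => w x * enorm (grad zeta x) `^ p).
Proof.
move=> Tz; have [C C0 zC] := grad_test_bounded Tz.
have [_ [_ wK] _] := Aw.
have [_ cz sz] := Tz; set K := closure _ in cz sz.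
have mK : measurable (K : set X) by exact/measurable_closed/closed_closure.
have IK : integrable (w \_ K).
  rewrite (_ : EFin \o _ = (EFin \o w) \_ K); last by rewrite restrict_EFin.
  by apply/(integrable_restrict mu mK mO); rewrite setIidr//; exact: wK.
have mg : mfun (fun x => w x * enorm (grad zeta x) `^ p).
  apply: (measurable_funM mw); apply: measurable_powR_comp.
  by apply: measurable_enorm => i; exact: grad_test_mfun.
apply: (ae_le_integrable mO mg (integrableRZ mO (C `^ p) (integrableR_norm IK))).
apply: aeW => x _.
rewrite normrM mulrC (ger0_norm (powR_ge0 _ _)) patchE.
case: ifPn => [_|/negP].
  by rewrite ler_wpM2r//; apply: ler_powRl; [exact: ltW|exact: enorm_ge0|exact: zC].
rewrite inE => xK; rewrite normr0 mulr0.
have -> : grad zeta x = 0.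
  apply/rowP => i; rewrite !mxE; apply/eqP; apply: contra_notT xK => x0.
  have : test_function K zeta by case: Tz => *; split.
  by move=> /(test_function_partial i)/test_function_in; apply.
by rewrite enorm0 powR0 ?gt_eqF// mul0r.
Qed.

Lemma weak_gradient_chain v g G G' zeta : W1p0 Omega p w v g ->
  smooth_bounded n G G' -> test_function Omega zeta ->
  weak_gradient Omega (fun x => zeta x * G (v x)) (chain_grad G G' zeta v g).
Proof.
move=> W0 GG Tz; have [[wg _] _] := W0.
have [mv mg] := weak_gradient_measurable wg; have [_ Lg _] := wg.
have [SG DG cG' [M M0 GM]] := GG.
have [Cz Cz0 zC] := test_function_bounded Tz.
have mz := test_function_measurable (D := O) Tz.
have mGv := measurable_comp_continuous (smooth_bounded_continuous GG) mv.
have mG'v := measurable_comp_continuous cG' mv.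
have mzG := measurable_funM mz mGv.
have hE x i : chain_grad G G' zeta v g x 0 i =
    G (v x) * partial i zeta x + zeta x * G' (v x) * g x 0 i.
  by rewrite !mxE.
have mh i : mfun (fun x => chain_grad G G' zeta v g x 0 i).
  under eq_fun do rewrite hE.
  apply: measurable_funD; first apply: measurable_funM => //.
    exact: test_function_measurable (test_function_partial i Tz).
  by apply: measurable_funM (mg i); exact: measurable_funM.
have K_fin (K : set E) : compact K -> (mu K < +oo)%E.
  by move=> /compact_bounded; exact: bounded_leb_lty.
have mK (K : set E) : compact K -> measurable (K : set X).
  by move=> cK; exact: (measurable_closed (compact_closed (@norm_hausdorff _ _) cK)).
have zGM x : `|zeta x * G (v x)| <= Cz * M.
  by rewrite normrM; have [? _] := GM (v x); apply: ler_pM.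
split.
- split; first exact: mzG.
  move=> K cK KO; apply: measurable_bounded_integrable.
  + exact: mK.
  + exact: K_fin.
  + exact: (measurable_funS mO KO mzG).
  + exists (Cz * M); split; first exact: num_real.
    by move=> y Cy x _ /=; exact: le_trans (ltW Cy).
- move=> i; split; first exact: mh.
  move=> K cK KO.
  have [C C0 dzC] := test_function_bounded (test_function_partial i Tz).
  have mKK := mK _ cK.
  have iK1 : mu.-integrable (K : set X) (EFin \o (fun _ : X => M * C)).
    apply: measurable_bounded_integrable; [exact: mKK|exact: K_fin|exact: measurable_cst|].
    exact: bounded_cst.
  have iK2 := integrableRZ mKK (Cz * M) (integrableR_norm ((Lg i).2 K cK KO)).
  apply: (ae_le_integrable mKK (measurable_funS mO KO (mh i)) (integrableRD mKK iK1 iK2)).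
  apply: aeW => x _ /=; rewrite hE; apply: le_trans (ler_normD _ _) _.
  rewrite !normrM; have [G1 G2] := GM (v x).
  by apply: lerD; [exact: ler_pM|rewrite ler_wpM2r//; exact: ler_pM].
- move=> xi Txi i.
  have Tzx : test_function Omega (fun x => zeta x * xi x).
    by apply: (test_function_mul Tz); have [] := Txi.
  have [i1 [i2 i12]] := chain_rule_weak oO p1 Aw i W0 GG Tzx.
  have pE x : partial i (fun x => zeta x * xi x) x = zeta x * partial i xi x + xi x * partial i zeta x.
    have [Sz _ _] := Tz; have [Sx _ _] := Txi.
    by have [_ e] := is_deriveM (smooth_is_derive i x Sz) (smooth_is_derive i x Sx); apply: etrans e _.
  have mdxi := test_function_measurable (D := O) (test_function_partial i Txi).
  have idxi := test_function_integrable (test_function_partial i Txi) mO.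
  have iA : integrable (fun x => zeta x * G (v x) * partial i xi x).
    apply: (ae_le_integrable mO (measurable_funM mzG mdxi) (integrableRZ mO (Cz * M) (integrableR_norm idxi))).
    by apply: aeW => x _ /=; rewrite normrM; apply: ler_wpM2r => //; exact: zGM.
  have iB : integrable (fun x => chain_grad G G' zeta v g x 0 i * xi x).
    have -> : (fun x => chain_grad G G' zeta v g x 0 i * xi x) =
       (fun x => (G (v x) * partial i (fun x => zeta x * xi x) x - zeta x * G (v x) * partial i xi x)
          + G' (v x) * g x 0 i * (zeta x * xi x)).
      apply/funext => x; rewrite pE hE.
      by ring.
    exact: (integrableRD mO (integrableRB mO i1 iA) i2).
  have fA := integrable_fin_num mO iA; have fB := integrable_fin_num mO iB.
  rewrite -(fineK fA) -(fineK fB) -EFinN; congr EFin.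
  apply/eqP; rewrite -addr_eq0; apply/eqP.
  transitivity (\int[mu]_(x in O) (zeta x * G (v x) * partial i xi x) +
    \int[mu]_(x in O) (chain_grad G G' zeta v g x 0 i * xi x)); first by [].
  rewrite -(RintegralD mO iA iB).
  transitivity (\int[mu]_(x in O) (G (v x) * partial i (fun x => zeta x * xi x) x
     + G' (v x) * g x 0 i * (zeta x * xi x))).
    apply: eq_Rintegral => x _.
    rewrite pE hE.
    by ring.
  by rewrite (RintegralD mO i1 i2) i12 addNr.
Qed.

(** If the psi_k are test functions tending to v, then the zeta G(psi_k) are
    test functions, and they tend to zeta G(v) in the weighted norm: the
    difference of the gradients is bounded by a combination of the energies
    of zeta and v and of the errors of the psi_k, so dominated convergence
    applies. *)
Lemma W1p0_chain v g G G' zeta : W1p0 Omega p w v g ->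
  smooth_bounded n G G' -> test_function Omega zeta ->
  W1p0 Omega p w (fun x => zeta x * G (v x)) (chain_grad G G' zeta v g).
Proof.
move=> W0 GG Tz; have [[wg _] _] := W0.
have wgh := weak_gradient_chain W0 GG Tz.
have [mv mg] := weak_gradient_measurable wg.
have [mu_ mh] := weak_gradient_measurable wgh.
have [SG DG cG' [M M0 GM]] := GG.
have [Cz Cz0 zC] := test_function_bounded Tz.
have [_ _ iwg] := (W1pP oO p1 Aw v g).1 W0.1.
have iwz := weight_grad_integrable Tz.
have [psi [D [Tpsi iD psiP]]] := approx_ae oO p1 Aw W0.
have [Sz _ _] := Tz.
have zGM x t : `|zeta x * G t| <= Cz * M.
  by rewrite normrM; have [? _] := GM t; apply: ler_pM.
have zG'M x t : `|zeta x * G' t| <= Cz * M.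
  by rewrite normrM; have [_ ?] := GM t; apply: ler_pM.
have Mz0 : 0 <= Cz * M by rewrite mulr_ge0// ltW.
have O_fin : (mu O < +oo)%E by exact: bounded_leb_lty.
have icst (c : R) : integrable (fun _ => c).
  apply: measurable_bounded_integrable; [exact: mO|exact: O_fin|exact: measurable_cst|].
  exact: bounded_cst.
have W1 : W1p Omega p w (fun x => zeta x * G (v x)) (chain_grad G G' zeta v g).
  apply/(W1pP oO p1 Aw); split; first exact: wgh.
  - have m1 := measurable_powR_comp p (measurable_norm mu_).
    apply: (ae_le_integrable mO m1 (icst ((Cz * M) `^ p))).
    apply: aeW => x _ /=; rewrite (ger0_norm (powR_ge0 _ _)).
    by apply: ler_powRl => //; exact: ltW.
  - have m1 := measurable_funM mw (measurable_powR_comp p (measurable_enorm mh)).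
    apply: (ae_le_integrable mO m1 (integrableRZ mO (2 `^ p) (integrableRD mO
       (integrableRZ mO (M `^ p) iwz) (integrableRZ mO ((Cz * M) `^ p) iwg)))).
    apply: filterS w_gt0 => x + Ox => /(_ Ox) wx /=.
    rewrite ger0_norm; last by rewrite mulr_ge0 ?powR_ge0// ltW.
    rewrite [M `^ p * _]mulrCA [(Cz * M) `^ p * _]mulrCA -mulrDr mulrCA ler_pM2l//.
    have h : enorm (chain_grad G G' zeta v g x) <= M * enorm (grad zeta x) + Cz * M * enorm (g x).
      apply: le_trans (enormD _ _) _; rewrite !enormZ; apply: lerD; apply: ler_wpM2r;
        by [exact: enorm_ge0|have [] := GM (v x)|exact: zG'M].
    apply: le_trans (ler_powRl (ltW p0) (enorm_ge0 _) h) _.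
    have e1 : 0 <= M * enorm (grad zeta x) by rewrite mulr_ge0 ?enorm_ge0// ltW.
    have e2 : 0 <= Cz * M * enorm (g x) by rewrite mulr_ge0 ?enorm_ge0.
    apply: le_trans (powRD_le (ltW p0) e1 e2) _.
    by rewrite !(powRM p _ (enorm_ge0 _))// ltW.
split => // e e0.
pose f k x := zeta x * G (psi k x).
have Tf k : test_function Omega (f k).
  by apply: (test_function_mul Tz); apply: SG; have [] := Tpsi k.
have gf k x : grad (f k) x = chain_grad G G' zeta (psi k) (grad (psi k)) x.
  by have [Sp _ _] := Tpsi k; rewrite (grad_mul_comp x GG Sz Sp).
pose K := 2 `^ p * 2 `^ p * ((2 * M) `^ p + (2 * M * Cz) `^ p + (Cz * M) `^ p).
pose A k x := `|zeta x * G (v x) - f k x| `^ p.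
pose B k x := w x * enorm (chain_grad G G' zeta v g x - grad (f k) x) `^ p.
have md k : mfun (fun x => ((fun x => zeta x * G (v x)) \- f k)%R x).
  exact: (measurable_funB mu_ (test_function_measurable (D := O) (Tf k))).
have mdg k i : mfun (fun x => (chain_grad G G' zeta v g \- grad (f k))%R x 0 i).
  rewrite (_ : (fun x => _) = (fun x => chain_grad G G' zeta v g x 0 i - grad (f k) x 0 i)).
    exact: (measurable_funB (mh i) (grad_test_mfun i (Tf k))).
  by apply/funext => x; rewrite !mxE.
have mA k : mfun (A k) by exact: (measurable_powR_comp p (measurable_norm (md k))).
have mB k : mfun (B k).
  exact: (measurable_funM mw (measurable_powR_comp p (measurable_enorm (mdg k)))).
have GMM s t : `|G s - G t| <= 2 * M.
  have [h1 _] := GM s; have [h2 _] := GM t.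
  by apply: le_trans (ler_normB _ _) _; rewrite mulrDl mul1r lerD.
have GMM' s t : `|G' s - G' t| <= 2 * M.
  have [_ h1] := GM s; have [_ h2] := GM t.
  by apply: le_trans (ler_normB _ _) _; rewrite mulrDl mul1r lerD.
have AC k x : A k x <= (Cz * (2 * M)) `^ p.
  apply: ler_powRl; [exact: ltW|exact: normr_ge0|].
  by rewrite /f -mulrBr normrM; apply: ler_pM.
have eB k x : enorm (chain_grad G G' zeta v g x - grad (f k) x) <=
    `|G (v x) - G (psi k x)| * enorm (grad zeta x) +
    Cz * `|G' (v x) - G' (psi k x)| * enorm (g x) +
    Cz * M * enorm (g x - grad (psi k) x).
  have -> : chain_grad G G' zeta v g x - grad (f k) x =
     (G (v x) - G (psi k x)) *: grad zeta x + (zeta x * (G' (v x) - G' (psi k x))) *: g x +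
     (zeta x * G' (psi k x)) *: (g x - grad (psi k) x).
    by rewrite gf; apply/rowP => i; rewrite !mxE; ring.
  apply: le_trans (enormD _ _) _; apply: lerD; last first.
    by rewrite enormZ; apply: ler_wpM2r; [exact: enorm_ge0|exact: zG'M].
  apply: le_trans (enormD _ _) _; rewrite !enormZ lerD2l.
  by apply: ler_wpM2r; [exact: enorm_ge0|rewrite normrM; apply: ler_wpM2r].
have BK : {ae mu, forall (x : X) k, Omega x -> B k x <=
    K * (w x * enorm (grad zeta x) `^ p + w x * enorm (g x) `^ p + D x)}.
  apply: filterS2 psiP w_gt0 => x psix wx k Ox.
  have {}wx := wx Ox; have [_ _ /(_ k) wD _] := psix Ox.
  have n1 := enorm_ge0 (grad zeta x); have n2 := enorm_ge0 (g x).
  have n3 := enorm_ge0 (g x - grad (psi k) x).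
  apply: (@le_trans _ _ (w x * (2 * M * enorm (grad zeta x) + 2 * M * Cz * enorm (g x)
      + Cz * M * enorm (g x - grad (psi k) x)) `^ p)).
    rewrite ler_pM2l//; apply: ler_powRl; [exact: ltW|exact: enorm_ge0|].
    apply: le_trans (eB k x) _; rewrite lerD2r; apply: lerD; apply: ler_wpM2r => //.
    by rewrite [_ * Cz]mulrC ler_pM2l.
  have M20 : 0 <= 2 * M by rewrite mulr_ge0// ltW.
  have MC0 : 0 <= 2 * M * Cz by rewrite mulr_ge0// ltW.
  apply: (@le_trans _ _ (w x * (2 `^ p * 2 `^ p * ((2 * M * enorm (grad zeta x)) `^ p
      + (2 * M * Cz * enorm (g x)) `^ p + (Cz * M * enorm (g x - grad (psi k) x)) `^ p)))).
    by rewrite ler_pM2l//; apply: powRD3_le; rewrite ?mulr_ge0// ltW.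
  rewrite (powRM p M20 n1) (powRM p MC0 n2) (powRM p Mz0 n3) mulrCA /K -[leRHS]mulrA.
  apply: ler_wpM2l; first by rewrite mulr_ge0 ?powR_ge0.
  have := wD.
  move: (w x) (D x) wx (enorm (grad zeta x) `^ p) (powR_ge0 (enorm (grad zeta x)) p)
     (enorm (g x) `^ p) (powR_ge0 (enorm (g x)) p)
     (enorm (g x - grad (psi k) x) `^ p) (powR_ge0 (enorm (g x - grad (psi k) x)) p).
  move: ((2 * M) `^ p) (powR_ge0 (2 * M) p) ((2 * M * Cz) `^ p) (powR_ge0 (2 * M * Cz) p)
     ((Cz * M) `^ p) (powR_ge0 (Cz * M) p).
  move=> c1 c10 c2 c20 c3 c30 W0' D0 W0p a a0 b b0 c c0 h.
  have wc : 0 <= W0' * c by rewrite mulr_ge0// ltW.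
  have wa : 0 <= W0' * a by rewrite mulr_ge0// ltW.
  have wb : 0 <= W0' * b by rewrite mulr_ge0// ltW.
  have d0 : 0 <= D0 by exact: le_trans h.
  have -> : W0' * (c1 * a + c2 * b + c3 * c) = c1 * (W0' * a) + c2 * (W0' * b) + c3 * (W0' * c) by ring.
  move: (W0' * a) (W0' * b) (W0' * c) wa wb wc h => y1 y2 y3 *; nra.
have iS := integrableRD mO (icst ((Cz * (2 * M)) `^ p)) (integrableRZ mO K
  (integrableRD mO (integrableRD mO iwz iwg) iD)).
have dS : {ae mu, forall (x : X) k, Omega x -> `|A k x + B k x| <=
    (Cz * (2 * M)) `^ p + K * (w x * enorm (grad zeta x) `^ p + w x * enorm (g x) `^ p + D x)}.
  apply: filterS2 BK w_gt0 => x BKx wx k Ox; have {}BKx := BKx k Ox; have {}wx := wx Ox.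
  rewrite ger0_norm; first exact: lerD.
  by rewrite addr_ge0 ?powR_ge0// mulr_ge0 ?powR_ge0// ltW.
have cS : {ae mu, forall x : X, Omega x -> (fun k => A k x + B k x) @ \oo --> 0}.
  apply: filterS psiP => x + Ox => /(_ Ox)[cpsi cgrad _ _].
  have cG : (fun k => `|G (v x) - G (psi k x)|) @ \oo --> 0.
    rewrite -(normr0 R) -(subrr (G (v x))); apply: cvg_norm; apply: cvgB; first exact: cvg_cst.
    by apply: continuous_cvg cpsi; exact: (smooth_bounded_continuous GG).
  have cGp : (fun k => `|G' (v x) - G' (psi k x)|) @ \oo --> 0.
    rewrite -(normr0 R) -(subrr (G' (v x))); apply: cvg_norm; apply: cvgB; first exact: cvg_cst.
    by apply: continuous_cvg cpsi; exact: cG'.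
  rewrite -[X in _ --> X]addr0; apply: cvgD.
    apply: (cvg0_powR p0) => [k|]; first exact: normr_ge0.
    under eq_fun do rewrite /f -mulrBr normrM.
    by rewrite -(mulr0 `|zeta x|); apply: cvgM => //; exact: cvg_cst.
  rewrite -(mulr0 (w x)); apply: cvgM; first exact: cvg_cst.
  apply: (cvg0_powR p0) => [k|]; first exact: enorm_ge0.
  apply: (@squeeze_cvgr _ _ _ _ (fun=> 0) (fun k =>
    `|G (v x) - G (psi k x)| * enorm (grad zeta x) +
    Cz * `|G' (v x) - G' (psi k x)| * enorm (g x) +
    Cz * M * enorm (g x - grad (psi k) x))); last 2 first.
  - exact: cvg_cst.
  - rewrite [X in _ --> X](_ : _ = 0 * enorm (grad zeta x) + Cz * 0 * enorm (g x) + Cz * M * 0); last by ring.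
    apply: cvgD; [apply: cvgD|]; apply: cvgM => //; try exact: cvg_cst.
    by apply: cvgM => //; exact: cvg_cst.
  - by apply: nearW => k; rewrite enorm_ge0/=; exact: eB.
have mS k : mfun (fun x => A k x + B k x) by exact: measurable_funD.
have [_ cv] := dominated_Rintegral mO mS (measurable_cst (0 : R)) iS cS dS.
rewrite (_ : \int[mu]_(x in O) 0 = 0) in cv; last by rewrite /Rintegral integral0.
have /cvgrPdist_lt/(_ _ (powR_gt0 p e0))[k _ /(_ k (leqnn k))] := cv.
rewrite sub0r normrN => Ske.
have iA : integrable (A k).
  apply: (ae_le_integrable mO (mA k) (icst ((Cz * (2 * M)) `^ p))).
  by apply: aeW => x _ /=; rewrite (ger0_norm (powR_ge0 _ _)); exact: AC.
have iB : integrable (B k).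
  apply: (ae_le_integrable mO (mB k) (integrableRZ mO K
    (integrableRD mO (integrableRD mO iwz iwg) iD))).
  apply: filterS2 BK w_gt0 => x BKx wx Ox; have {}wx := wx Ox.
  rewrite ger0_norm; first exact: BKx.
  by rewrite mulr_ge0 ?powR_ge0// ltW.
exists (f k) => //; apply/(sobolev_norm_ltP oO p1 Aw e0 (md k) (mdg k)); split => //.
apply: le_lt_trans Ske; rewrite (RintegralD mO iA iB); exact: ler_norm.
Qed.

End test_pair.

(** * A smooth substitute for the truncation of the identity *)

Section profile.
Context (R : realType).
Implicit Types (t m p a b : R).

(** Picone's inequality calls for the test function |phi| ^ p / v ^ (p - 1),
    and v may vanish. The function profile (m v) / m replaces v there: it is
    smooth, at least 1 / m, and within 4 / m of v >= 0. Its derivative must be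
    bounded and at least 1 on the half-line [v >= 0]; sqrt (1 + t ^ 2) alone
    has derivative 0 at the origin, and the term (t - 1) / sqrt (1 + t ^ 2)
    corrects this. *)
Definition profile t : R := Num.sqrt (1 + t ^+ 2) + (t - 1) / Num.sqrt (1 + t ^+ 2) + 2.

Definition dprofile t : R := t / Num.sqrt (1 + t ^+ 2) + (Num.sqrt (1 + t ^+ 2))^-1
  - (t - 1) * t / Num.sqrt (1 + t ^+ 2) ^+ 3.

Let r t : R := Num.sqrt (1 + t ^+ 2).

Let Q0 t : 0 < 1 + t ^+ 2. Proof. by rewrite ltr_wpDr// sqr_ge0. Qed.
Let r0 t : 0 < r t. Proof. by rewrite sqrtr_gt0. Qed.
Let r2 t : r t ^+ 2 = 1 + t ^+ 2. Proof. by rewrite sqr_sqrtr// ltW. Qed.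
Let r1 t : 1 <= r t.
Proof. by rewrite -(@ler_pXn2r _ 2)// ?nnegrE ?(ltW (r0 t))// expr1n r2 lerDl sqr_ge0. Qed.
Let tr t : `|t| <= r t.
Proof.
rewrite -(@ler_pXn2r _ 2)// ?nnegrE//; last exact: ltW.
by rewrite real_normK ?num_real// r2 lerDr.
Qed.
Let rt t : 0 <= t -> r t <= 1 + t.
Proof.
move=> t0; rewrite -(@ler_pXn2r _ 2)// ?nnegrE ?addr_ge0 ?(ltW (r0 t))// r2.
by rewrite sqrrD expr1n; lra.
Qed.
Let tV t : `|t / r t| <= 1.
Proof. by rewrite normrM normfV (gtr0_norm (r0 t)) ler_pdivrMr// mul1r. Qed.
Let rV t : `|(r t)^-1| <= 1.
Proof. by rewrite gtr0_norm ?invr_gt0// invf_le1. Qed.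

Let t1V t : - 2 <= (t - 1) / r t <= 2.
Proof.
rewrite mulrBl mul1r; have := tV t; have := rV t; rewrite !ler_norml.
by move: (t / r t) (r t)^-1 => x y; lra.
Qed.

Lemma is_derive_profile t : is_derive t (1 : R) profile (dprofile t).
Proof.
have d2 : is_derive t (1 : R) (fun s : R => 1 + s ^+ 2) (2 * t).
  apply: is_derive_eq (is_deriveD (is_derive_cst (1 : R) t (1 : R))
    (is_deriveX 2 (is_derive_id t (1 : R)))) _.
  by rewrite add0r -![_ *: _]/(_ * _) expr1 mulr1.
have dr : is_derive t (1 : R) r (t / r t).
  apply: is_derive_eq (@is_derive1_comp _ Num.sqrt (fun s : R => 1 + s ^+ 2) t _ _
    (is_derive1_sqrt (Q0 t)) d2) _.
  by rewrite -/(r t); field; rewrite gt_eqF.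
have dV := is_deriveV (lt0r_neq0 (r0 t)) dr.
have dt : is_derive t (1 : R) (fun s : R => s - 1) 1.
  by apply: is_derive_eq (is_deriveB (is_derive_id t (1 : R)) (is_derive_cst (1 : R) t (1 : R))) _;
    rewrite subr0.
apply: is_derive_eq (is_deriveD (is_deriveD dr (is_deriveM dt dV)) (is_derive_cst (2 : R) t (1 : R))) _.
rewrite /dprofile -/(r t) addr0 -![_ *: _]/(_ * _).
by field; rewrite gt_eqF.
Qed.

Lemma profile_ge1 t : 1 <= profile t.
Proof. by rewrite /profile -/(r t); have := r1 t; have := t1V t; move: ((t - 1) / r t) (r t) => x y; lra. Qed.

Lemma profile_ge t : 0 <= t -> t <= profile t.
Proof.
move=> t0; rewrite /profile -/(r t); have := tr t; have := t1V t.
by rewrite ger0_norm//; move: ((t - 1) / r t) (r t) => x y; lra.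
Qed.

Lemma profile_le t : 0 <= t -> profile t <= t + 4.
Proof.
move=> t0; rewrite /profile -/(r t); have := rt t0.
have : (t - 1) / r t <= 1.
  by rewrite ler_pdivrMr// mul1r; have := tr t; rewrite ger0_norm//; lra.
by move: ((t - 1) / r t) (r t) => x y; lra.
Qed.

Lemma dprofile_le t : `|dprofile t| <= 4.
Proof.
rewrite /dprofile -/(r t).
have -> : (t - 1) * t / r t ^+ 3 = ((t - 1) / r t) * (t / r t) * (r t)^-1.
  by field; rewrite gt_eqF.
have h1 : `|(t - 1) / r t| <= 2 by rewrite ler_norml.
have h : `|(t - 1) / r t * (t / r t) * (r t)^-1| <= 2.
  rewrite !normrM (_ : 2 = 2 * 1 * 1 :> R); last by rewrite !mulr1.
  apply: ler_pM; [exact: mulr_ge0|by []| |by rewrite normfV -normfV; exact: rV].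
  by apply: ler_pM => //; rewrite -normrM -?normfV; [exact: h1|exact: tV].
have := ler_normD (t / r t + (r t)^-1) (- ((t - 1) / r t * (t / r t) * (r t)^-1)).
have := ler_normD (t / r t) (r t)^-1; rewrite normrN; have := tV t; have := rV t.
by move: h; lra.
Qed.

Lemma dprofile_ge1 t : 0 <= t -> 1 <= dprofile t.
Proof.
move=> t0; rewrite /dprofile -/(r t).
have -> : t / r t + (r t)^-1 - (t - 1) * t / r t ^+ 3 =
    (t * r t ^+ 2 + (r t ^+ 2 - t ^+ 2) + t) / r t ^+ 3.
  by field; rewrite gt_eqF.
rewrite {2}r2 addrK ler_pdivlMr ?exprn_gt0// mul1r.
have := tr t; rewrite ger0_norm//; have := r2 t; have := rt t0; have := r0 t.
move: (r t) => s s0 h1 h2 h3.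
have h4 : s ^+ 2 <= t * s + 1 by rewrite h2; nra.
by rewrite exprSr; nra.
Qed.

(** Applying [G] to a coordinate function shows that [G] is of class C^1. *)
Lemma smooth_bounded_cont n (G G' : R -> R) :
  (forall f : 'rV[R]_n.+1 -> R, smooth_on setT f -> smooth_on setT (G \o f)) ->
  (forall t : R, is_derive t (1 : R) G (G' t)) -> continuous G'.
Proof.
move=> SG DG; pose c := fun x : 'rV[R]_n.+1 => x 0 0.
have Sc : smooth_on setT c by move=> k; exact: class_C_coord.
have := smooth_continuous (smooth_partial 0 (SG _ Sc)).
have -> : partial 0 (G \o c) = G' \o c.
  apply/funext => x; have [_ e] := is_derive_comp (smooth_is_derive 0 x Sc) (DG (c x)).
  apply: etrans e _ => /=; rewrite -[RHS]mulr1; congr (_ * _).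
  have d : is_derive x (delta_mx 0 0) (c : _ -> R^o) 1.
    have e : x = x + 0 *: delta_mx 0 0 by rewrite scale0r addr0.
    rewrite {1}e; apply/is_derive_line.
    rewrite (_ : (fun s : R => _) = cst (x 0 0) + id).
      by apply: is_derive_eq; rewrite add0r.
    by apply/funext => s; rewrite /c !mxE/= mulr1.
  by have [_ e1] := d; exact: e1.
move=> cG t; pose l (s : R) : 'rV[R]_n.+1 := s *: delta_mx 0 0.
have e : G' = (G' \o c) \o l by apply/funext => s; rewrite /c /l /= !mxE/= mulr1.
rewrite e; apply: continuous_comp; last exact: cG.
by apply: continuousZl; exact: cvg_id.
Qed.

End profile.

(** * Nonlinear functions of a solution *)

Section truncations.
Context (R : realType) (n : nat).
Local Notation E := 'rV[R]_n.+1.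
Implicit Types (f : E -> R).

Lemma smooth_profile f : smooth_on setT f -> smooth_on setT (fun x => profile (f x)).
Proof.
move=> Sf.
have Q0 x : 0 < 1 + f x ^+ 2 by rewrite ltr_wpDr// sqr_ge0.
have SQ : smooth_on setT (fun x => 1 + f x ^+ 2).
  by apply: smoothD; [exact: smooth_cst|exact: smoothM].
have r0 x : 0 < Num.sqrt (1 + f x ^+ 2) by rewrite sqrtr_gt0.
have Sr : smooth_on setT (fun x => Num.sqrt (1 + f x ^+ 2)).
  under eq_fun do rewrite -(powR12_sqrt (ltW (Q0 _))).
  exact: smooth_powR.
have SV : smooth_on setT (fun x => (Num.sqrt (1 + f x ^+ 2))^-1).
  under eq_fun do rewrite -(powR_inv1 (ltW (r0 _))).
  exact: smooth_powR.
apply: smoothD; last exact: smooth_cst.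
apply: smoothD => //; apply: smoothM => //.
by apply: smoothD => //; exact: smooth_cst.
Qed.

Definition profile_pow (p m t : R) : R := (profile (m * t) / m) `^ (1 - p).

Definition dprofile_pow (p m t : R) : R :=
  (1 - p) * (profile (m * t) / m) `^ (- p) * dprofile (m * t).

Lemma smooth_bounded_profile p m : 1 < p -> 1 <= m ->
  smooth_bounded n (profile_pow p m) (dprofile_pow p m).
Proof.
move=> p1 m1; have m0 : 0 < m by exact: lt_le_trans m1.
have h0 t : 0 < profile (m * t) / m by rewrite divr_gt0// (lt_le_trans ltr01)// profile_ge1.
have hm t : m^-1 <= profile (m * t) / m by rewrite ler_pdivlMr// mulVf ?gt_eqF// profile_ge1.
have Dh t : is_derive t (1 : R) (fun s : R => profile (m * s) / m) (dprofile (m * t)).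
  have d1 : is_derive t (1 : R) (fun s : R => m * s) m.
    by apply: is_derive_eq (is_deriveZ m (is_derive_id t (1 : R))) _; rewrite [_ *: _]mulr1.
  have d2 := @is_derive1_comp _ (@profile R) (fun s : R => m * s) t _ _ (is_derive_profile (m * t)) d1.
  apply: is_derive_eq (is_deriveM d2 (is_derive_cst (m^-1 : R) t (1 : R))) _.
  by rewrite scaler0 add0r /= -![_ *: _]/(_ * _) mulrCA mulVf ?gt_eqF// mulr1.
have SG f : smooth_on setT f -> smooth_on setT (profile_pow p m \o f).
  move=> Sf; apply: (@smooth_powR _ _ (fun x => profile (m * f x) / m)) => //.
  apply: smoothM; last exact: smooth_cst.
  by apply: (@smooth_profile (fun x => m * f x)); apply: smoothM => //; exact: smooth_cst.
have DG t : is_derive t (1 : R) (profile_pow p m) (dprofile_pow p m t).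
  apply: is_derive_eq (@is_derive1_comp _ (fun y : R => y `^ (1 - p))
    (fun s : R => profile (m * s) / m) t _ _ (is_derive1_powR (1 - p) (h0 t)) (Dh t)) _.
  by rewrite /dprofile_pow addrAC subrr add0r.
have pw (q t : R) : 0 <= q -> (profile (m * t) / m) `^ (- q) <= m `^ q.
  move=> q0; rewrite powRN -[leRHS]invrK lef_pV2 ?posrE ?invr_gt0 ?powR_gt0//.
  rewrite -powRN -[m `^ (- q)](_ : (m^-1) `^ q = _); last first.
    by rewrite -powR_inv1 ?ltW// -powRrM mulN1r.
  by apply: ler_powRl => //; rewrite invr_ge0 ltW.
split => //; first exact: smooth_bounded_cont SG DG.
exists (m `^ (p - 1) + (p - 1) * m `^ p * 4).
  by rewrite ltr_pwDl ?powR_gt0// !mulr_ge0 ?powR_ge0// subr_ge0 ltW.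
move=> t; split.
  rewrite ger0_norm ?powR_ge0// /profile_pow -opprB.
  rewrite -[leLHS]addr0; apply: lerD; first by apply: pw; rewrite subr_ge0 ltW.
  by rewrite !mulr_ge0 ?powR_ge0// subr_ge0 ltW.
rewrite /dprofile_pow !normrM -[leLHS]add0r; apply: lerD; first exact: powR_ge0.
have -> : `|1 - p| = p - 1 by rewrite distrC gtr0_norm// subr_gt0.
rewrite (ger0_norm (powR_ge0 _ _)).
rewrite -!mulrA; apply: ler_wpM2l; first by rewrite subr_ge0 ltW.
apply: ler_pM; [exact: powR_ge0|exact: normr_ge0|apply: pw|exact: dprofile_le].
by rewrite ltW// (lt_trans ltr01).
Qed.

(** As m tends to infinity, this tends to the indicator of t != 0 for every
    s > 0, whereas its derivative carries the factor s. *)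
Definition escape (s m t : R) : R := 1 - (1 + (m * t) ^+ 2) `^ (- s).

Definition descape (s m t : R) : R :=
  s * (2 * m * (m * t)) * (1 + (m * t) ^+ 2) `^ (- s - 1).

Lemma escape_ge0 s m t : 0 < s -> 0 <= escape s m t <= 1.
Proof.
move=> s0; rewrite /escape subr_ge0 lerBlDr lerDl powR_ge0 andbT.
have Q1 : 1 <= 1 + (m * t) ^+ 2 by rewrite lerDl sqr_ge0.
rewrite powRN invf_le1 ?powR_gt0 ?(lt_le_trans ltr01)//.
by have := ler_powRl (ltW s0) ler01 Q1; rewrite powR1.
Qed.

Lemma descape_le s m t : 0 < s -> 0 < m ->
  `|descape s m t| <= s * (2 * m * (`|m * t| / (1 + (m * t) ^+ 2))).
Proof.
move=> s0 m0; have Q1 : 1 <= 1 + (m * t) ^+ 2 by rewrite lerDl sqr_ge0.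
have Q0 : 0 < 1 + (m * t) ^+ 2 by exact: lt_le_trans Q1.
rewrite /descape !normrM (gtr0_norm s0) (gtr0_norm m0) [`|2|]gtr0_norm//.
rewrite -!mulrA ler_pM2l// !mulrA ler_wpM2l//.
  by rewrite !mulr_ge0// ltW.
rewrite ger0_norm ?powR_ge0// powRD; last by rewrite (gt_eqF Q0) implybT.
rewrite (powR_inv1 (ltW Q0)) -[leRHS]mul1r; apply: ler_wpM2r; first by rewrite invr_ge0 ltW.
by have := escape_ge0 m t s0; rewrite /escape => /andP[]; rewrite subr_ge0.
Qed.

Lemma smooth_bounded_escape s m : 0 < s -> 0 < m ->
  smooth_bounded n (escape s m) (descape s m).
Proof.
move=> s0 m0.
have Q0 t : 0 < 1 + (m * t) ^+ 2 by rewrite ltr_wpDr// sqr_ge0.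
have SG f : smooth_on setT f -> smooth_on setT (escape s m \o f).
  move=> Sf; apply: (@smoothD _ _ (fun=> 1) (fun x => - (1 + (m * f x) ^+ 2) `^ (- s))).
    exact: smooth_cst.
  under eq_fun do rewrite -mulN1r; apply: smoothM; first exact: smooth_cst.
  apply: smooth_powR => //; apply: smoothD; first exact: smooth_cst.
  by apply: smoothM; apply: smoothM => //; exact: smooth_cst.
have DG t : is_derive t (1 : R) (escape s m) (descape s m t).
  have d1 : is_derive t (1 : R) (fun s : R => m * s) m.
    by apply: is_derive_eq (is_deriveZ m (is_derive_id t (1 : R))) _; rewrite [_ *: _]mulr1.
  have d2 : is_derive t (1 : R) (fun s : R => 1 + (m * s) ^+ 2) (2 * m * (m * t)).
    apply: is_derive_eq (is_deriveD (is_derive_cst (1 : R) t (1 : R)) (is_deriveX 2 d1)) _.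
    by rewrite add0r -![_ *: _]/(_ * _) expr1; ring.
  apply: is_derive_eq (is_deriveB (is_derive_cst (1 : R) t (1 : R))
    (@is_derive1_comp _ (fun y : R => y `^ (- s))
    (fun s : R => 1 + (m * s) ^+ 2) t _ _ (is_derive1_powR (- s) (Q0 t)) d2)) _.
  by rewrite /descape sub0r; ring.
split => //; first exact: smooth_bounded_cont SG DG.
exists (1 + s * (2 * m)) => [|t]; first by rewrite ltr_wpDr// !mulr_ge0// ltW.
have c0 : 0 <= s * (2 * m) by rewrite !mulr_ge0// ltW.
split.
  have /andP[h1 h2] := escape_ge0 m t s0; rewrite ger0_norm//.
  by apply: le_trans h2 _; rewrite lerDl.
apply: le_trans (descape_le t s0 m0) _; rewrite -[leLHS]add0r; apply: lerD => //.
rewrite mulrA -[leRHS]mulr1 ler_wpM2l// ler_pdivrMr// mul1r.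
rewrite -(real_normK (num_real (m * t))); move: `|m * t| => a.
by have := sqr_ge0 (a - 1); rewrite sqrrB1; have := sqr_ge0 a; lra.
Qed.

End truncations.

Section picone.
Context (R : realType).

(** Young's inequality; [lam = 1] is the sharp form, while a smaller [lam]
    leaves part of the last-but-one term to be absorbed. *)
Lemma young_scaled (p y b lam : R) : 1 < p -> 0 <= y -> 0 <= b -> 0 < lam ->
  p * (y `^ (p - 1) * b) <= (p - 1) * lam * y `^ p + lam `^ (1 - p) * b `^ p.
Proof.
move=> p1 y0 b0 l0; have p0 : 0 < p by exact: lt_trans p1.
have p10 : 0 < p - 1 by rewrite subr_gt0.
pose q := p / (p - 1); have q0 : 0 < q by rewrite divr_gt0.
have pq : q^-1 + p^-1 = 1 by rewrite /q; field; rewrite !gt_eqF.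
have := @conjugate_powR _ (lam `^ q^-1 * y `^ (p - 1)) (lam `^ (- q^-1) * b) q p
  _ _ q0 p0 pq.
rewrite !powRM ?powR_ge0// -!powRrM mulVf ?(gt_eqF q0)// (powRr1 (ltW l0)).
have -> : (p - 1) * q = p by rewrite /q; field; rewrite gt_eqF.
have -> : - q^-1 * p = 1 - p by rewrite /q; field; rewrite !gt_eqF.
have -> : lam `^ q^-1 * y `^ (p - 1) * (lam `^ (- q^-1) * b) = y `^ (p - 1) * b.
  rewrite mulrACA -powRD ?subrr ?powRr0 ?mul1r//.
  by rewrite (gt_eqF l0) implybT.
move=> /(_ _ _); rewrite mulr_ge0 ?powR_ge0// => /(_ isT).
rewrite mulr_ge0 ?powR_ge0// => /(_ isT) h.
have := ler_wpM2l (ltW p0) h; congr (_ <= _).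
by rewrite /q; field; rewrite !gt_eqF.
Qed.

End picone.

(** * Picone's inequality at a point *)

Section picone_pointwise.
Context (R : realType) (n : nat).
Local Notation E := 'rV[R]_n.+1.
Implicit Types (phi : E -> R) (Omega : set E).

(** A smooth approximation of |t| ^ p that vanishes at 0, so that composing
    with it preserves compact supports. *)
Definition smooth_pow (p d t : R) : R := (t ^+ 2 + d) `^ (p / 2) - d `^ (p / 2).

Lemma test_smooth_pow Omega p d phi : 0 < d -> test_function Omega phi ->
  test_function Omega (fun x => smooth_pow p d (phi x)).
Proof.
move=> d0 Tphi; have [Sphi _ _] := Tphi.
have Q0 x : 0 < phi x ^+ 2 + d by rewrite ltr_wpDl// sqr_ge0.
apply: (test_function_supp Tphi).
  apply: (@smoothD _ _ (fun x => (phi x ^+ 2 + d) `^ (p / 2)) (fun=> - d `^ (p / 2))).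
    apply: smooth_powR => //; apply: smoothD; first exact: smoothM.
    exact: smooth_cst.
  exact: smooth_cst.
move=> x; have [->|x0 _] := eqVneq (phi x) 0.
  by rewrite /smooth_pow expr0n/= add0r subrr eqxx.
exact: (@subset_closure _ [set y | phi y != 0]).
Qed.

Lemma grad_smooth_pow p d phi x : 0 < d -> smooth_on setT phi ->
  grad (fun x => smooth_pow p d (phi x)) x =
  (p * phi x * (phi x ^+ 2 + d) `^ (p / 2 - 1)) *: grad phi x.
Proof.
move=> d0 Sphi; apply/rowP => i; rewrite !mxE.
have Q0 : 0 < phi x ^+ 2 + d by rewrite ltr_wpDl// sqr_ge0.
have d2 : is_derive (phi x) (1 : R) (fun t : R => t ^+ 2 + d) (2 * phi x).
  apply: is_derive_eq (is_deriveD (is_deriveX 2 (is_derive_id (phi x) (1 : R)))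
    (is_derive_cst (d : R) (phi x) (1 : R))) _.
  by rewrite addr0 -![_ *: _]/(_ * _) expr1 mulr1.
have d3 : is_derive (phi x) (1 : R) (smooth_pow p d) (p * phi x * (phi x ^+ 2 + d) `^ (p / 2 - 1)).
  apply: is_derive_eq (is_deriveB (@is_derive1_comp _ (fun y : R => y `^ (p / 2))
    (fun t : R => t ^+ 2 + d) (phi x) _ _ (is_derive1_powR (p / 2) Q0) d2)
    (is_derive_cst (d `^ (p / 2) : R) (phi x) (1 : R))) _.
  by rewrite subr0; field.
by have [_ e] := is_derive_comp (smooth_is_derive i x Sphi) d3; apply: etrans e _.
Qed.

Lemma smooth_pow_ge p d t : 0 < p -> 0 < d ->
  `|t| `^ p - d `^ (p / 2) <= smooth_pow p d t.
Proof.
move=> p0 d0; rewrite lerD2r -[`|t|](_ : (t ^+ 2) `^ 2^-1 = _); last first.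
  by rewrite powR12_sqrt ?sqr_ge0// sqrtr_sqr.
rewrite -powRrM [2^-1 * p]mulrC; apply: ler_powRl.
- by rewrite divr_ge0// ltW.
- exact: sqr_ge0.
- by rewrite lerDl ltW.
Qed.

Lemma powRB2M (p a : R) : 1 < p -> 0 <= a -> a `^ (p - 2) * a = a `^ (p - 1).
Proof.
move=> p1 a0; have p10 : 0 < p - 1 by rewrite subr_gt0.
rewrite -(mulr_powRB1 a0 p10) mulrC; congr (_ * _ `^ _).
by rewrite -addrA -opprD.
Qed.

Lemma powRB2sqr (p a : R) : 1 < p -> 0 <= a -> a `^ (p - 2) * a ^+ 2 = a `^ p.
Proof.
move=> p1 a0; rewrite expr2 mulrA powRB2M// mulrC mulr_powRB1//.
exact: lt_trans p1.
Qed.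

(** The left-hand side is the flux |g| ^ (p - 2) g against the gradient of
    zeta h ^ (1 - p), where zeta approximates |phi| ^ p, s is the value of phi
    and h replaces the value of v. With Z = sqrt (s ^ 2 + d) and Y = |g| Z / h,
    the two terms of this gradient contribute at most p Y ^ (p - 1) |grad phi|,
    and - (p - 1) Y ^ p up to an error of order d ^ (p / 2) (here h' >= 1 is
    used). Young's inequality concludes. *)
Lemma picone_pointwise p m lam d t s h (g gphi : E) : 1 < p -> 1 <= m -> 0 < d ->
  0 < lam <= 1 -> 0 <= t -> h = profile (m * t) / m ->
  enorm g `^ (p - 2) * dot g (profile_pow p m t *:
     ((p * s * (s ^+ 2 + d) `^ (p / 2 - 1)) *: gphi) +
     (smooth_pow p d s * dprofile_pow p m t) *: g) <=
  lam `^ (1 - p) * enorm gphi `^ p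
  - (1 - lam) * (p - 1) * (enorm g * `|s| / h) `^ p
  + (p - 1) * m `^ p * 4 * d `^ (p / 2) * enorm g `^ p.
Proof.
move=> p1 m1 d0 /andP[l0 l1] t0 hE.
have p0 : 0 < p by exact: lt_trans p1.
have p10 : 0 < p - 1 by rewrite subr_gt0.
have m0 : 0 < m by exact: lt_le_trans m1.
have hm : m^-1 <= h by rewrite hE ler_pdivlMr// mulVf ?gt_eqF// profile_ge1.
have h0 : 0 < h by apply: lt_le_trans hm; rewrite invr_gt0.
set a := enorm g; set b := enorm gphi.
have a0 : 0 <= a by exact: enorm_ge0.
have b0 : 0 <= b by exact: enorm_ge0.
have Q0 : 0 < s ^+ 2 + d by rewrite ltr_wpDl// sqr_ge0.
set Z := (s ^+ 2 + d) `^ 2^-1.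
have Z0 : 0 < Z by rewrite powR_gt0.
have sZ : `|s| <= Z.
  by rewrite /Z (powR12_sqrt (ltW Q0)) -sqrtr_sqr ler_sqrt ?(ltW Q0)// lerDl (ltW d0).
have ZE q : (s ^+ 2 + d) `^ q = Z `^ (2 * q).
  by rewrite /Z -powRrM mulrA mulVf// mul1r.
have hV q : h `^ (- q) = h^-1 `^ q.
  by rewrite -(powR_inv1 (ltW h0)) -powRrM mulN1r.
have hV0 : 0 <= h^-1 by rewrite invr_ge0 ltW.
have Zh0 : 0 <= Z / h by rewrite mulr_ge0// ltW.
have gG : `|profile_pow p m t * (p * s * (s ^+ 2 + d) `^ (p / 2 - 1))| <=
    p * (Z / h) `^ (p - 1).
  rewrite /profile_pow -hE !normrM (gtr0_norm p0) !(ger0_norm (powR_ge0 _ _)).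
  rewrite ZE (_ : 2 * (p / 2 - 1) = p - 2); last by field.
  rewrite -opprB hV (powRM _ (ltW Z0) hV0).
  rewrite mulrC -!mulrA ler_pM2l// mulrA ler_wpM2r ?powR_ge0//.
  by rewrite -(powRB2M p1 (ltW Z0)) mulrC ler_wpM2l ?powR_ge0.
pose Y := a * (Z / h); have Y0 : 0 <= Y by rewrite mulr_ge0.
have yY : (a * `|s| / h) `^ p <= Y `^ p.
  apply: ler_powRl; [exact: ltW|by rewrite !mulr_ge0|].
  by rewrite /Y -mulrA ler_wpM2l// ler_wpM2r.
have first_term : a `^ (p - 2) * (profile_pow p m t * (p * s * (s ^+ 2 + d) `^ (p / 2 - 1)) * dot g gphi) <=
    p * (Y `^ (p - 1) * b).
  rewrite /Y (powRM _ a0 Zh0) -(powRB2M p1 a0).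
  rewrite [leRHS](_ : _ = a `^ (p - 2) * (p * (Z / h) `^ (p - 1) * (a * b))); last by ring.
  apply: ler_wpM2l; first exact: powR_ge0.
  apply: le_trans (ler_norm _) _; rewrite normrM.
  by apply: ler_pM; [exact: normr_ge0|exact: normr_ge0|exact: gG|exact: dot_le_enorm].
have dp1 := dprofile_ge1 (mulr_ge0 (ltW m0) t0).
have dp4 : dprofile (m * t) <= 4 by apply: le_trans (ler_norm _) (dprofile_le _).
have hp : h^-1 `^ p <= m `^ p.
  apply: ler_powRl => //; first exact: ltW.
  by rewrite -[leRHS]invrK lef_pV2 ?posrE// invr_gt0.
have second_term : a `^ (p - 2) * (smooth_pow p d s * dprofile_pow p m t * dot g g) <=
    - (p - 1) * Y `^ p + (p - 1) * m `^ p * 4 * d `^ (p / 2) * a `^ p.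
  have -> : a `^ (p - 2) * (smooth_pow p d s * dprofile_pow p m t * dot g g) =
      smooth_pow p d s * dprofile_pow p m t * a `^ p.
    by rewrite -enorm_sqr -/a -(powRB2sqr p1 a0) mulrCA.
  rewrite /dprofile_pow -hE hV /smooth_pow ZE (_ : 2 * (p / 2) = p); last by field.
  rewrite /Y (powRM _ a0 Zh0) (powRM _ (ltW Z0) hV0).
  move: (a `^ p) (powR_ge0 a p) (Z `^ p) (powR_ge0 Z p) (h^-1 `^ p) (powR_ge0 h^-1 p)
    (m `^ p) hp (d `^ (p / 2)) (powR_ge0 d (p / 2)) (dprofile (m * t)) dp1 dp4.
  move=> A A0 B B0 C C0 M CM D D0 k k1 k4.
  rewrite (_ : (B - D) * ((1 - p) * C * k) * A =
    - ((p - 1) * (A * (B * C)) * k) + (p - 1) * (D * A) * (C * k)); last by ring.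
  apply: lerD.
    rewrite mulNr lerN2 ler_peMr//; apply: mulr_ge0; first exact: ltW.
    by rewrite !mulr_ge0.
  rewrite (_ : (p - 1) * M * 4 * D * A = (p - 1) * (D * A) * (M * 4)); last by ring.
  apply: ler_wpM2l; first by rewrite !mulr_ge0// ltW.
  by apply: ler_pM => //; lra.
have young := young_scaled p1 Y0 b0 l0.
rewrite dotDr !dotZr mulrDr mulrA.
have := lerD first_term second_term.
have c0 : 0 <= (1 - lam) * (p - 1) by rewrite mulr_ge0 ?subr_ge0// ltW.
have := ler_wpM2l c0 yY.
move: young.
move: (Y `^ p) ((a * `|s| / h) `^ p) (Y `^ (p - 1) * b) (lam `^ (1 - p) * b `^ p)
  (_ * a `^ p) => yp sp yb lb err; rewrite !mulrA.
move: (a `^ (p - 2) * _) (a `^ (p - 2) * _) => u1 u2; lra.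
Qed.

End picone_pointwise.

(** * Picone's inequality for a nonnegative solution *)

Section weighted_picone.
Context (R : realType) (n : nat).
Local Notation E := 'rV[R]_n.+1.
Local Notation X := (caratheodory_type (@leb_outer R n)).
Local Notation mu := (@leb R n).
Variables (Omega : set E) (p : R) (w : E -> R).
Hypotheses (oO : open Omega) (bO : bounded_set Omega) (p1 : 1 < p).
Hypothesis Aw : class_A Omega p w.
Implicit Types (u v f phi psi xi zeta : E -> R) (g h : E -> E).
Local Notation O := (Omega : set X).
Local Notation integrable f := (mu.-integrable O (EFin \o (f : X -> R))).
Local Notation mfun f := (measurable_fun O (f : X -> R)).

Let p0 : 0 < p. Proof. exact: lt_trans p1. Qed.
Let mO : measurable O. Proof. exact: measurable_open. Qed.
Let mw : mfun w. Proof. by have [[]] := Aw. Qed.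
Let w_gt0 : {ae mu, forall x : X, Omega x -> 0 < w x}. Proof. by have [[]] := Aw. Qed.

Lemma W1p0_mfun v g : W1p0 Omega p w v g ->
  mfun v /\ forall i, mfun (fun x => g x 0 i).
Proof. by move=> [[wg _] _]; exact: weak_gradient_measurable wg. Qed.

Lemma measurable_dot g h : (forall i, mfun (fun x => g x 0 i)) ->
  (forall i, mfun (fun x => h x 0 i)) -> mfun (fun x => dot (g x) (h x)).
Proof. by move=> mg mh; apply: measurable_sum => i; exact: measurable_funM. Qed.

Lemma flux_integrable v g phi h : W1p0 Omega p w v g -> W1p0 Omega p w phi h ->
  integrable (fun x => w x * (enorm (g x) `^ (p - 2) * dot (g x) (h x))).
Proof.
move=> Wv Wphi; have [_ mg] := W1p0_mfun Wv; have [_ mh] := W1p0_mfun Wphi.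
have [_ _ ig] := (W1pP oO p1 Aw v g).1 Wv.1.
have [_ _ ih] := (W1pP oO p1 Aw phi h).1 Wphi.1.
have mf := measurable_funM mw (measurable_funM
  (measurable_powR_comp (p - 2) (measurable_enorm mg)) (measurable_dot mg mh)).
apply: (ae_le_integrable mO mf (integrableRD mO ig ih)).
apply: filterS w_gt0 => x + Ox => /(_ Ox) wx /=.
have a0 := enorm_ge0 (g x); have b0 := enorm_ge0 (h x).
rewrite normrM (gtr0_norm wx) -mulrDr ler_pM2l// normrM (ger0_norm (powR_ge0 _ _)).
apply: (@le_trans _ _ (enorm (g x) `^ (p - 1) * enorm (h x))).
  rewrite -(powRB2M p1 a0) -mulrA; apply: ler_wpM2l; first exact: powR_ge0.
  exact: dot_le_enorm.
have [ab|/ltW ba] := leP (enorm (g x)) (enorm (h x)).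
  apply: (@le_trans _ _ (enorm (h x) `^ p)); last by rewrite lerDr powR_ge0.
  rewrite -(mulr_powRB1 b0 p0) mulrC; apply: ler_wpM2l => //.
  by apply: ler_powRl => //; rewrite subr_ge0 ltW.
apply: (@le_trans _ _ (enorm (g x) `^ p)); last by rewrite lerDl powR_ge0.
by rewrite -(mulr_powRB1 a0 p0) mulrC; apply: ler_wpM2r => //; exact: powR_ge0.
Qed.

(** The reaction term is integrable because its integral equals that of the
    flux term, which is finite. *)
Lemma weak_solution_Rintegral f v g phi h : W1p0 Omega p w v g -> L1 Omega f ->
  (forall phi h, W1p0 Omega p w phi h ->
    (\int[mu]_(x in O) (w x * (enorm (g x) `^ (p - 2) * dot (g x) (h x)))%:E =
     \int[mu]_(x in O) (f x * (`|v x| `^ (p - 2) * v x) * phi x)%:E)%E) ->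
  W1p0 Omega p w phi h ->
  integrable (fun x => f x * (`|v x| `^ (p - 2) * v x) * phi x) /\
  \int[mu]_(x in O) (w x * (enorm (g x) `^ (p - 2) * dot (g x) (h x))) =
  \int[mu]_(x in O) (f x * (`|v x| `^ (p - 2) * v x) * phi x).
Proof.
move=> Wv Lf eqv Wphi; have [mv _] := W1p0_mfun Wv; have [mphi _] := W1p0_mfun Wphi.
have mf := integrable_measurable Lf.
have mr := measurable_funM (measurable_funM mf (measurable_funM
  (measurable_powR_comp (p - 2) (measurable_norm mv)) mv)) mphi.
have e := eqv _ _ Wphi; split; last by rewrite /Rintegral e.
apply/integrableP; split; first exact: measurable_EFin_comp mr.
rewrite (integral_fin_num_abs mu mO mr) -e.
exact: (integrable_fin_num mO (flux_integrable Wv Wphi)).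
Qed.

(** The equation is tested with zeta h ^ (1 - p) for zeta = smooth_pow p d phi,
    and [picone_pointwise] is integrated; then d tends to 0. For [lam = 1]
    this is Picone's inequality for the energy of phi, and for [lam < 1] it
    bounds in addition the energy of the logarithm of v, as in Caccioppoli's
    estimate. *)
Lemma weighted_picone f v g phi m lam : W1p0 Omega p w v g -> L1 Omega f ->
  (forall phi h, W1p0 Omega p w phi h ->
    (\int[mu]_(x in O) (w x * (enorm (g x) `^ (p - 2) * dot (g x) (h x)))%:E =
     \int[mu]_(x in O) (f x * (`|v x| `^ (p - 2) * v x) * phi x)%:E)%E) ->
  ae_in Omega (fun x => 0 <= f x) -> ae_in Omega (fun x => 0 <= v x) ->
  test_function Omega phi -> 1 <= m -> 0 < lam <= 1 ->
  let h x := profile (m * v x) / m in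
  [/\ integrable (fun x => f x * (v x / h x) `^ (p - 1) * `|phi x| `^ p),
      integrable (fun x => w x * (enorm (g x) * `|phi x| / h x) `^ p) &
   \int[mu]_(x in O) (f x * (v x / h x) `^ (p - 1) * `|phi x| `^ p)
   + (1 - lam) * (p - 1) * \int[mu]_(x in O) (w x * (enorm (g x) * `|phi x| / h x) `^ p)
   <= lam `^ (1 - p) * \int[mu]_(x in O) (w x * enorm (grad phi x) `^ p)].
Proof.
move=> Wv Lf eqv f0' v0' Tphi m1 lam01 h.
have f0 : {ae mu, forall x : X, Omega x -> 0 <= f x} := f0'.
have v0 : {ae mu, forall x : X, Omega x -> 0 <= v x} := v0'.
have m0 : 0 < m by exact: lt_le_trans m1.
have h0 x : 0 < h x by rewrite divr_gt0// (lt_le_trans ltr01)// profile_ge1.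
have [mv mg] := W1p0_mfun Wv.
have mf := integrable_measurable Lf.
have mphi := test_function_measurable (D := O) Tphi.
have [Sphi _ _] := Tphi.
have [C C0 phiC] := test_function_bounded Tphi.
have [_ _ ig] := (W1pP oO p1 Aw v g).1 Wv.1.
have ib := weight_grad_integrable oO p1 Aw Tphi.
have ch : continuous (fun t : R => profile (m * t) / m).
  move=> t; apply: cvgM; last exact: cvg_cst.
  have cp : continuous (@profile R).
    move=> s; apply/differentiable_continuous/derivable1_diffP.
    by have [] := is_derive_profile s.
  by apply: (@continuous_comp _ _ _ ( *%R m)); [exact: mulrl_continuous|exact: cp].
have mh : mfun h by exact: (measurable_comp_continuous ch mv).
have mhV : mfun (fun x => (h x)^-1).
  under eq_fun do rewrite -(powR_inv1 (ltW (h0 _))).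
  exact: measurable_powR_comp.
have mphip : mfun (fun x => `|phi x| `^ p) by exact: (measurable_powR_comp p (measurable_norm mphi)).
have mA : mfun (fun x => f x * (v x / h x) `^ (p - 1) * `|phi x| `^ p).
  apply: measurable_funM mphip; apply: (measurable_funM mf).
  exact: (measurable_powR_comp (p - 1) (measurable_funM mv mhV)).
have mB : mfun (fun x => w x * (enorm (g x) * `|phi x| / h x) `^ p).
  apply: (measurable_funM mw); apply: measurable_powR_comp.
  by apply: measurable_funM mhV; apply: measurable_funM (measurable_norm mphi); exact: measurable_enorm.
have q1 x : 0 <= v x -> 0 <= (v x / h x) `^ (p - 1) <= 1.
  move=> vx; rewrite powR_ge0/=.
  have vh : v x / h x <= 1.
    rewrite ler_pdivrMr// mul1r /h ler_pdivlMr// mulrC.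
    by apply: profile_ge; rewrite mulr_ge0// ltW.
  have := ler_powRl (p := p - 1) _ _ vh; rewrite powR1; apply.
    by rewrite subr_ge0 ltW.
  by rewrite divr_ge0// ltW.
have phip x : `|phi x| `^ p <= C `^ p by apply: ler_powRl => //; exact: ltW.
have iA : integrable (fun x => f x * (v x / h x) `^ (p - 1) * `|phi x| `^ p).
  apply: (ae_le_integrable mO mA (integrableRZ mO (C `^ p) (integrableR_norm Lf))).
  apply: filterS v0 => x + Ox => /(_ Ox) /q1/andP[q0 q1x] /=.
  rewrite mulrC normrM (ger0_norm (powR_ge0 _ _)); apply: ler_pM => //.
  by rewrite normrM (ger0_norm q0) ler_piMr.
have hm x : (h x)^-1 <= m.
  rewrite -[leRHS]invrK lef_pV2 ?posrE ?invr_gt0//.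
  by rewrite /h ler_pdivlMr// mulVf ?gt_eqF// profile_ge1.
have iB : integrable (fun x => w x * (enorm (g x) * `|phi x| / h x) `^ p).
  apply: (ae_le_integrable mO mB (integrableRZ mO ((C * m) `^ p) (integrableR_norm ig))).
  apply: filterS w_gt0 => x + Ox => /(_ Ox) wx /=.
  rewrite !normrM (gtr0_norm wx) !(ger0_norm (powR_ge0 _ _)) mulrCA ler_pM2l//.
  have Cm0 : 0 <= C * m by rewrite mulr_ge0// ltW.
  rewrite -(powRM _ Cm0 (enorm_ge0 _)); apply: ler_powRl; first exact: ltW.
    by rewrite !mulr_ge0 ?enorm_ge0 ?invr_ge0// ltW.
  rewrite -mulrA [leRHS]mulrC; apply: ler_wpM2l; first exact: enorm_ge0.
  by apply: ler_pM => //; rewrite invr_ge0 ltW.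
split => //.
set IA := Rintegral _ _ _; set IB := Rintegral _ _ _; set Ib := Rintegral _ _ _.
pose If := \int[mu]_(x in O) f x; pose Ia := \int[mu]_(x in O) (w x * enorm (g x) `^ p).
pose K := (p - 1) * m `^ p * 4.
have key d : 0 < d -> IA - d `^ (p / 2) * If <=
    lam `^ (1 - p) * Ib - (1 - lam) * (p - 1) * IB + K * d `^ (p / 2) * Ia.
  move=> d0; set zeta := fun x => smooth_pow p d (phi x).
  have Tz : test_function Omega zeta by exact: test_smooth_pow.
  have GG := smooth_bounded_profile n p1 m1.
  have Wz := W1p0_chain oO bO p1 Aw Wv GG Tz.
  have [iR LR] := weak_solution_Rintegral Wv Lf eqv Wz.
  have iL := flux_integrable Wv Wz.
  have iA' := integrableRB mO iA (integrableRZ mO (d `^ (p / 2)) Lf).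
  have iU := integrableRD mO (integrableRB mO (integrableRZ mO (lam `^ (1 - p)) ib)
    (integrableRZ mO ((1 - lam) * (p - 1)) iB)) (integrableRZ mO (K * d `^ (p / 2)) ig).
  apply: (@le_trans _ _ (\int[mu]_(x in O) (f x * (v x / h x) `^ (p - 1) * `|phi x| `^ p
      - d `^ (p / 2) * f x))).
    by rewrite (RintegralB mO iA (integrableRZ mO (d `^ (p / 2)) Lf)) (RintegralZl _ mO Lf).
  apply: le_trans (ae_le_Rintegral mO iA' iR _) _.
    apply: filterS2 f0 v0 => x fx vx Ox; have {}fx := fx Ox; have {}vx := vx Ox.
    have /andP[q0 q1x] := q1 x vx.
    have -> : f x * (`|v x| `^ (p - 2) * v x) * (zeta x * profile_pow p m (v x)) =
        f x * ((v x / h x) `^ (p - 1) * zeta x).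
      rewrite (ger0_norm vx) (powRB2M p1 vx) /profile_pow -/(h x) -(opprB p 1).
      have hV0 : 0 <= (h x)^-1 by rewrite invr_ge0 ltW.
      rewrite (powRM _ vx hV0) -(powR_inv1 (ltW (h0 x))) -powRrM mulN1r.
      by ring.
    rewrite -mulrA [_ * f x]mulrC -mulrBr; apply: ler_wpM2l => //.
    apply: le_trans (ler_wpM2l q0 (smooth_pow_ge (phi x) p0 d0)).
    by rewrite mulrBr lerD2l lerN2 ler_piMl// powR_ge0.
  rewrite -LR.
  apply: le_trans (ae_le_Rintegral mO iL iU _) _.
    apply: filterS2 w_gt0 v0 => x wx vx Ox; have {}wx := wx Ox; have {}vx := vx Ox.
    have := picone_pointwise (phi x) (g x) (grad phi x) p1 m1 d0 lam01 vx (erefl (h x)).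
    rewrite -(grad_smooth_pow p x d0 Sphi) => /(ler_wpM2l (ltW wx)).
    move=> /le_trans; apply; rewrite le_eqVlt; apply/orP; left; apply/eqP.
    by rewrite /K; ring.
  rewrite (RintegralD mO (integrableRB mO (integrableRZ mO (lam `^ (1 - p)) ib)
    (integrableRZ mO ((1 - lam) * (p - 1)) iB)) (integrableRZ mO (K * d `^ (p / 2)) ig)).
  rewrite (RintegralB mO (integrableRZ mO (lam `^ (1 - p)) ib)
    (integrableRZ mO ((1 - lam) * (p - 1)) iB)).
  by rewrite (RintegralZl _ mO ib) (RintegralZl _ mO iB) (RintegralZl _ mO ig).
move: key; move: (lam `^ (1 - p) * Ib) ((1 - lam) * (p - 1) * IB) => X1 X2 key.
rewrite -lerBrDr; apply/ler_addgt0Pr => e e0.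
pose c := `|If| + `|K * Ia| + 1.
have c0 : 0 < c by rewrite ltr_wpDl// addr_ge0.
(* with d ^ (p / 2) = e / c, the two error terms add up to at most e *)
have := key ((e / c) `^ (2 / p)) (powR_gt0 _ (divr_gt0 e0 c0)).
rewrite -powRrM (_ : 2 / p * (p / 2) = 1); last by field; rewrite gt_eqF.
rewrite powRr1; last by rewrite ltW// divr_gt0.
set z := e / c; have z0 : 0 < z by rewrite divr_gt0.
have zc : z * c = e by rewrite /z divfK// gt_eqF.
have h1 := ler_wpM2l (ltW z0) (ler_norm If).
have h2 := ler_wpM2l (ltW z0) (ler_norm (K * Ia)).
rewrite -zc (_ : K * z * Ia = z * (K * Ia)); last by ring.
rewrite /c !mulrDr mulr1.
move: (z * If) (z * `|If|) (z * (K * Ia)) (z * `|K * Ia|) h1 h2 => y1 y2 y3 y4 h1 h2.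
by move: z0; lra.
Qed.

End weighted_picone.

(** * The set where a solution does not vanish *)

Section nonzero_set.
Context (R : realType) (n : nat).
Local Notation E := 'rV[R]_n.+1.
Local Notation X := (caratheodory_type (@leb_outer R n)).
Local Notation mu := (@leb R n).

Lemma escape_cvg (s t : R) : 0 < s ->
  (fun k : nat => escape s k.+1%:R t) @ \oo --> ((t != 0)%:R : R).
Proof.
move=> s0; have [->|t0] := eqVneq t 0.
  rewrite (_ : (fun k => _) = fun=> 0); first exact: cvg_cst.
  apply/funext => k; rewrite /escape mulr0 expr0n/= addr0.
  by rewrite powRN powR1 invr1 subrr.
rewrite -[X in _ --> X]subr0; apply: cvgB; first exact: cvg_cst.
have Q0 (k : nat) : 0 < 1 + (k.+1%:R * t) ^+ 2 :> R by rewrite ltr_wpDr// sqr_ge0.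
have e k : (1 + (k.+1%:R * t) ^+ 2) `^ (- s) = ((1 + (k.+1%:R * t) ^+ 2)^-1) `^ s.
  by rewrite -(powR_inv1 (ltW (Q0 k))) -powRrM mulN1r.
under eq_fun do rewrite e; apply: (cvg0_powR s0) => [k|].
  by rewrite invr_ge0 ltW.
apply: (@harmonic_cvg0 _ _ (t ^- 2)) => k; first by rewrite invr_ge0 ltW.
have t2 : 0 < t ^+ 2 by rewrite exprn_even_gt0.
rewrite ler_pdivrMr// mulrC ler_pdivlMr// exprMn.
have : 1 <= k.+1%:R :> R by rewrite ler1n.
move: (k.+1%:R : R) (t ^+ 2) t2 => a b b0 a1.
have : 0 <= a * b * (a - 1) by rewrite !mulr_ge0 ?subr_ge0// ?(ltW b0)// (le_trans ler01).
by rewrite expr2; lra.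
Qed.

Variables (Omega : set E) (p : R) (w : E -> R).
Hypotheses (oO : open Omega) (bO : bounded_set Omega) (p1 : 1 < p).
Hypothesis Aw : class_A Omega p w.
Implicit Types (u v f phi psi xi zeta : E -> R) (g h : E -> E).
Local Notation O := (Omega : set X).
Local Notation integrable f := (mu.-integrable O (EFin \o (f : X -> R))).
Local Notation mfun f := (measurable_fun O (f : X -> R)).

Let mO : measurable O. Proof. exact: measurable_open. Qed.
Let w_gt0 : {ae mu, forall x : X, Omega x -> 0 < w x}. Proof. by have [[]] := Aw. Qed.

(** The derivative of [escape] decays at least like 1 / (m t), so the
    Caccioppoli bound of [weighted_picone] controls it uniformly in [m]. *)
Lemma descape_profile (s m t : R) : 0 < s -> 0 < m -> 0 <= t ->
  `|descape s m t| <= s * (6 / (profile (m * t) / m)).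
Proof.
move=> s0 m0 t0; apply: le_trans (descape_le t s0 m0) _.
rewrite ler_pM2l// ger0_norm ?mulr_ge0 ?(ltW m0)//.
have mt : 0 <= m * t by rewrite mulr_ge0// ltW.
have P0 := lt_le_trans ltr01 (profile_ge1 (m * t)).
have Q0 : 0 < 1 + (m * t) ^+ 2 by rewrite ltr_wpDr// sqr_ge0.
have -> : 6 / (profile (m * t) / m) = 2 * m * (3 / profile (m * t)).
  by field; rewrite !gt_eqF.
apply: ler_wpM2l; first by rewrite mulr_ge0// ltW.
rewrite ler_pdivrMr// mulrAC ler_pdivlMr//.
have := profile_le mt; have := sqr_ge0 (m * t - 1).
by move: (m * t) mt (profile (m * t)) P0 => y y0 P P0; nra.
Qed.

(** The indicator of v != 0 is the limit of escape s m (v) as m tends to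
    infinity. By the chain rule its derivative is tested by the integral of
    escape' (v) g xi, which the case [lam = 1 / 2] of [weighted_picone] bounds
    by s times a constant independent of [m]. As s > 0 is arbitrary, the weak
    derivative is 0. *)
Lemma nonzero_set_derivative f v g phi xi i : W1p0 Omega p w v g -> L1 Omega f ->
  (forall phi h, W1p0 Omega p w phi h ->
    (\int[mu]_(x in O) (w x * (enorm (g x) `^ (p - 2) * dot (g x) (h x)))%:E =
     \int[mu]_(x in O) (f x * (`|v x| `^ (p - 2) * v x) * phi x)%:E)%E) ->
  ae_in Omega (fun x => 0 <= f x) -> ae_in Omega (fun x => 0 <= v x) ->
  test_function Omega phi -> test_function Omega xi ->
  (forall x, xi x != 0 -> 1 <= `|phi x|) ->
  \int[mu]_(x in O) ((v x != 0)%:R * partial i xi x) = 0.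
Proof.
move=> Wv Lf eqv f0' v0' Tphi Txi xiphi.
have f0 : {ae mu, forall x : X, Omega x -> 0 <= f x} := f0'.
have v0 : {ae mu, forall x : X, Omega x -> 0 <= v x} := v0'.
have [mv mg] := W1p0_mfun Wv.
have Tdxi := test_function_partial i Txi.
have idxi := test_function_integrable Tdxi mO.
have mdxi := test_function_measurable (D := O) Tdxi.
have [C C0 xiC] := test_function_bounded Txi.
have ixiw : integrable (fun x => xi x * w x `^ (- (p - 1)^-1)).
  by apply: (test_weight_integrable oO Txi); have [] := Aw.
pose J := \int[mu]_(x in O) `|xi x * w x `^ (- (p - 1)^-1)|.
pose Ib := \int[mu]_(x in O) (w x * enorm (grad phi x) `^ p).
have p10 : 0 < p - 1 by rewrite subr_gt0.
pose B0 := 2^-1 `^ (1 - p) * Ib / (2^-1 * (p - 1)).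
have bound s m : 0 < s -> 1 <= m ->
    `|\int[mu]_(x in O) (escape s m (v x) * partial i xi x)| <= s * (6 * (C * B0 + J)).
  move=> s0 m1; have m0 : 0 < m by exact: lt_le_trans m1.
  have [iG [iG' ->]] := chain_rule_weak oO p1 Aw i Wv (smooth_bounded_escape n s0 m0) Txi.
  rewrite normrN; apply: le_trans (le_normr_Rintegral mO iG') _.
  (* any lam < 1 keeps a positive multiple of the energy of log v on the left *)
  have l01 : 0 < (2^-1 : R) <= 1 by rewrite invr_gt0 ltr0n/= invf_le1// ler1n.
  have [iA iB AB] := weighted_picone oO bO p1 Aw Wv Lf eqv f0 v0 Tphi m1 l01.
  have iD := integrableRZ mO (s * 6) (integrableRD mO (integrableRZ mO C iB) (integrableR_norm ixiw)).
  apply: le_trans (ae_le_Rintegral mO (integrableR_norm iG') iD _) _.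
    apply: filterS2 w_gt0 v0 => x wx vx Ox; have {}wx := wx Ox; have {}vx := vx Ox.
    have [->|x0] := eqVneq (xi x) 0.
      rewrite !mulr0 mul0r normr0 addr0 !mulr_ge0 ?powR_ge0// ltW//.
    have phi1 := xiphi x x0.
    have P0 : 0 < profile (m * v x) / m.
      by rewrite divr_gt0// (lt_le_trans ltr01 (profile_ge1 _)).
    have a0 := enorm_ge0 (g x).
    set y := enorm (g x) * `|phi x| / (profile (m * v x) / m).
    have y0 : 0 <= y by rewrite !mulr_ge0// invr_ge0 ltW.
    have yy := young_weight p1 wx y0.
    rewrite (normrM (_ * g x 0 i)) (normrM (descape _ _ _)) (normrM (xi x)) (ger0_norm (powR_ge0 (w x) _)).
    have h1 := descape_profile s0 m0 vx.
    have h2 := coord_le_enorm (g x) i.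
    have h3 : `|descape s m (v x)| * `|g x 0 i| <= s * 6 * y.
      apply: le_trans (ler_pM (normr_ge0 _) (normr_ge0 _) h1 h2) _.
      rewrite -!mulrA ler_pM2l// ler_pM2l// /y mulrC -mulrA; apply: ler_wpM2l => //.
      by rewrite ler_peMl// invr_ge0 ltW.
    apply: (@le_trans _ _ (s * 6 * y * `|xi x|)); first exact: (ler_wpM2r (normr_ge0 _) h3).
    rewrite -mulrA ler_pM2l ?mulr_gt0// mulrC.
    apply: le_trans (ler_wpM2l (normr_ge0 (xi x)) yy) _; rewrite mulrDr lerD2r.
    by rewrite ler_wpM2r// mulr_ge0 ?powR_ge0// ltW.
  rewrite (RintegralZl _ mO (integrableRD mO (integrableRZ mO C iB) (integrableR_norm ixiw))).
  rewrite (RintegralD mO (integrableRZ mO C iB) (integrableR_norm ixiw)) (RintegralZl _ mO iB).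
  rewrite -/J -mulrA; apply: ler_wpM2l; first exact: ltW.
  apply: ler_wpM2l => //.
  rewrite lerD2r ler_pM2l// /B0 ler_pdivlMr; last by rewrite mulr_gt0// invr_gt0.
  rewrite mulrC; apply: le_trans AB; rewrite -/Ib (_ : 1 - 2^-1 = 2^-1); last by field.
  rewrite lerDr; apply: (ae_Rintegral_ge0 mO iA).
  by apply: filterS f0 => x + Ox => /(_ Ox) fx; rewrite !mulr_ge0 ?powR_ge0.
have mchi : mfun (fun x => (v x != 0)%:R).
  have mH : measurable_fun [set: R] (fun t : R => (t != 0)%:R : R).
    rewrite (_ : (fun t : R => _) = \1_(~` [set 0])).
      by apply: measurable_indic; apply: measurableC; exact: measurable_set1.
    apply/funext => t; rewrite indicE in_setC; congr ((nat_of_bool (~~ _))%:R).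
    by apply/eqP/idP; rewrite inE.
  exact: (measurableT_comp mH mv).
have cvgs s : 0 < s -> (fun k : nat => \int[mu]_(x in O) (escape s k.+1%:R (v x) * partial i xi x)) @ \oo -->
    \int[mu]_(x in O) ((v x != 0)%:R * partial i xi x).
  move=> s0; have mFs (k : nat) : mfun (fun x => escape s k.+1%:R (v x) * partial i xi x).
    have GG := smooth_bounded_escape n s0 (ltr0Sn R k).
    exact: measurable_funM (measurable_comp_continuous (smooth_bounded_continuous GG) mv) mdxi.
  have [] := dominated_Rintegral mO mFs (measurable_funM mchi mdxi) (integrableR_norm idxi) _ _ => //.
  - apply: aeW => x _; apply: cvgM; last exact: cvg_cst.
    exact: escape_cvg.
  - apply: aeW => x k _; have /andP[e0 e1] := escape_ge0 k.+1%:R (v x) s0.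
    by rewrite normrM (ger0_norm e0) ler_piMl.
set I := Rintegral _ _ _ in cvgs *.
set B := 6 * (C * B0 + J) in bound.
have Ib' s : 0 < s -> `|I| <= s * B.
  move=> s0; have /cvg_norm cv := cvgs s s0.
  rewrite -(cvg_lim _ cv)//; apply: limr_le; first by apply/cvg_ex; exists `|I|.
  by apply: nearW => k; apply: bound => //; rewrite ler1n.
apply/eqP; rewrite -normr_le0; apply/ler_addgt0Pr => e e0; rewrite add0r.
have B1 : 0 < `|B| + 1 by rewrite ltr_wpDl.
apply: le_trans (Ib' (e / (`|B| + 1)) (divr_gt0 e0 B1)) _.
rewrite mulrAC ler_pdivrMr// ler_pM2l//; apply: le_trans (ler_norm _) _.
by rewrite lerDl.
Qed.

End nonzero_set.

(** * Translation invariance of a set with vanishing weak derivative *)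

Section translation.
Context (R : realType) (n : nat).
Local Notation E := 'rV[R]_n.+1.
Local Notation X := (caratheodory_type (@leb_outer R n)).
Local Notation mu := (@leb R n).
Implicit Types (a b x : E) (xi : E -> R) (i : 'I_n.+1).

Lemma cvg_prod_seq (I : Type) (s : seq I) (F : I -> nat -> R) (L : I -> R) :
  (forall j, F j @ \oo --> L j) ->
  (fun k => \prod_(i <- s) F i k) @ \oo --> \prod_(i <- s) L i.
Proof.
move=> FL; elim: s => [|i s IH].
  by under eq_fun do rewrite big_nil; rewrite big_nil; exact: cvg_cst.
by under eq_fun do rewrite big_cons; rewrite big_cons; apply: cvgM.
Qed.

Lemma flat_cvg1 (y : nat -> R) (c : R) : 0 < c -> (forall k, k.+1%:R * c <= y k) ->
  (fun k => flat (y k)) @ \oo --> (1 : R).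
Proof.
move=> c0 cy.
have y0 k : 0 < y k by apply: lt_le_trans (cy k); rewrite mulr_gt0.
have h : (fun k => (y k)^-1) @ \oo --> 0.
  apply: (@harmonic_cvg0 _ _ c^-1) => k; first by rewrite invr_ge0 ltW.
  by rewrite ler_pdivrMr// mulrC ler_pdivlMr.
apply: (@squeeze_cvgr _ _ _ _ (fun k => 1 - (y k)^-1) (fun=> 1)).
- apply: nearW => k; rewrite flat_le1 andbT /flat y0.
  by apply: le_trans (expR_ge1Dx _).
- by rewrite -[X in _ --> X]subr0; apply: cvgB => //; exact: cvg_cst.
- exact: cvg_cst.
Qed.

(** The upper face is moved outwards by 1 / (k + 1), so that its points keep
    the value 1 in the limit; the steeper slope (k + 1) ^ 2 makes up for the
    shrinking gap. *)
Definition box_bump a b (k : nat) : E -> R :=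
  bump_fun k.+1%:R (k.+1%:R ^+ 2) a (b + const_mx k.+1%:R^-1).

Lemma box_bump_cvg a b x : (fun k => box_bump a b k x) @ \oo --> (\1_(box (a, b)) x : R).
Proof.
have -> : \1_(box (a, b)) x = \prod_i ((a 0 i < x 0 i <= b 0 i)%R%:R : R).
  rewrite indicE; have [xB|xB] := boolP (x \in box (a, b)).
    by rewrite big1// => i _; move: xB; rewrite inE => /(_ i)/= ->.
  have [i] : exists i, ~~ (a 0 i < x 0 i <= b 0 i).
    apply/existsP; apply: contraNT xB => /existsPn xB; rewrite inE => i /=.
    by have := xB i; rewrite negbK.
  by move=> /negbTE xi; rewrite (bigD1 i)//= xi mul0r.
apply: cvg_prod_seq => i /=.
under eq_fun do rewrite !mxE.
have kE (k : nat) : k.+1%:R ^+ 2 * (b 0 i + k.+1%:R^-1 - x 0 i) =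
    k.+1%:R * (k.+1%:R * (b 0 i - x 0 i) + 1) :> R.
  by field.
have k0 (k : nat) : 0 < k.+1%:R :> R by [].
have k1 (k : nat) : 1 <= k.+1%:R :> R by rewrite ler1n.
have [ax|xa] := ltP (a 0 i) (x 0 i); last first.
  rewrite (_ : (fun k => _) = fun=> 0); first exact: cvg_cst.
  apply/funext => k; rewrite {1}/flat ifF ?mul0r//; apply/negbTE.
  by rewrite -leNgt pmulr_rle0// subr_le0.
have ca : (fun k : nat => flat (k.+1%:R * (x 0 i - a 0 i))) @ \oo --> (1 : R).
  by apply: (@flat_cvg1 _ (x 0 i - a 0 i)); rewrite ?subr_gt0.
have [xb|bx] := leP (x 0 i) (b 0 i); rewrite ?andbT ?andbF.
  rewrite -[_%:R](mulr1 (1 : R)); apply: cvgM => //.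
  apply: (@flat_cvg1 _ 1) => // k; rewrite kE ler_pM2l// lerDr.
  by rewrite mulr_ge0// subr_ge0.
rewrite -[_%:R](mul1r (0 : R)); apply: cvgM => //.
pose N := Num.truncn ((x 0 i - b 0 i)^-1).
have xb : 0 < x 0 i - b 0 i by rewrite subr_gt0.
apply: cvg_near_cst; exists N => // k /= Nk.
apply/eqP; rewrite /flat ifF//; apply/negbTE; rewrite -leNgt kE pmulr_rle0//.
rewrite -(opprB (x 0 i)) mulrN addrC subr_le0 -ler_pdivrMr// mul1r.
apply: le_trans (ltW (truncnS_gt _)) _.
by rewrite ler_nat ltnS.
Qed.

Lemma partial_shift xi i (c x : E) :
  partial i (fun y => xi (y + c)) x = partial i xi (x + c).
Proof.
have e : (fun h : R => h^-1 *: (((fun y => xi (y + c)) \o shift x) (h *: delta_mx 0 i)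
    - xi (x + c)) : R^o) =
    (fun h : R => h^-1 *: ((xi \o shift (x + c)) (h *: delta_mx 0 i) - xi (x + c))).
  by apply/funext => h /=; rewrite addrA.
by rewrite /partial /derive e.
Qed.

Variables (A : set E) (U : set E).
Hypotheses (mA : measurable (A : set X)) (A_fin : (mu A < +oo)%E).
Hypothesis dA : forall xi i, test_function U xi -> \int[mu]_(x in (A : set X)) partial i xi x = 0.

(** Each of N small translations by t / N changes the integral by
    O((t / N) ^ 2), since the first-order term is the integral over [A] of a
    derivative; the sum of these changes is O(1 / N). *)
Lemma Rintegral_translate xi i (t : R) : 0 <= t ->
  (forall s, 0 <= s <= t -> test_function U (fun x => xi (x + s *: delta_mx 0 i))) ->
  \int[mu]_(x in (A : set X)) xi (x + t *: delta_mx 0 i) =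
  \int[mu]_(x in (A : set X)) xi x.
Proof.
move=> t0 Txi; set e := delta_mx 0 i in Txi *.
pose y (s : R) := \int[mu]_(x in (A : set X)) xi (x + s *: e).
have x0 : xi = (fun x => xi (x + 0 *: e)).
  by apply/funext => x; rewrite scale0r addr0.
suff : y t = y 0 by rewrite /y => ->; rewrite -x0.
have T0 : test_function U xi by rewrite x0; apply: Txi; rewrite lexx.
have [C C0 xiC] := taylor_bound i T0.
pose L := fine (mu A); have L0 : 0 <= L by rewrite fine_ge0.
have icst (c : R) : mu.-integrable (A : set X) (EFin \o (fun _ : X => c)).
  apply: measurable_bounded_integrable; [exact: mA|exact: A_fin|exact: measurable_cst|].
  exact: bounded_cst.
have step s d : 0 <= s -> 0 <= d -> s + d <= t -> `|y (s + d) - y s| <= C * d ^+ 2 * L.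
  move=> s0 d0 sdt.
  have Ts : test_function U (fun x => xi (x + s *: e)).
    by apply: Txi; rewrite s0/= (le_trans _ sdt)// lerDl.
  have Tsd : test_function U (fun x => xi (x + (s + d) *: e)).
    by apply: Txi; rewrite addr_ge0.
  have i1 := test_function_integrable Tsd mA.
  have i2 := test_function_integrable Ts mA.
  have i3 := integrableRZ mA d (test_function_integrable (test_function_partial i Ts) mA).
  have -> : y (s + d) - y s = \int[mu]_(x in (A : set X)) (xi (x + (s + d) *: e) - xi (x + s *: e)
      - d * partial i (fun y => xi (y + s *: e)) x).
    rewrite (RintegralB mA (integrableRB mA i1 i2) i3) (RintegralB mA i1 i2).
    rewrite (RintegralZl _ mA (test_function_integrable (test_function_partial i Ts) mA)).
    by rewrite (dA i Ts) mulr0 subr0.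
  have i4 := integrableRB mA (integrableRB mA i1 i2) i3.
  apply: le_trans (le_normr_Rintegral mA i4) _.
  rewrite -(Rintegral_cst mu mA); apply: (ae_le_Rintegral mA (integrableR_norm i4) (icst _)).
  apply: aeW => x _; rewrite partial_shift scalerDl addrA.
  exact: xiC.
have tele (N : nat) (d : R) : 0 <= d -> N%:R * d <= t ->
    `|y (N%:R * d) - y 0| <= N%:R * (C * d ^+ 2 * L).
  move=> d0; elim: N => [|N IH] Nt; first by rewrite !mul0r subrr normr0.
  have Nt' : N%:R * d <= t by apply: le_trans Nt; rewrite ler_wpM2r// ler_nat.
  have e1 : N.+1%:R * d = N%:R * d + d by rewrite -natr1 mulrDl mul1r.
  have h1 := IH Nt'; have Nd0 : 0 <= N%:R * d by rewrite mulr_ge0.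
  have h2 : `|y (N.+1%:R * d) - y (N%:R * d)| <= C * d ^+ 2 * L.
    by rewrite e1; apply: step => //; rewrite -e1.
  have -> : y (N.+1%:R * d) - y 0 = y (N%:R * d) - y 0 + (y (N.+1%:R * d) - y (N%:R * d)).
    by ring.
  apply: le_trans (ler_normD _ _) _; apply: le_trans (lerD h1 h2) _.
  by rewrite -natr1 mulrDl mul1r.
apply/eqP; rewrite -subr_eq0 -normr_le0; apply/ler_addgt0Pr => eps eps0; rewrite add0r.
pose K := C * t ^+ 2 * L; have K0 : 0 <= K by rewrite !mulr_ge0 ?sqr_ge0// ltW.
pose N := (Num.truncn (K / eps)).+1.
have N0 : 0 < N%:R :> R by [].
have := @tele N (t / N%:R); rewrite [N%:R * _]mulrC divfK ?gt_eqF// => /(_ _ _)/le_trans; apply => //.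
  by rewrite divr_ge0.
rewrite (_ : N%:R * _ = K / N%:R); last by rewrite /K; field; rewrite gt_eqF.
rewrite ler_pdivrMr// mulrC -ler_pdivrMr//; exact: ltW (truncnS_gt _).
Qed.

Lemma fine_measure_box_cvg a b :
  (fun k => \int[mu]_(x in (A : set X)) box_bump a b k x) @ \oo -->
  fine (mu (A `&` box (a, b))).
Proof.
have -> : fine (mu (A `&` box (a, b))) = \int[mu]_(x in (A : set X)) \1_(box (a, b)) x.
  by rewrite /Rintegral integral_indic//; [rewrite setIC|exact: measurable_box].
have icst : mu.-integrable (A : set X) (EFin \o (fun _ : X => 1 : R)).
  apply: measurable_bounded_integrable; [exact: mA|exact: A_fin|exact: measurable_cst|].
  exact: bounded_cst.
have mb k : measurable_fun (A : set X) (box_bump a b k : X -> R).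
  by apply: measurable_funTS; apply: measurable_fun_continuous; apply: smooth_continuous; exact: smooth_bump.
have mi : measurable_fun (A : set X) (\1_(box (a, b)) : X -> R).
  by apply: measurable_funTS; apply: measurable_indic; exact: measurable_box.
have [] := dominated_Rintegral mA mb mi icst _ _ => //.
- by apply: aeW => x _; exact: box_bump_cvg.
- by apply: aeW => x k _; rewrite ger0_norm ?bump_ge0// bump_le1.
Qed.

Lemma measure_box_translate (c d a b : E) i (t : R) : 0 <= t ->
  [set x : E | forall j, c 0 j < x 0 j < d 0 j] `<=` U ->
  (forall j, c 0 j < (a - t *: delta_mx 0 i) 0 j) -> (forall j, b 0 j < d 0 j) ->
  fine (mu (A `&` box (a - t *: delta_mx 0 i, b - t *: delta_mx 0 i))) =
  fine (mu (A `&` box (a, b))).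
Proof.
move=> t0 cdU ca bd; set e := delta_mx 0 i in ca *.
suff h : (fun k => \int[mu]_(x in (A : set X)) box_bump (a - t *: e) (b - t *: e) k x) @ \oo -->
    fine (mu (A `&` box (a, b))).
  have h' := @fine_measure_box_cvg (a - t *: e) (b - t *: e).
  by rewrite -(cvg_lim (@norm_hausdorff _ R^o) h') (cvg_lim (@norm_hausdorff _ R^o) h).
apply: cvg_trans (@fine_measure_box_cvg a b); apply: near_eq_cvg.
have sh k s x : box_bump a b k (x + s *: e) = box_bump (a - s *: e) (b - s *: e) k x.
  by rewrite /box_bump /bump_fun; apply: eq_bigr => j _; rewrite !mxE; congr (flat _ * flat _); ring.
have /choice[N_ NP] : forall j, exists N : nat, forall k, (N <= k)%N -> b 0 j + k.+1%:R^-1 < d 0 j.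
  move=> j; exists (Num.truncn ((d 0 j - b 0 j)^-1)) => k Nk.
  have db : 0 < d 0 j - b 0 j by rewrite subr_gt0.
  rewrite addrC -ltrBrDr -[ltRHS]invrK ltf_pV2 ?posrE ?invr_gt0//.
  by apply: lt_le_trans (truncnS_gt _) _; rewrite ler_nat ltnS.
exists (\max_j N_ j)%N; [exact: I|move=> k /= Nk].
rewrite -[LHS](Rintegral_translate (t := t) (i := i))//; last first.
  move=> s /andP[s0 st]; rewrite (_ : (fun x => _) = box_bump (a - s *: e) (b - s *: e) k); last first.
    by apply/funext => x; exact: sh.
  apply: test_bump; rewrite ?exprn_gt0//.
  apply: subset_trans cdU => x /= xab j.
  have := xab j; have := ca j; have := NP j k (leq_trans (leq_bigmax j) Nk).
  rewrite !mxE eqxx /=; case: (j == i) => /=; rewrite ?mulr1n ?mulr0n ?mulr1 ?mulr0 => h1 h2 /andP[h3 h4];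
    (apply/andP; split; first by lra);
    by apply: le_lt_trans h4 _; apply: le_lt_trans h1; rewrite lerD2r ?gerBl.
by apply: eq_Rintegral => x _; rewrite sh.
Qed.

End translation.

(** * Such a set is null or full in small boxes *)

Section dichotomy.
Context (R : realType) (n : nat).
Local Notation E := 'rV[R]_n.+1.
Local Notation X := (caratheodory_type (@leb_outer R n)).
Local Notation mu := (@leb R n).
Implicit Types (a b x : E) (i j : 'I_n.+1).

(** Additivity and nonnegativity make [g] monotone, hence linear. *)
Lemma additive_linear (g : R -> R) (l : R) :
  (forall s, 0 <= s <= l -> 0 <= g s) ->
  (forall s t, 0 <= s -> 0 <= t -> s + t <= l -> g (s + t) = g s + g t) ->
  forall s, 0 <= s <= l -> g s * l = g l * s.
Proof.
move=> g0 gD s /andP[s0 sl].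
have l0 : 0 <= l by exact: le_trans sl.
have gle s1 s2 : 0 <= s1 -> s1 <= s2 -> s2 <= l -> g s1 <= g s2.
  move=> s10 s12 s2l; rewrite -(subrKC s1 s2) gD ?subr_ge0//; last by rewrite subrKC.
  by rewrite lerDl g0// subr_ge0 s12/= (le_trans _ s2l)// gerBl.
have g00 : g 0 = 0 by have := gD 0 0; rewrite addr0 => /(_ (lexx _) (lexx _) l0); lra.
have gM (N : nat) (t : R) : 0 <= t -> N%:R * t <= l -> g (N%:R * t) = N%:R * g t.
  move=> t0; elim: N => [|N IH] Nt; first by rewrite !mul0r g00.
  have Nt' : N%:R * t <= l by apply: le_trans Nt; rewrite ler_wpM2r// ler_nat.
  by rewrite -natr1 !mulrDl !mul1r in Nt *; rewrite gD// ?mulr_ge0// IH.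
have gl0 : 0 <= g l by rewrite g0// l0 lexx.
have [sl'|] := eqVneq s l; first by rewrite sl'.
rewrite neq_lt [l < s]ltNge sl orbF => {}sl.
(* s lies between two consecutive multiples of l / N *)
have key (N : nat) : `|g s * l - g l * s| * N.+1%:R <= g l * l.
  have N0 : 0 < N.+1%:R :> R by [].
  set t := l / N.+1%:R; have tp : 0 < t by rewrite divr_gt0// (le_lt_trans s0).
  have t0 := ltW tp.
  have Nt : N.+1%:R * t = l by rewrite mulrC divfK// gt_eqF.
  have gt : N.+1%:R * g t = g l by rewrite -gM// Nt.
  pose k := Num.truncn (s / t).
  have st0 : 0 <= s / t by rewrite divr_ge0.
  have /andP[ks sk] : k%:R * t <= s < k.+1%:R * t.
    have := truncn_itv st0; rewrite -/k => /andP[h1 h2].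
    by rewrite -ler_pdivlMr// h1/= -ltr_pdivrMr.
  have kN : (k < N.+1)%N.
    by rewrite -(ltr_nat R) -(ltr_pM2r tp) Nt (le_lt_trans ks).
  have kl : k%:R * t <= l by apply: le_trans ks (ltW sl).
  have k1l : k.+1%:R * t <= l by rewrite -[leRHS]Nt ler_pM2r// ler_nat.
  have g1 : k%:R * g t <= g s by rewrite -gM//; apply: gle; rewrite ?mulr_ge0// ltW.
  have g2 : g s <= k.+1%:R * g t by rewrite -gM//; apply: gle => //; exact: ltW.
  rewrite -natr1 in g2 sk.
  have e1 : g s * l - g l * s = N.+1%:R * (g s * t - g t * s) by rewrite -gt -{1}Nt; ring.
  have e2 : g l * l = N.+1%:R * N.+1%:R * (g t * t) by rewrite -gt -{1}Nt; ring.
  have gt0 : 0 <= g t by apply: g0; rewrite t0/= -[leRHS]Nt ler_peMl// ler1n.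
  rewrite e1 e2 normrM (gtr0_norm N0) mulrAC.
  apply: ler_wpM2l; first by rewrite mulr_ge0// ltW.
  have h1 := ler_wpM2r t0 g1; have h2 := ler_wpM2r t0 g2.
  have h3 := ler_wpM2l gt0 ks; have h4 := ler_wpM2l gt0 (ltW sk).
  rewrite mulrCA in h3; rewrite mulrDl mul1r mulrDr mulrCA in h4.
  rewrite -mulrA in h1; rewrite mulrDl mul1r mulrDl -mulrA in h2.
  by rewrite ler_norml; lra.
apply/eqP; rewrite -subr_eq0 -normr_le0; apply/ler_addgt0Pr => e e0; rewrite add0r.
have := key (Num.truncn (g l * l / e)).
rewrite -ler_pdivlMr//; move/le_trans; apply.
rewrite ler_pdivrMr// [e * _]mulrC -ler_pdivrMr//; exact: ltW (truncnS_gt _).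
Qed.

Definition set_coord a i (s : R) : E := \row_j if j == i then s else a 0 j.

Lemma set_coord_id a i : set_coord a i (a 0 i) = a.
Proof. by apply/rowP => j; rewrite mxE; case: eqP => [->|]. Qed.

Lemma set_coordE a i s : set_coord a i s 0 i = s.
Proof. by rewrite mxE eqxx. Qed.

Variables (A : set E) (U : set E).
Hypotheses (mA : measurable (A : set X)) (A_fin : (mu A < +oo)%E).
Hypothesis dA : forall (xi : E -> R) i, test_function U xi ->
  \int[mu]_(x in (A : set X)) partial i xi x = 0.

Definition box_measure a b : R := fine (mu (A `&` box (a, b))).

Lemma box_measure_fin a b : mu (A `&` box (a, b)) = (box_measure a b)%:E.
Proof.
rewrite /box_measure fineK// ge0_fin_numE//.
by apply: le_lt_trans A_fin; apply: le_outer_measure; exact: subIsetl.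
Qed.

Lemma box_measureD a b i (s : R) : a 0 i <= s <= b 0 i ->
  box_measure a b = box_measure a (set_coord b i s) + box_measure (set_coord a i s) b.
Proof.
move=> /andP[as_ sb]; apply: EFin_inj; rewrite EFinD -!box_measure_fin.
rewrite -measureU.
- congr (mu _); apply/seteqP; split => x /=.
    move=> [Ax abx]; have [xs|sx] := leP (x 0 i) s; [left|right]; split=> // j; rewrite mxE;
    case: eqP => [->|_]; have := abx j; have := abx i => /= /andP[h1 h2]; rewrite ?h1 ?h2 ?xs ?sx//.
  move=> [[Ax abx]|[Ax abx]]; split=> // j; have := abx j; rewrite /= mxE; case: eqP => [->|//].
    by move=> /andP[-> h]; exact: le_trans sb.
  by move=> /andP[h ->]; rewrite (le_lt_trans as_).
- by apply: measurableI => //; exact: measurable_box.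
- by apply: measurableI => //; exact: measurable_box.
- apply/seteqP; split => // x [[_ /(_ i)] + [_ /(_ i)]] /=.
  by rewrite !mxE eqxx => /andP[_ h1] /andP[h2 _]; have := lt_le_trans h2 h1; rewrite ltxx.
Qed.

Variables (c d c' d' : E).
Hypotheses (c'd'U : [set x : E | forall j, c' 0 j < x 0 j < d' 0 j] `<=` U).
Hypotheses (cd : forall j, c 0 j < d 0 j) (c'c : forall j, c' 0 j < c 0 j)
  (dd' : forall j, d 0 j < d' 0 j).

(** By [measure_box_translate], the measure of the part of [A] in a slab depends
    only on the width of the slab in direction [i], and additively so. *)
Lemma box_measure_linear a b i : (forall j, c 0 j <= a 0 j) -> (forall j, b 0 j <= d 0 j) ->
  a 0 i <= b 0 i ->
  box_measure a b * (d 0 i - c 0 i) =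
  box_measure (set_coord a i (c 0 i)) (set_coord b i (d 0 i)) * (b 0 i - a 0 i).
Proof.
move=> ca bd ab.
pose F (r s : R) := box_measure (set_coord a i r) (set_coord b i s).
have F0 r s : 0 <= F r s by rewrite fine_ge0.
have Ftr r s : c 0 i <= r -> s <= d 0 i -> F r s = F (c 0 i) (c 0 i + (s - r)).
  move=> cr sd; have rc : 0 <= r - c 0 i by rewrite subr_ge0.
  rewrite /F /box_measure -(measure_box_translate mA A_fin dA (i := i) rc c'd'U).
  - congr (fine (mu (A `&` box (_, _)))); apply/rowP => j; rewrite !mxE eqxx/=;
    case: eqP => _ /=; rewrite ?mulr1n ?mulr0n ?mulr1 ?mulr0; ring.
  - move=> j; rewrite !mxE eqxx/=; case: eqP => [->|_] /=.
      by rewrite mulr1 subKr.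
    by rewrite mulr0 subr0; exact: lt_le_trans (ca j).
  - move=> j; rewrite mxE; case: eqP => [->|_]; first exact: le_lt_trans (dd' i).
    exact: le_lt_trans (dd' j).
have FD r s t : r <= s -> s <= t -> F r t = F r s + F s t.
  move=> rs st; rewrite /F (@box_measureD _ _ i s); last by rewrite !set_coordE rs.
  by congr (box_measure _ _ + box_measure _ _); apply/rowP => j; rewrite !mxE; case: eqP.
have := @additive_linear (fun s => F (c 0 i) (c 0 i + s)) (d 0 i - c 0 i).
rewrite subrKC => /(_ _ _ (b 0 i - a 0 i)); rewrite -(Ftr _ _ (ca i) (bd i)).
have -> : F (a 0 i) (b 0 i) = box_measure a b by rewrite /F !set_coord_id.
apply.
- by move=> s _; exact: F0.
- move=> s t s0 t0 st; rewrite (FD _ (c 0 i + s)) ?lerDl//; last by rewrite addrA lerDl.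
  congr (_ + _); rewrite [LHS]Ftr//.
  + by congr (F _ (_ + _)); ring.
  + by rewrite lerDl.
  + by rewrite -lerBrDl.
- by rewrite subr_ge0 ab lerB.
Qed.

(** The coordinates are changed one at a time. *)
Lemma box_measure_vol a b : (forall j, c 0 j <= a 0 j) -> (forall j, b 0 j <= d 0 j) ->
  (forall j, a 0 j <= b 0 j) ->
  box_measure a b * \prod_j (d 0 j - c 0 j) = box_measure c d * \prod_j (b 0 j - a 0 j).
Proof.
move=> ca bd ab.
pose mixl (s : seq 'I_n.+1) : E := \row_j if j \in s then a 0 j else c 0 j.
pose mixr (s : seq 'I_n.+1) : E := \row_j if j \in s then b 0 j else d 0 j.
have main s : uniq s -> box_measure (mixl s) (mixr s) * \prod_(j <- s) (d 0 j - c 0 j) =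
    box_measure c d * \prod_(j <- s) (b 0 j - a 0 j).
  elim: s => [_|i s IH /= /andP[iNs us]].
    by rewrite !big_nil; congr (box_measure _ _ * _); apply/rowP => j; rewrite mxE.
  rewrite !big_cons mulrA.
  have := @box_measure_linear (mixl (i :: s)) (mixr (i :: s)) i.
  rewrite !mxE mem_head => -> //; first last.
  - by move=> j; rewrite mxE; case: ifP.
  - by move=> j; rewrite mxE; case: ifP.
  have -> : set_coord (mixl (i :: s)) i (c 0 i) = mixl s.
    by apply/rowP => j; rewrite !mxE in_cons; case: eqP => [->|_]//=; rewrite (negbTE iNs).
  have -> : set_coord (mixr (i :: s)) i (d 0 i) = mixr s.
    by apply/rowP => j; rewrite !mxE in_cons; case: eqP => [->|_]//=; rewrite (negbTE iNs).
  by rewrite mulrAC IH// mulrAC mulrA.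
have := main (index_enum 'I_n.+1) (index_enum_uniq _).
have -> : mixl (index_enum 'I_n.+1) = a by apply/rowP => j; rewrite mxE mem_index_enum.
by have -> : mixr (index_enum 'I_n.+1) = b by apply/rowP => j; rewrite mxE mem_index_enum.
Qed.

(** If [A] has density theta > 0 in the box Q, then every box contained in Q
    has the same density. Hence boxes that cover A in Q have total volume at
    least |A| / theta = |Q|, so that A has the full measure of Q. *)
Lemma box_dichotomy : mu (A `&` box (c, d)) = 0%E \/ mu (box (c, d) `\` A) = 0%E.
Proof.
have [m0|m0] := eqVneq (box_measure c d) 0.
  by left; rewrite box_measure_fin m0.
right.
have {}m0 : 0 < box_measure c d by rewrite lt_neqAle eq_sym m0 fine_ge0.
pose V := \prod_j (d 0 j - c 0 j).
have V0 : 0 < V by apply: prodr_gt0 => j _; rewrite subr_gt0.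
pose theta := box_measure c d / V; have theta0 : 0 < theta by rewrite divr_gt0.
have vol_ge0 (ab : E * E) : 0 <= box_vol ab.
  by apply: prodr_ge0 => j _; rewrite le_max lexx.
have piece (ab : E * E) : (mu (A `&` box (c, d) `&` box ab) <= (theta * box_vol ab)%:E)%E.
  pose a' : E := \row_j Num.max (c 0 j) (ab.1 0 j).
  pose b' : E := \row_j Num.min (d 0 j) (ab.2 0 j).
  have -> : A `&` box (c, d) `&` box ab = A `&` box (a', b').
    rewrite -setIA; congr (A `&` _); apply/seteqP; split => x /=.
      move=> [h1 h2] j; rewrite !mxE gt_max le_min.
      by have /andP[-> ->] := h1 j; have /andP[-> ->] := h2 j.
    by move=> h; split=> j; have := h j; rewrite !mxE gt_max le_min => /andP[/andP[? ?] /andP[? ?]]; apply/andP.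
  have [ab'|] := pselect (forall j, a' 0 j <= b' 0 j).
    rewrite box_measure_fin lee_fin.
    have ca' j : c 0 j <= a' 0 j by rewrite mxE le_max lexx.
    have bd' j : b' 0 j <= d 0 j by rewrite mxE ge_min lexx.
    have := box_measure_vol ca' bd' ab'; rewrite -/V => e.
    have -> : box_measure a' b' = theta * \prod_j (b' 0 j - a' 0 j).
      by rewrite /theta mulrAC -e mulfK// gt_eqF.
    apply: ler_wpM2l; first exact: ltW.
    apply: ler_prod => j _; rewrite subr_ge0 ab'/= le_max; apply/orP; right.
    by rewrite !mxE lerB// ?ge_min ?le_max lexx orbT.
  move=> /existsNP[j /negP]; rewrite -ltNge => ba.
  rewrite (_ : A `&` _ = set0).
    by rewrite measure0 lee_fin mulr_ge0// ltW.
  apply/seteqP; split => // x [_ /(_ j)]/= /andP[h1 h2].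
  by have := lt_trans (lt_le_trans h1 h2) ba; rewrite ltxx.
have AQ : mu (A `&` box (c, d)) = (box_measure c d)%:E by exact: box_measure_fin.
have Vm : (V%:E <= mu (A `&` box (c, d)))%E.
  apply: le_ereal_inf_tmp => _ [F AF <-].
  have h1 : ((box_measure c d)%:E <= \sum_(k <oo) (theta * box_vol (F k))%:E)%E.
    rewrite -AQ; apply: (@le_trans _ _ (\sum_(k <oo) mu (A `&` box (c, d) `&` box (F k)))%E).
      apply: le_trans (outer_measure_sigma_subadditive (@leb_outer R n) _).
      by apply: le_outer_measure => x Ax; have [k _ Fk] := AF x Ax; exists k.
    by apply: lee_nneseries => [k _ _|k _]; [exact: outer_measure_ge0|exact: piece].
  have e : (\sum_(k <oo) (theta * box_vol (F k))%:E = theta%:E * \sum_(k <oo) (box_vol (F k))%:E)%E.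
    by rewrite -nneseriesZl// => k _; rewrite lee_fin.
  rewrite e in h1; rewrite -(@lee_pmul2l _ theta%:E)//.
  rewrite -EFinM (_ : theta * V = box_measure c d)//.
  by rewrite /theta divfK// gt_eqF.
have mQ : measurable (box (c, d) : set X) by exact: measurable_box.
have QV : (mu (box (c, d)) <= V%:E)%E.
  apply: le_trans (leb_box_le _) _; rewrite lee_fin /box_vol.
  by apply: ler_prod => j _; rewrite le_max lexx/= ge_max subr_ge0 ltW//=.
have QD : mu (box (c, d)) = (mu (box (c, d) `\` A) + (box_measure c d)%:E)%E.
  by rewrite -AQ setIC; exact: (measureDI mu mQ mA).
have : (mu (box (c, d) `\` A) + (box_measure c d)%:E <= 0 + (box_measure c d)%:E)%E.
  rewrite add0e -QD; apply: le_trans QV _; by rewrite -AQ.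
rewrite leeD2rE// => D0; apply/eqP; rewrite eq_le D0/=; exact: outer_measure_ge0.
Qed.

End dichotomy.

(** * Positivity of nonnegative solutions *)

Section positivity.
Context (R : realType) (n : nat).
Local Notation E := 'rV[R]_n.+1.
Local Notation X := (caratheodory_type (@leb_outer R n)).
Local Notation mu := (@leb R n).
Implicit Types (a b c d x : E) (S : set E) (Omega : set E).

Definition open_box a b : set E := [set x | forall j, a 0 j < x 0 j < b 0 j].

Lemma open_open_box a b : open (open_box a b).
Proof.
have -> : open_box a b = (bump_fun 1 1 a b : E -> R) @^-1` (~` [set 0]).
  apply/seteqP; split => x /=.
    by move=> abx; apply/eqP; rewrite gt_eqF// bump_gt0.
  by move=> /eqP; exact: bump_neq0.
apply: open_comp; last by apply: closed_openC; exact: closed_eq.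
by move=> x _; exact: (smooth_continuous (@smooth_bump R n 1 1 a b)).
Qed.

Lemma null_local S Omega :
  (forall x, Omega x -> exists c d, open_box c d x /\ leb_outer (S `&` box (c, d)) = 0%E) ->
  leb_outer (S `&` Omega) = 0%E.
Proof.
move=> loc; apply/eqP; rewrite eq_le outer_measure_ge0 andbT.
pose T k := if pselect (leb_outer (S `&` box (@rational_box R n k)) = 0%E)
  then S `&` box (@rational_box R n k) else set0.
apply: (@le_trans _ _ (leb_outer (\bigcup_k T k))).
  apply: le_outer_measure => x [Sx /loc[c [d [cdx null]]]].
  have [k kx kcd] := open_rational_box (@open_open_box c d) cdx.
  exists k => //; rewrite /T; case: pselect => // -[].
  apply/eqP; rewrite eq_le outer_measure_ge0 andbT -null.
  apply: le_outer_measure => y [Sy /kcd cdy]; split => // j.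
  by have /andP[-> /ltW] := cdy j.
apply: le_trans (outer_measure_sigma_subadditive _ _) _.
rewrite eseries0// => k _ _; rewrite /T; case: pselect => [//|nk].
exact: (outer_measure0 (@leb_outer R n)).
Qed.

Lemma flat_homo (s t : R) : s <= t -> flat s <= flat t.
Proof.
move=> st; rewrite /flat; case: ifPn => s0; last by case: ifP => // _; exact: expR_ge0.
have t0 : 0 < t by exact: lt_le_trans st.
by rewrite t0 ler_expR lerN2 lef_pV2.
Qed.

(** The product of the values flat r is a lower bound of the bump on the
    smaller box; dividing by it makes the function at least 1 there. *)
Lemma local_cutoff Omega x : open Omega -> Omega x ->
  exists2 r : R, 0 < r &
  exists2 phi, test_function Omega phi &
    forall y, open_box (x - const_mx r) (x + const_mx r) y -> Omega y /\ 1 <= `|phi y|.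
Proof.
move=> oO Ox; have /nbhs_ballP[e /= e0 eO] := open_nbhs_nbhs (conj oO Ox).
pose r := e / 3; have r0 : 0 < r by rewrite divr_gt0.
exists r => //.
pose a : E := x - const_mx (2 * r); pose b : E := x + const_mx (2 * r).
have abO : closed_box a b `<=` Omega.
  move=> y aby; apply: eO; split => // i j; rewrite ord1 /ball/=.
  by have := aby j; rewrite !mxE /r => /andP[h1 h2]; rewrite ltr_norml; apply/andP; split; lra.
pose K := \prod_(j < n.+1) (flat r * flat r).
have K0 : 0 < K by apply: prodr_gt0 => j _; rewrite mulr_gt0// flat_gt0.
exists (fun y => bump_fun 1 1 a b y * K^-1).
  by apply: test_function_mul; [exact: test_bump|exact: smooth_cst].
move=> y yr; split.
  by apply: abO => j; have := yr j; rewrite !mxE => /andP[h1 h2]; apply/andP; split; lra.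
rewrite ger0_norm; last by rewrite mulr_ge0 ?bump_ge0// invr_ge0 ltW.
rewrite ler_pdivlMr// mul1r; apply: ler_prod => j _.
rewrite mulr_ge0 ?flat_ge0//= !mul1r.
by apply: ler_pM; rewrite ?flat_ge0//; apply: flat_homo; have := yr j; rewrite !mxE; lra.
Qed.

Variables (Omega : set E) (p : R) (w : E -> R).
Hypotheses (oO : open Omega) (bO : bounded_set Omega) (cO : connected Omega) (p1 : 1 < p).
Hypothesis Aw : class_A Omega p w.
Local Notation O := (Omega : set X).

(** Around each point of Omega the set where v != 0 is null or full in some
    box, by [nonzero_set_derivative] and [box_dichotomy]. The points of
    either kind form an open set, and these two sets are disjoint because a
    nonempty box is not null. As Omega is connected, one of them is empty. *)
Lemma solution_positive (f v : E -> R) (g : E -> E) : W1p0 Omega p w v g -> L1 Omega f ->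
  (forall phi h, W1p0 Omega p w phi h ->
    (\int[mu]_(x in O) (w x * (enorm (g x) `^ (p - 2) * dot (g x) (h x)))%:E =
     \int[mu]_(x in O) (f x * (`|v x| `^ (p - 2) * v x) * phi x)%:E)%E) ->
  ae_in Omega (fun x => 0 <= f x) -> ae_in Omega (fun x => 0 <= v x) ->
  ~ ae_in Omega (fun x => v x = 0) -> ae_in Omega (fun x => v x != 0).
Proof.
move=> Wv Lf eqv f0 v0 vN0.
have mO : measurable O by exact: measurable_open.
have [mv _] := W1p0_mfun Wv.
have O_fin : (mu O < +oo)%E by exact: bounded_leb_lty.
pose A : set E := Omega `&` [set x | v x != 0].
have mA : measurable (A : set X).
  have -> : A = Omega `&` (v @^-1` (~` [set 0])).
    by apply/seteqP; split => x [? /= h]; split => //=; apply/eqP.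
  by apply: (mv mO); apply: measurableC; exact: measurable_set1.
have A_fin : (mu A < +oo)%E.
  by apply: le_lt_trans O_fin; apply: (le_outer_measure (@leb_outer R n)); exact: subIsetl.
have nonnull : exists S, leb_outer S <> 0%E.
  exists Omega => O0; apply: vN0; exists O; split => //.
  by move=> x /=; apply: contra_notP => xO Ox.
pose Z : set E := [set x | exists c d, open_box c d x /\ leb_outer (A `&` box (c, d)) = 0%E].
pose P : set E := [set x | exists c d, open_box c d x /\ leb_outer (~` A `&` box (c, d)) = 0%E].
have ZP x : Omega x -> Z x \/ P x.
  move=> Ox; have [r r0 [phi Tphi phiP]] := local_cutoff oO Ox.
  pose c' := x - const_mx r; pose d' := x + const_mx r.
  pose c := x - const_mx (r / 2); pose d := x + const_mx (r / 2).
  have cdx : open_box c d x by move=> j; rewrite !mxE; apply/andP; split; lra.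
  have dA (xi : E -> R) i : test_function (open_box c' d') xi ->
      \int[mu]_(y in (A : set X)) partial i xi y = 0.
    move=> Txi; have xiO : test_function Omega xi.
      by apply: test_function_sub Txi => y /phiP[].
    rewrite -[RHS](nonzero_set_derivative oO bO p1 Aw i Wv Lf eqv f0 v0 Tphi xiO).
      rewrite Rintegral_mkcondr; apply: eq_Rintegral => y _; rewrite patchE.
      case: ifPn => [|/negP]; rewrite inE/= => yv; first by rewrite yv mul1r.
      by move/negP : yv => /negbTE ->; rewrite mul0r.
    by move=> y y0; have [] := phiP y (test_function_in Txi y0).
  have [||||h|h] := @box_dichotomy R n A (open_box c' d') mA A_fin dA c d c' d' _ _ _ _.
  - by [].
  - by move=> j; rewrite !mxE; lra.
  - by move=> j; rewrite !mxE; lra.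
  - by move=> j; rewrite !mxE; lra.
  - by left; exists c, d.
  - by right; exists c, d; split => //; rewrite setIC -setDE.
have disj x : Z x -> P x -> False.
  move=> [c [d [cdx Z0]]] [c2 [d2 [cdx2 P0]]]; have [S] := nonnull; apply.
  pose a : E := \row_j Num.max (c 0 j) (c2 0 j).
  pose b : E := \row_j Num.min (d 0 j) (d2 0 j).
  apply: (@leb_null_box R n a b).
    move=> j; rewrite !mxE gt_max !lt_min.
    have /andP[h1 h2] := cdx j; have /andP[h3 h4] := cdx2 j.
    by rewrite (lt_trans h1 h2) (lt_trans h1 h4) (lt_trans h3 h2) (lt_trans h3 h4).
  apply/eqP; rewrite eq_le; apply/andP; split; last exact: (outer_measure_ge0 (@leb_outer R n)).
  have mAC : measurable (~` A : set X) by exact: measurableC.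
  have -> : mu (box (a, b)) = (mu (box (a, b) `\` A) + mu (box (a, b) `&` A))%E.
    by apply: (measureDI mu _ mA); exact: measurable_box.
  rewrite -[leRHS]adde0; apply: leeD.
    rewrite -P0; apply: (le_outer_measure (@leb_outer R n)) => y [yab nA]; split => // j.
    by have := yab j; rewrite !mxE gt_max le_min => /andP[/andP[_ ->] /andP[_ ->]].
  rewrite -Z0; apply: (le_outer_measure (@leb_outer R n)) => y [yab yA]; split => // j.
  by have := yab j; rewrite !mxE gt_max le_min => /andP[/andP[-> _] /andP[-> _]].
have opn (B : set E) : open [set x : E | exists c d, open_box c d x /\ leb_outer (B `&` box (c, d)) = 0%E].
  rewrite openE => x /= [c [d [cdx B0]]].
  have := open_nbhs_nbhs (conj (@open_open_box c d) cdx); apply: filterS => y cdy.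
  by exists c, d.
have [[x0 [Ox0 Px0]]|noP] := pselect (exists x, Omega x /\ P x).
  have PO : Omega `&` P = Omega.
    apply: cO; first by exists x0.
    - by exists P => //; exact: opn.
    - exists (~` Z); first exact/open_closedC/opn.
      apply/seteqP; split => x [Ox Px]; split => //.
        by move=> Zx; exact: disj Zx Px.
      by have [] := ZP x Ox.
  have null : leb_outer (~` A `&` Omega) = 0%E.
    by apply: null_local => x; rewrite -PO => -[].
  exists (~` A `&` Omega); split => //.
    by apply: measurableI => //; exact: measurableC.
  move=> x /= xv; have [Ox|nOx] := pselect (Omega x); last by exfalso; apply: xv => /nOx.
  by split => // -[_ /= v0x]; apply: xv.
exfalso; apply: vN0.
have null : leb_outer (A `&` Omega) = 0%E.
  apply: null_local => x Ox; have [//|Px] := ZP x Ox.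
  by exfalso; apply: noP; exists x.
exists (A `&` Omega); split => //; first exact: measurableI.
move=> x /= xv; have [Ox|nOx] := pselect (Omega x); last by exfalso; apply: xv => /nOx.
by split => //; split => //=; apply/eqP => vx; apply: xv.
Qed.

End positivity.

(** * The comparison principle *)

Section comparison.
Context (R : realType) (n : nat).
Local Notation E := 'rV[R]_n.+1.
Local Notation X := (caratheodory_type (@leb_outer R n)).
Local Notation mu := (@leb R n).
Variables (Omega : set E) (p : R).
Hypotheses (oO : open Omega) (bO : bounded_set Omega) (p1 : 1 < p).
Implicit Types (u v f w phi psi xi zeta : E -> R) (g h : E -> E).
Local Notation O := (Omega : set X).
Local Notation integrable f := (mu.-integrable O (EFin \o (f : X -> R))).
Local Notation mfun f := (measurable_fun O (f : X -> R)).

Let p0 : 0 < p. Proof. exact: lt_trans p1. Qed.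
Let mO : measurable O. Proof. exact: measurable_open. Qed.

Let eq_int f f' : f = f' ->
  (\int[mu]_(x in O) (f x)%:E = \int[mu]_(x in O) (f' x)%:E)%E.
Proof. by move=> ->. Qed.

Lemma test_function_opp phi : test_function Omega phi ->
  test_function Omega (fun x => - phi x) /\
  forall i x, partial i (fun x => - phi x) x = - partial i phi x.
Proof.
move=> Tphi; split.
  under eq_fun do rewrite -mulrN1.
  by apply: (test_function_mul Tphi); exact: smooth_cst.
move=> i x; have [Sphi _ _] := Tphi.
by have [_ e] := is_deriveN (smooth_is_derive i x Sphi); exact: e.
Qed.

Lemma L1loc_opp f : L1loc Omega f -> L1loc Omega (fun x => - f x).
Proof.
move=> [mf If]; split; first exact: (measurableT_comp (@oppr_measurable R setT) mf).
move=> K cK KO; have mK : measurable (K : set X).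
  exact: (measurable_closed (compact_closed (@norm_hausdorff _ _) cK)).
rewrite (_ : EFin \o _ = (fun x => (-1)%:E * (EFin \o f) x)%E); last first.
  by apply/funext => x; rewrite /= -EFinM mulN1r.
exact: (integrableZl mK (-1) (If K cK KO)).
Qed.

Lemma W1p0_opp w v g : W1p0 Omega p w v g ->
  W1p0 Omega p w (fun x => - v x) (fun x => - g x).
Proof.
have normN u' g' : sobolev_norm Omega p w (fun x => - u' x) (fun x => - g' x) =
    sobolev_norm Omega p w u' g'.
  pose N a b := ((\int[mu]_(x in O) a x + \int[mu]_(x in O) b x) `^ p^-1)%E.
  apply: (f_equal2 N); apply/funext => x; first by rewrite normrN.
  by rewrite enormN.
move=> [[[Lv Lg wg] sn] app]; split; first split.
- split; first exact: (L1loc_opp Lv).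
    move=> i; have := L1loc_opp (Lg i); congr (L1loc _ _).
    by apply/funext => x; rewrite mxE.
  move=> xi /test_function_opp[Txi dxi] i.
  apply: etrans (etrans (wg _ Txi i) _); last apply: f_equal; apply: eq_int; apply/funext => x.
    by rewrite dxi mulrN mulNr.
  by rewrite mxE mulrN mulNr.
- by rewrite normN.
move=> e e0; have [phi Tphi small] := app e e0.
have [TNphi dphi] := test_function_opp Tphi.
exists (fun x => - phi x); first exact: TNphi.
rewrite -normN (_ : (fun x => _) = (v \- phi)%R); last first.
  by apply/funext => x /=; rewrite opprB opprK addrC.
rewrite (_ : (fun x => _) = (g \- grad phi)%R) //.
by apply/funext => x; apply/rowP => i; rewrite !mxE dphi opprB opprK addrC.
Qed.

Lemma weak_solution_opp w f v : weak_solution Omega p w f v ->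
  weak_solution Omega p w f (fun x => - v x).
Proof.
move=> [g Wv eqv]; exists (fun x => - g x); first exact: W1p0_opp.
move=> phi h /W1p0_opp/eqv eq.
apply: etrans (etrans eq _); apply: eq_int; apply/funext => x.
  rewrite enormN; do 2! congr (_ * _).
  by rewrite /dot; apply: eq_bigr => i _; rewrite !mxE mulrN mulNr.
by rewrite normrN !mulrN mulNr.
Qed.

(** Lowering the weight lowers the norm, while the weak gradient and the test
    functions do not depend on the weight. *)
Lemma W1p0_le w1 w2 v g : class_A Omega p w1 -> class_A Omega p w2 ->
  ae_in Omega (fun x => w2 x <= w1 x) -> W1p0 Omega p w1 v g -> W1p0 Omega p w2 v g.
Proof.
move=> A1 A2 w21' [W1 app].
have w21 : {ae mu, forall x : X, Omega x -> w2 x <= w1 x} := w21'.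
have w2_gt0 : {ae mu, forall x : X, Omega x -> 0 < w2 x} by have [[]] := A2.
have mw2 : mfun w2 by have [[]] := A2.
have le g' : (forall i, mfun (fun x => g' x 0 i)) ->
    integrable (fun x => w1 x * enorm (g' x) `^ p) ->
    integrable (fun x => w2 x * enorm (g' x) `^ p) /\
    \int[mu]_(x in O) (w2 x * enorm (g' x) `^ p) <= \int[mu]_(x in O) (w1 x * enorm (g' x) `^ p).
  move=> mg' i1; have m2 := measurable_funM mw2 (measurable_powR_comp p (measurable_enorm mg')).
  have i2 : integrable (fun x => w2 x * enorm (g' x) `^ p).
    apply: (ae_le_integrable mO m2 i1); apply: filterS2 w21 w2_gt0 => x a b Ox.
    have {}a := a Ox; have {}b := b Ox.
    by rewrite ger0_norm ?mulr_ge0 ?powR_ge0 ?(ltW b)// ler_wpM2r ?powR_ge0.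
  split=> //; apply: (ae_le_Rintegral mO i2 i1); apply: filterS w21 => x + Ox => /(_ Ox) a.
  by rewrite ler_wpM2r ?powR_ge0.
have [wg iv ig] := (W1pP oO p1 A1 v g).1 W1.
have [mv mg] := weak_gradient_measurable wg.
split; first by apply/(W1pP oO p1 A2); split => //; exact: (le g mg ig).1.
move=> e e0; have [phi Tphi small] := app e e0; exists phi => //.
have md : mfun (v \- phi)%R.
  exact: (measurable_funB mv (test_function_measurable (D := O) Tphi)).
have mdg i : mfun (fun x => (g \- grad phi)%R x 0 i).
  rewrite (_ : (fun x => _) = (fun x => g x 0 i - grad phi x 0 i)).
    exact: (measurable_funB (mg i) (grad_test_mfun i Tphi)).
  by apply/funext => x; rewrite !mxE.
have [/(_ small)[i1 i2 i12] _] := sobolev_norm_ltP oO p1 A1 e0 md mdg.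
have [i3 i23] := le _ mdg i2.
apply/(sobolev_norm_ltP oO p1 A2 e0 md mdg); split => //.
by apply: le_lt_trans i12; rewrite lerD2l.
Qed.

Lemma cvg_powR (q : R) (y : nat -> R) (l : R) : 0 < q -> 0 <= l ->
  (forall k, 0 <= y k) -> y @ \oo --> l -> (fun k => y k `^ q) @ \oo --> l `^ q.
Proof.
move=> q0; rewrite le_eqVlt => /predU1P[<- y0 yl|l0 y0 yl].
  by rewrite powR0 ?gt_eqF//; exact: cvg0_powR.
apply: (@continuous_cvg nat R R \oo _ y (fun t : R => t `^ q) l _ yl).
apply/differentiable_continuous/derivable1_diffP.
by have [] := is_derive1_powR q l0.
Qed.

Lemma profile_ratio_cvg (t : R) : 0 < t ->
  (fun k : nat => t / (profile (k.+1%:R * t) / k.+1%:R)) @ \oo --> (1 : R).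
Proof.
move=> t0.
have k0 (k : nat) : 0 < k.+1%:R :> R by [].
have kt (k : nat) : 0 <= k.+1%:R * t by rewrite mulr_ge0// ltW.
have h : (fun k : nat => profile (k.+1%:R * t) / k.+1%:R - t) @ \oo --> (0 : R).
  apply: (@harmonic_cvg0 _ _ 4) => k.
    by rewrite subr_ge0 ler_pdivlMr// mulrC; exact: profile_ge.
  rewrite mulrBr mulrCA mulfV ?gt_eqF// mulr1 lerBlDl.
  exact: profile_le.
have ht : (fun k : nat => profile (k.+1%:R * t) / k.+1%:R) @ \oo --> t.
  rewrite (_ : (fun k => _) = (fun k : nat => (profile (k.+1%:R * t) / k.+1%:R - t) + t)).
    by rewrite -[X in _ --> X]add0r; apply: cvgD => //; exact: cvg_cst.
  by apply/funext => k; rewrite subrK.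
rewrite -[X in _ --> X](mulfV (lt0r_neq0 t0)); apply: cvgM; first exact: cvg_cst.
by apply: cvgV; [exact: lt0r_neq0|exact: ht].
Qed.

Variables w1 w2 f1 f2 u : E -> R.
Hypotheses (A1 : class_A Omega p w1) (A2 : class_A Omega p w2).
Hypothesis w21 : ae_in Omega (fun x => w2 x <= w1 x).
Hypotheses (Lf1 : L1 Omega f1) (Lf2 : L1 Omega f2).
Hypothesis f12 : ae_in Omega (fun x => 0 <= f1 x < f2 x).
Hypothesis sol_u : weak_solution Omega p w1 f1 u.
Hypothesis u_neq0 : ~ ae_in Omega (fun x => u x = 0).

(** Test functions psi_k that tend to u for the weight w2 are inserted into
    Picone's inequality for v. In the limit the energy of u for w2 is at least
    the integral of f2 |u| ^ p; it is at most its energy for w1, which equals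
    the integral of f1 |u| ^ p. As f1 < f2, u vanishes. *)
Lemma no_positive_solution v : weak_solution Omega p w2 f2 v ->
  ae_in Omega (fun x => 0 < v x) -> False.
Proof.
move=> [gv Wv eqv] v_gt0'.
have v_gt0 : {ae mu, forall x : X, Omega x -> 0 < v x} := v_gt0'.
have f12' : {ae mu, forall x : X, Omega x -> 0 <= f1 x < f2 x} := f12.
have w21' : {ae mu, forall x : X, Omega x -> w2 x <= w1 x} := w21.
have v_ge0 : ae_in Omega (fun x => 0 <= v x).
  by apply: filterS v_gt0 => x + Ox => /(_ Ox)/ltW.
have f2_ge0 : ae_in Omega (fun x => 0 <= f2 x).
  by apply: filterS f12' => x + Ox => /(_ Ox)/andP[? /ltW]; exact: le_trans.
have [gu Wu equ] := sol_u.
have Wu2 := W1p0_le A1 A2 w21 Wu.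
have w2_gt0 : {ae mu, forall x : X, Omega x -> 0 < w2 x} by have [[]] := A2.
have [mu_ mgu] := W1p0_mfun Wu; have [mv mgv] := W1p0_mfun Wv.
have [_ _ ig1] := (W1pP oO p1 A1 u gu).1 Wu.1.
have [_ _ ig2] := (W1pP oO p1 A2 u gu).1 Wu2.1.
have mf2 := integrable_measurable Lf2.
have [if1u eq1] := weak_solution_Rintegral oO p1 A1 Wu Lf1 equ Wu.
have f1uE x : f1 x * (`|u x| `^ (p - 2) * u x) * u x = f1 x * `|u x| `^ p.
  rewrite -(powRB2sqr p1 (normr_ge0 (u x))) real_normK ?num_real//.
  by rewrite expr2; ring.
have if1 : integrable (fun x => f1 x * `|u x| `^ p).
  by move: if1u; congr (is_true (_ _)); apply/funext => x /=; rewrite f1uE.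
have energy1 : \int[mu]_(x in O) (w1 x * enorm (gu x) `^ p) =
    \int[mu]_(x in O) (f1 x * `|u x| `^ p).
  transitivity (\int[mu]_(x in O) (w1 x * (enorm (gu x) `^ (p - 2) * dot (gu x) (gu x)))).
    by apply: eq_Rintegral => x _; rewrite -enorm_sqr powRB2sqr// enorm_ge0.
  by rewrite eq1; apply: eq_Rintegral => x _; rewrite f1uE.
have [psi [D [Tpsi iD psiP]]] := approx_ae oO p1 A2 Wu2.
have ipsi k := weight_grad_integrable oO p1 A2 (Tpsi k).
(* m = k + 1: the replacement h of v tends to v while psi k tends to u *)
pose F k x := f2 x * (v x / (profile (k.+1%:R * v x) / k.+1%:R)) `^ (p - 1) * `|psi k x| `^ p.
have l11 : 0 < (1 : R) <= 1 by rewrite ltr01 lexx.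
have picone k : integrable (F k) /\ \int[mu]_(x in O) F k x <=
    \int[mu]_(x in O) (w2 x * enorm (grad (psi k) x) `^ p).
  have k1 : 1 <= k.+1%:R :> R by rewrite ler1n.
  have [iF _] := weighted_picone oO bO p1 A2 Wv Lf2 eqv f2_ge0 v_ge0 (Tpsi k) k1 l11.
  by rewrite subrr !mul0r addr0 powR1 mul1r; split.
have cc : (fun k => \int[mu]_(x in O) (w2 x * enorm (grad (psi k) x) `^ p)) @ \oo -->
    \int[mu]_(x in O) (w2 x * enorm (gu x) `^ p).
  have iB := integrableRZ mO (2 `^ p) (integrableRD mO ig2 iD).
  apply: (proj2 (dominated_Rintegral mO (fun k => integrable_measurable (ipsi k))
    (integrable_measurable ig2) iB _ _)).
  - apply: filterS psiP => x + Ox => /(_ Ox)[_ cg _ _].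
    apply: cvgM; first exact: cvg_cst.
    apply: (cvg_powR p0 (enorm_ge0 _) (fun k => enorm_ge0 _)).
    apply/cvgrPdist_le => e e0; move/cvgrPdist_le: cg => /(_ e e0); apply: filterS => k.
    rewrite sub0r normrN ger0_norm ?enorm_ge0//; apply: le_trans.
    set a := gu x; set b := grad (psi k) x.
    have := enormD (a - b) b; rewrite subrK => le1.
    have := enormD (b - a) a; rewrite subrK -(enormN (b - a)) opprB => le2.
    by rewrite ler_norml; lra.
  - apply: filterS2 psiP w2_gt0 => x psix wx k Ox; have {}wx := wx Ox.
    have [_ _ /(_ k) wD _] := psix Ox.
    rewrite ger0_norm; last by rewrite mulr_ge0 ?powR_ge0// ltW.
    apply: (@le_trans _ _ (w2 x * (2 `^ p * (enorm (gu x) `^ p + enorm (gu x - grad (psi k) x) `^ p)))).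
      rewrite ler_pM2l//; apply: le_trans (powRD_le (ltW p0) (enorm_ge0 _) (enorm_ge0 _)).
      apply: ler_powRl; [exact: ltW|exact: enorm_ge0|].
      rewrite -[X in X <= _](_ : enorm (gu x - (gu x - grad (psi k) x)) = _); last by rewrite subKr.
      by apply: le_trans (enormD _ _) _; rewrite enormN.
    by rewrite mulrCA; apply: ler_wpM2l; [exact: powR_ge0|rewrite mulrDr lerD2l].
have mf2u : mfun (fun x => f2 x * `|u x| `^ p).
  exact: (measurable_funM mf2 (measurable_powR_comp p (measurable_norm mu_))).
have [if2 le2] : integrable (fun x => f2 x * `|u x| `^ p) /\
    \int[mu]_(x in O) (f2 x * `|u x| `^ p) <= \int[mu]_(x in O) (w2 x * enorm (gu x) `^ p).
  apply: (fatou_Rintegral mO (fun k => (picone k).1) mf2u _ _ (fun k => (picone k).2) cc).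
  - apply: filterS2 psiP v_gt0 => x psix vx Ox.
    have [cpsi _ _ _] := psix Ox; have {}vx := vx Ox.
    apply: cvgM; last by apply: cvg_powR => //; exact: cvg_norm.
    rewrite -[X in _ --> X]mulr1; apply: cvgM; first exact: cvg_cst.
    have p10 : 0 < p - 1 by rewrite subr_gt0.
    have := @cvg_powR (p - 1) (fun k : nat => v x / (profile (k.+1%:R * v x) / k.+1%:R)) 1 p10 ler01.
    rewrite powR1; apply; last exact: profile_ratio_cvg.
    by move=> k; rewrite !mulr_ge0 ?(ltW vx)// invr_ge0 mulr_ge0 ?invr_ge0// (le_trans ler01)// profile_ge1.
    have f20 : {ae mu, forall x : X, Omega x -> 0 <= f2 x} := f2_ge0.
    apply: filterS f20 => x f2x k Ox.
    by rewrite !mulr_ge0 ?powR_ge0// f2x.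
have w12 : \int[mu]_(x in O) (w2 x * enorm (gu x) `^ p) <=
    \int[mu]_(x in O) (w1 x * enorm (gu x) `^ p).
  apply: (ae_le_Rintegral mO ig2 ig1); apply: filterS w21' => x + Ox => /(_ Ox) a.
  by rewrite ler_wpM2r ?powR_ge0.
have i21 := integrableRB mO if2 if1.
have I21 : \int[mu]_(x in O) (f2 x * `|u x| `^ p - f1 x * `|u x| `^ p) <= 0.
  by rewrite (RintegralB mO if2 if1) subr_le0 -energy1; exact: le_trans w12.
have f21 : {ae mu, forall x : X, Omega x -> 0 <= f2 x * `|u x| `^ p - f1 x * `|u x| `^ p}.
  apply: filterS f12' => x + Ox => /(_ Ox)/andP[_ /ltW h].
  by rewrite -mulrBl mulr_ge0 ?powR_ge0// subr_ge0.
apply: u_neq0; apply: filterS2 (Rintegral_gt0_ae mO i21 f21 I21) f12' => x ux fx Ox.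
have /andP[_ f21x] := fx Ox; have := ux Ox; rewrite -mulrBl => /eqP.
rewrite mulf_eq0 subr_eq0 gt_eqF//= powR_eq0 normr_eq0 => /andP[/eqP -> _].
by [].
Qed.

Lemma no_nonneg_solution v : connected Omega -> weak_solution Omega p w2 f2 v ->
  ~ ae_in Omega (fun x => v x = 0) -> ~ ae_in Omega (fun x => 0 <= v x).
Proof.
move=> cO sol_v v_neq0 v_ge0'; apply: (no_positive_solution sol_v).
have v_ge0 : {ae mu, forall x : X, Omega x -> 0 <= v x} := v_ge0'.
have [g Wv eqv] := sol_v.
have f12' : {ae mu, forall x : X, Omega x -> 0 <= f1 x < f2 x} := f12.
have f2_ge0 : ae_in Omega (fun x => 0 <= f2 x).
  by apply: filterS f12' => x + Ox => /(_ Ox)/andP[? /ltW]; exact: le_trans.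
have vN0 : {ae mu, forall x : X, Omega x -> v x != 0} :=
  solution_positive oO bO cO p1 A2 Wv Lf2 eqv f2_ge0 v_ge0' v_neq0.
apply: filterS2 v_ge0 vN0 => x h1 h2 Ox.
by rewrite lt_neqAle eq_sym h2//= h1.
Qed.

End comparison.

Theorem theorem3p3 (R : realType) (n : nat) (p : R) (Omega : set 'rV[R]_n.+1)
    (w1 w2 f1 f2 u v : 'rV[R]_n.+1 -> R)
    (hp : 1 < p)
    (hOmega : bounded_smooth_domain Omega)
    (hw1 : class_A Omega p w1)
    (hw2 : class_As Omega p w2)
    (hw2s : exists s : R, As_exponent Omega p w2 s /\ n.+1%:R < p_sub p s)
    (hw : ae_in Omega (fun x => w2 x <= w1 x))
    (hf1 : L1 Omega f1)
    (hf2 : L1 Omega f2)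
    (hf : ae_in Omega (fun x => 0 <= f1 x < f2 x))
    (huW : exists g, W1p Omega p w1 u g)
    (hu : weak_solution Omega p w1 f1 u)
    (hu_ge0 : ae_in Omega (fun x => 0 <= u x))
    (hu_neq0 : ~ ae_in Omega (fun x => u x = 0))
    (hvW : exists g, W1p Omega p w2 v g)
    (hv : weak_solution Omega p w2 f2 v)
    (hv_neq0 : ~ ae_in Omega (fun x => v x = 0)) :
  changes_sign Omega v.
Proof.
have [oO _ cO bO _] := hOmega; have [A2 _] := hw2.
have main v' := @no_nonneg_solution R n Omega p oO bO hp w1 w2 f1 f2 u hw1 A2 hw
  hf1 hf2 hf hu hu_neq0 v' cO.
split; first exact: main hv hv_neq0.
move=> v_le0; apply: (main _ (weak_solution_opp hv)).
  move=> Nv0; apply: hv_neq0.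
  have {}Nv0 : {ae (@leb R n), forall x : caratheodory_type (@leb_outer R n),
    Omega x -> - v x = 0} := Nv0.
  by apply: filterS Nv0 => x + Ox => /(_ Ox)/eqP; rewrite oppr_eq0 => /eqP.
have {}v_le0 : {ae (@leb R n), forall x : caratheodory_type (@leb_outer R n),
  Omega x -> v x <= 0} := v_le0.
by apply: filterS v_le0 => x + Ox => /(_ Ox); rewrite oppr_ge0.
Qed.
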